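(* Let \[ \lambda_3=\frac12\left(2+\sqrt5-\sqrt{7+2\sqrt5}\right)\cong 0.4245 . \] For any real number $\xi$ which is not algebraic over $\mathbb{Q}$ of degree at most $3$, there exist a constant $c=c(\xi)>0$ and infinitely many algebraic integers $\alpha$ of degree at most $4$ satisfying \[ |\xi-\alpha|\le c\,H(\alpha)^{-(\lambda_3^{-1}+1)} \] (where $\lambda_3^{-1}+1\cong 3.3556$).
   Context: For an algebraic number $\alpha$, $H(\alpha)$ denotes its (naive) height, i.e. the maximum of the absolute values of the coefficients of its irreducible polynomial over $\mathbb{Z}$. The degree of $\alpha$ is its degree over $\mathbb{Q}$. *)

(* Defs.v *)
From HB Require Import structures.
From mathcomp Require Import all_boot all_order all_algebra.
From mathcomp Require Import all_classical all_reals all_analysis.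
From mathcomp Require Import complex.

Set Implicit Arguments.
Unset Strict Implicit.
Unset Printing Implicit Defensive.

Import Order.TTheory GRing.Theory Num.Theory.

Local Open Scope classical_set_scope.
Local Open Scope ring_scope.

(* Irreducible element of the ring Z[X]. The library's [irreducible_poly] only
   excludes divisors of other degrees up to constants, so it would accept
   non-primitive polynomials such as 2X + 2. *)
Definition irreducibleZX (P : {poly int}) : Prop :=
  [/\ P != 0, P \isn't a GRing.unit &
      forall A B : {poly int},
        P = A * B -> A \is a GRing.unit \/ B \is a GRing.unit].

(* For z algebraic, the irreducible polynomial over Z is unique up to sign; the
   sign is fixed by a positive leading coefficient. The value is 0 (junk) when
   z is not algebraic. *)
Definition irrpolyZ (F : numFieldType) (z : F) : {poly int} :=
  xget 0 [set P : {poly int} |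
    [/\ irreducibleZX P, 0 < lead_coef P & root (map_poly intr P) z]].

Definition height (F : numFieldType) (z : F) : nat :=
  (\max_(i < size (irrpolyZ z)) `|((irrpolyZ z)`_i)%R|)%N.

(* The value is 0 (junk) when z is not algebraic. *)
Definition minpolyQ (F : numFieldType) (z : F) : {poly rat} :=
  xget 0 [set p : {poly rat} |
    [/\ p \is monic, irreducible_poly p & root (map_poly ratr p) z]].

(* Meaningful only for algebraic z. *)
Definition degreeQ (F : numFieldType) (z : F) : nat := (size (minpolyQ z)).-1.

Definition algebraic_number (F : numFieldType) (z : F) : Prop :=
  algebraicOver (ratr : rat -> F) z.

Definition algebraic_integer (F : numFieldType) (z : F) : Prop :=
  integralOver (intr : int -> F) z.

Definition lambda3 (R : realType) : R :=
  2^-1 * (2 + Num.sqrt 5 - Num.sqrt (7 + 2 * Num.sqrt 5)).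

(* Main.v *)
Require Import Defs.
From mathcomp Require Import all_boot all_order all_algebra.
From mathcomp Require Import all_classical all_reals all_analysis.
From mathcomp Require Import complex.
From mathcomp Require Import ring lra zify.
Import Order.TTheory GRing.Theory Num.Theory.
Local Open Scope classical_set_scope.
Local Open Scope complex_scope.
Local Open Scope ring_scope.

Set Implicit Arguments.
Unset Strict Implicit.
Unset Printing Implicit Defensive.

(** The hypothesis on xi says that 1, xi, xi^2, xi^3 are linearly independent over
    the rationals.  For an integer point z = (z_0, z_1, z_2, z_3) let X z = |z_0|
    and let L z be the maximum of the |z_j - xi^j z_0|.

    The Diophantine half (uniform_exponent) produces arbitrarily large T such that
    no nonzero integer point has X z <= T and L z <= c T^(-lambda), where lambda
    is lambda3 and c a small constant.  If that fails, then the minimal points x_k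
    satisfy L x_k <= exp(-kappa) (X x_(k+1))^(-lambda) with kappa as large as
    desired.  A pair of points u, v is given a bracket (Cm u v, Cp u v), a pair of
    integers approximately proportional to (1, xi).  When three consecutive
    minimal points are independent (a turn), the bracket of the last two does not
    vanish (bracket0_large) beyond some rank, and the lower bound 1 for it links
    the sizes of the minimal points.  Three such points span a three-dimensional
    space; lambda3 is the critical exponent at which these inequalities forbid
    that two successive turns span the same space (growth_exponents, Delta_neq0).
    Hence a four by four determinant is a nonzero integer at every turn.  The
    resulting inequalities leave some room: they force the brackets at successive
    turns to be proportional (class_bounds).  All of them are then proportional to
    one pair of integers while they approximate (1, xi) better and better, so that
    xi is rational, a contradiction (turning_absurd).

    The second half is a duality.  For T as above a theorem of Hermite type on
    quadratic forms (hermite, transference) brings an integer polynomial of degree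
    at most 3 close to any real one: within O(1/T) for the value at xi and within
    O(T^lambda) for the coefficients.  This yields P = Y^4 + 2 + 4 Q with
    P(xi) = O(1/T), all coefficients O(T^lambda) and P'(xi) at least of order
    T^lambda (quartic_approximation).  As P is an Eisenstein polynomial at 2, the
    height of its roots is read off its coefficients, and some root is within
    4 |P(xi)/P'(xi)| = O(T^(-1-lambda)) of xi (near_root); with H = O(T^lambda) this
    is O(H^(-1-1/lambda)).  The heights are unbounded because |P'(xi)| is O(H). *)

(** * Determinants and brackets *)

Record vec (R : Type) := Vec { c0 : R; c1 : R; c2 : R; c3 : R }.

Section Vectors.
Variable R : comRingType.
Implicit Types (x y z w : vec R) (a b : R).

Definition comb a x b y :=
  Vec (a * c0 x + b * c0 y) (a * c1 x + b * c1 y)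
      (a * c2 x + b * c2 y) (a * c3 x + b * c3 y).

Definition dot x y := c0 x * c0 y + c1 x * c1 y + c2 x * c2 y + c3 x * c3 y.

Definition det3 (a1 a2 a3 b1 b2 b3 e1 e2 e3 : R) :=
  a1 * (b2 * e3 - b3 * e2) - b1 * (a2 * e3 - a3 * e2)
  + e1 * (a2 * b3 - a3 * b2).

(** The generalized vector product: dot (cross x y z) w is the determinant of
    x, y, z, w. *)
Definition cross x y z :=
  Vec (- det3 (c1 x) (c2 x) (c3 x) (c1 y) (c2 y) (c3 y) (c1 z) (c2 z) (c3 z))
      (det3 (c0 x) (c2 x) (c3 x) (c0 y) (c2 y) (c3 y) (c0 z) (c2 z) (c3 z))
      (- det3 (c0 x) (c1 x) (c3 x) (c0 y) (c1 y) (c3 y) (c0 z) (c1 z) (c3 z))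
      (det3 (c0 x) (c1 x) (c2 x) (c0 y) (c1 y) (c2 y) (c0 z) (c1 z) (c2 z)).

Definition det4 x y z w := dot (cross x y z) w.

(** The bracket of x and y.  With x^- = (c0, c1, c2) and x^+ = (c1, c2, c3), its
    components are det (x^-, x^+, y^-) and det (x^-, x^+, y^+).  For a point
    proportional to (1, xi, xi^2, xi^3) one has x^+ = xi x^-, which is why both
    components are small and why their ratio is close to xi. *)
Definition Cm x y :=
  det3 (c0 x) (c1 x) (c2 x) (c1 x) (c2 x) (c3 x) (c0 y) (c1 y) (c2 y).
Definition Cp x y :=
  det3 (c0 x) (c1 x) (c2 x) (c1 x) (c2 x) (c3 x) (c1 y) (c2 y) (c3 y).

(** The brackets of all bases of a plane are governed by the two brackets of one
    basis; in particular all of them vanish when these two do. *)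
Lemma Cm_comb a b e f x y :
  Cm (comb a x b y) (comb e x f y) = (a * f - b * e) * (a * Cm x y - b * Cm y x).
Proof. rewrite /Cm /det3 /=. ring. Qed.

Lemma Cp_comb a b e f x y :
  Cp (comb a x b y) (comb e x f y) = (a * f - b * e) * (a * Cp x y - b * Cp y x).
Proof. rewrite /Cp /det3 /=. ring. Qed.

Lemma cross_comb x y z w a b e f : 
  det4 w (comb a x b y) (comb e x f y) z = (a * f - b * e) * det4 w x y z.
Proof. rewrite /det4 /dot /cross /det3 /=. ring. Qed.

End Vectors.

(** * Size estimates *)

Section NormBounds.
Variable R : realFieldType.
Implicit Types a b A B : R.

Lemma normD_le a b A B : `|a| <= A -> `|b| <= B -> `|a + b| <= A + B.
Proof. by move=> ha hb; apply: (le_trans (ler_normD _ _)); apply: lerD. Qed.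

Lemma normB_le a b A B : `|a| <= A -> `|b| <= B -> `|a - b| <= A + B.
Proof. by move=> ha hb; apply: normD_le => //; rewrite normrN. Qed.

Lemma normM_le a b A B : `|a| <= A -> `|b| <= B -> `|a * b| <= A * B.
Proof. by move=> ha hb; rewrite normrM ler_pM. Qed.

Lemma det3_le (a1 a2 a3 b1 b2 b3 e1 e2 e3 A a B b E e : R) :
    `|a1| <= A -> `|a2| <= a -> `|a3| <= a ->
    `|b1| <= B -> `|b2| <= b -> `|b3| <= b ->
    `|e1| <= E -> `|e2| <= e -> `|e3| <= e ->
  `|det3 a1 a2 a3 b1 b2 b3 e1 e2 e3| <=
    2 * (A * b * e + B * a * e + E * a * b).
Proof.
move=> ha1 ha2 ha3 hb1 hb2 hb3 he1 he2 he3; rewrite /det3.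
have -> : 2 * (A * b * e + B * a * e + E * a * b) =
  A * (b * e + b * e) + B * (a * e + a * e) + E * (a * b + a * b) by ring.
by apply: normD_le; [apply: normB_le|];
  apply: normM_le => //; apply: normB_le; apply: normM_le.
Qed.

End NormBounds.

Section Approximation.
Variables (R : realType) (xi : R).
Implicit Types x y z w : vec R.

(** A point is measured by its height X and by its distance L to the line of
    (1, xi, xi^2, xi^3). *)
Definition d1 x := c1 x - xi * c0 x.
Definition d2 x := c2 x - xi ^+ 2 * c0 x.
Definition d3 x := c3 x - xi ^+ 3 * c0 x.
Definition L x := Num.max `|d1 x| (Num.max `|d2 x| `|d3 x|).
Definition X x := `|c0 x|.
Definition M : R := 1 + `|xi|.

Lemma L_le x e : (L x <= e) = [&& `|d1 x| <= e, `|d2 x| <= e & `|d3 x| <= e].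
Proof. by rewrite /L !ge_max. Qed.

Lemma d_le x : [/\ `|d1 x| <= L x, `|d2 x| <= L x & `|d3 x| <= L x].
Proof. by have := lexx (L x); rewrite L_le => /and3P. Qed.

Lemma L_ge0 x : 0 <= L x.
Proof. by case: (d_le x) => h _ _; apply: le_trans h. Qed.

Lemma X_ge0 x : 0 <= X x. Proof. exact: normr_ge0. Qed.

Lemma M_ge1 : 1 <= M. Proof. by rewrite lerDl. Qed.

Lemma M_ge0 : 0 <= M. Proof. exact: le_trans ler01 M_ge1. Qed.

Lemma xi_leM : `|xi| <= M. Proof. by rewrite lerDr. Qed.

(** The entries obtained from x^+ - xi x^- by subtracting xi and xi^2 times its
    first coordinate from the other two. *)
Lemma Delta_le x :
  [/\ `|d1 x| <= 2 * M ^+ 2 * L x,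
      `|d2 x - 2 * xi * d1 x| <= 2 * M ^+ 2 * L x &
      `|d3 x - xi * d2 x - xi ^+ 2 * d1 x| <= 2 * M ^+ 2 * L x].
Proof.
case: (d_le x) => h1 h2 h3; have L0 := L_ge0 x.
have := xi_leM; have := M_ge1; set m := M => m1 xim.
have x2 : `|xi ^+ 2| <= `|xi| ^+ 2 by rewrite normrX.
have xi0 := normr_ge0 xi.
have mE : m = 1 + `|xi| by [].
split.
- by apply: (le_trans h1); nra.
- apply: (le_trans (normB_le h2 (normM_le (normM_le (_ : `|2 : R| <= 2) (lexx `|xi|)) h1))).
    by rewrite ger0_norm.
  by nra.
- apply: (le_trans (normB_le (normB_le h3 (normM_le (lexx `|xi|) h2)) (normM_le x2 h1))).
  by nra.
Qed.

(** The determinant is det (x^-, x^+ - xi x^-, y^+ - xi y^-).  Subtracting from the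
    second and third columns xi and xi^2 times the first leaves a single large
    entry, c0 x. *)
Lemma Cp_xi_le x y : L x <= X x ->
  `|Cp x y - xi * Cm x y| <= 24 * M ^+ 4 * (X x * L x * L y).
Proof.
move=> LX; have -> : Cp x y - xi * Cm x y =
    det3 (c0 x) (d1 x) (d2 x)
         (d1 x) (d2 x - 2 * xi * d1 x) (d3 x - xi * d2 x - xi ^+ 2 * d1 x)
         (d1 y) (d2 y - 2 * xi * d1 y) (d3 y - xi * d2 y - xi ^+ 2 * d1 y).
  by rewrite /Cp /Cm /det3 /d1 /d2 /d3; ring.
case: (d_le x) => h1 h2 h3; case: (Delta_le x) => g1 g2 g3.
case: (Delta_le y) => k1 k2 k3.
have := det3_le (lexx (X x)) h1 h2 g1 g2 g3 k1 k2 k3.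
move=> /le_trans; apply.
have M0 : 0 <= M ^+ 4 by rewrite exprn_ge0 ?M_ge0.
have P : 0 <= M ^+ 4 * L x * L y.
  by rewrite mulr_ge0 ?L_ge0 // mulr_ge0 ?L_ge0.
have {P LX} := ler_wpM2l P LX; set u := M ^+ 4 * _ * _ => P.
rewrite -subr_ge0; have -> : 24 * M ^+ 4 * (X x * L x * L y) -
    2 * (X x * (2 * M ^+ 2 * L x) * (2 * M ^+ 2 * L y) +
      2 * M ^+ 2 * L x * L x * (2 * M ^+ 2 * L y) +
      2 * M ^+ 2 * L y * L x * (2 * M ^+ 2 * L x)) =
    16 * (u * X x - u * L x).
  by rewrite /u; ring.
by rewrite mulr_ge0 // subr_ge0.
Qed.

Lemma Cm_le x y : L x <= X x ->
  `|Cm x y| <= 8 * M ^+ 2 * (X x * L x * L y + X y * L x ^+ 2).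
Proof.
move=> LX; have -> : Cm x y =
    det3 (c0 x) (d1 x) (d2 x)
         (d1 x) (d2 x - 2 * xi * d1 x) (d3 x - xi * d2 x - xi ^+ 2 * d1 x)
         (c0 y) (d1 y) (d2 y).
  by rewrite /Cp /Cm /det3 /d1 /d2 /d3; ring.
case: (d_le x) => h1 h2 h3; case: (Delta_le x) => g1 g2 g3.
case: (d_le y) => k1 k2 k3.
have := det3_le (lexx (X x)) h1 h2 g1 g2 g3 (lexx (X y)) k1 k2.
move=> /le_trans; apply.
have M0 : 0 <= M ^+ 2 by rewrite exprn_ge0 ?M_ge0.
have P : 0 <= M ^+ 2 * L x * L y.
  by rewrite mulr_ge0 ?L_ge0 // mulr_ge0 ?L_ge0.
have Q : 0 <= M ^+ 2 * X y * L x ^+ 2.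
  by rewrite mulr_ge0 ?exprn_ge0 ?L_ge0 // mulr_ge0 ?X_ge0.
have {P LX} := ler_wpM2l P LX; set u := M ^+ 2 * _ * _ => P.
rewrite -subr_ge0; have -> : 8 * M ^+ 2 * (X x * L x * L y + X y * L x ^+ 2) -
    2 * (X x * (2 * M ^+ 2 * L x) * L y + 2 * M ^+ 2 * L x * L x * L y +
         X y * L x * (2 * M ^+ 2 * L x)) =
    4 * (u * X x - u * L x) + 4 * (M ^+ 2 * X y * L x ^+ 2).
  by rewrite /u; ring.
by rewrite addr_ge0 // mulr_ge0 // subr_ge0.
Qed.

Lemma Cp_le x y : L x <= X x ->
  `|Cp x y| <= 32 * M ^+ 4 * (X x * L x * L y + X y * L x ^+ 2).
Proof.
move=> LX; have -> : Cp x y = (Cp x y - xi * Cm x y) + xi * Cm x y by ring.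
apply: (le_trans (normD_le (Cp_xi_le y LX) (normM_le xi_leM (Cm_le y LX)))).
have M0 : 0 <= M ^+ 2 * X x * L x * L y + M ^+ 2 * X y * L x ^+ 2.
  by rewrite addr_ge0 // !mulr_ge0 // ?exprn_ge0 ?L_ge0 ?X_ge0 ?M_ge0.
have N0 : 0 <= M ^+ 4 * X y * L x ^+ 2.
  by rewrite !mulr_ge0 // ?exprn_ge0 ?L_ge0 ?X_ge0 ?M_ge0.
have M1 : 0 <= M ^+ 2 - M by have := M_ge1; nra.
rewrite -subr_ge0; set s := (X in 0 <= X).
have -> : s = 8 * ((M ^+ 2 - M) * (M ^+ 2 * X x * L x * L y + M ^+ 2 * X y * L x ^+ 2))
    + 24 * (M ^+ 4 * X y * L x ^+ 2) by rewrite /s; ring.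
by rewrite addr_ge0 // mulr_ge0 // mulr_ge0.
Qed.

(** In a coordinate that involves the first column, the other two columns may be
    reduced by multiples of that column; every term then has one factor X and two
    factors L, and the largest one takes X at z and L at x and y. *)
Lemma cross_le x y z :
    X x <= X y -> X y <= X z -> L y <= L x -> L z <= L y ->
  [/\ `|c1 (cross x y z)| <= 6 * (X z * L x * L y),
      `|c2 (cross x y z)| <= 6 * (X z * L x * L y) &
      `|c3 (cross x y z)| <= 6 * (X z * L x * L y)].
Proof.
move=> xy yz yx zy.
case: (d_le x) => x1 x2 x3; case: (d_le y) => y1 y2 y3; case: (d_le z) => z1 z2 z3.
have Lx := L_ge0 x; have Ly := L_ge0 y; have Lz := L_ge0 z.
have Xx := X_ge0 x; have Xy := X_ge0 y; have Xz := X_ge0 z.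
have key : 2 * (X x * L y * L z + X y * L x * L z + X z * L x * L y)
    <= 6 * (X z * L x * L y).
  have h1 : X x * L y * L z <= X z * L x * L y.
    rewrite mulrAC; apply: ler_pM => //; rewrite ?mulr_ge0 //.
    by apply: ler_pM => //; [apply: le_trans yz | apply: le_trans yx].
  have h2 : X y * L x * L z <= X z * L x * L y.
    by apply: ler_pM => //; rewrite ?mulr_ge0 // ler_wpM2r.
  lra.
split; rewrite /cross /=.
- have -> : det3 (c0 x) (c2 x) (c3 x) (c0 y) (c2 y) (c3 y) (c0 z) (c2 z) (c3 z) =
     det3 (c0 x) (d2 x) (d3 x) (c0 y) (d2 y) (d3 y) (c0 z) (d2 z) (d3 z).
    by rewrite /det3 /d2 /d3; ring.
  by apply: le_trans key; apply: det3_le.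
- have -> : det3 (c0 x) (c1 x) (c3 x) (c0 y) (c1 y) (c3 y) (c0 z) (c1 z) (c3 z) =
     det3 (c0 x) (d1 x) (d3 x) (c0 y) (d1 y) (d3 y) (c0 z) (d1 z) (d3 z).
    by rewrite /det3 /d1 /d3; ring.
  by rewrite normrN; apply: le_trans key; apply: det3_le.
- have -> : det3 (c0 x) (c1 x) (c2 x) (c0 y) (c1 y) (c2 y) (c0 z) (c1 z) (c2 z) =
     det3 (c0 x) (d1 x) (d2 x) (c0 y) (d1 y) (d2 y) (c0 z) (d1 z) (d2 z).
    by rewrite /det3 /d1 /d2; ring.
  by apply: le_trans key; apply: det3_le.
Qed.

(** A vector is also read as the coefficient list of a polynomial of degree at
    most 3, here evaluated at xi. *)
Definition ceval b := c0 b + c1 b * xi + c2 b * xi ^+ 2 + c3 b * xi ^+ 3.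

Lemma dotE b x :
  dot b x = c0 x * ceval b + (c1 b * d1 x + c2 b * d2 x + c3 b * d3 x).
Proof. by rewrite /dot /ceval /d1 /d2 /d3; ring. Qed.

Lemma dot_tail_le b x B : `|c1 b| <= B -> `|c2 b| <= B -> `|c3 b| <= B ->
  `|c1 b * d1 x + c2 b * d2 x + c3 b * d3 x| <= 3 * (B * L x).
Proof.
move=> b1 b2 b3; case: (d_le x) => x1 x2 x3.
have -> : 3 * (B * L x) = B * L x + B * L x + B * L x by ring.
by do 2?[apply: normD_le]; apply: normM_le.
Qed.

Lemma det4_le x y z w :
    X x <= X y -> X y <= X z -> X z <= X w ->
    L y <= L x -> L z <= L y -> L w <= L z ->
  `|det4 x y z w| <= 24 * (X w * L x * L y * L z).
Proof.
move=> xy yz zw yx zy wz; rewrite /det4 dotE.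
case: (d_le x) => x1 x2 x3; case: (d_le y) => y1 y2 y3; case: (d_le z) => z1 z2 z3.
have Lx := L_ge0 x; have Ly := L_ge0 y; have Lz := L_ge0 z.
have -> : ceval (cross x y z) =
    - det3 (d1 x) (d2 x) (d3 x) (d1 y) (d2 y) (d3 y) (d1 z) (d2 z) (d3 z).
  by rewrite /ceval /cross /= /det3 /d1 /d2 /d3; ring.
have [b1 b2 b3] := cross_le xy yz yx zy.
apply: (le_trans (normD_le (normM_le (lexx (X w)) _) (dot_tail_le w b1 b2 b3))).
  by rewrite normrN; apply: det3_le x1 x2 x3 y1 y2 y3 z1 z2 z3.
have : X z * L x * L y * L w <= X w * L x * L y * L z.
  by apply: ler_pM; rewrite ?L_ge0 ?mulr_ge0 ?X_ge0 //; do 2?apply: ler_wpM2r.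
lra.
Qed.

End Approximation.

(** * Integer points *)

Section Integrality.
Variable R : realType.
Implicit Types (x y z : vec R) (a b : R).

Definition intv x :=
  [&& c0 x \is a Num.int, c1 x \is a Num.int,
      c2 x \is a Num.int & c3 x \is a Num.int].

Definition vec0 : vec R := Vec 0 0 0 0.

Definition rnd a : R := (Num.floor (a + 2^-1))%:~R.

Lemma rnd_int a : rnd a \is a Num.int. Proof. exact: intr_int. Qed.

Lemma rnd_le a : `|a - rnd a| <= 2^-1.
Proof.
have h1 := floor_le (a + 2^-1); have h2 := floorD1_gt (a + 2^-1).
rewrite intrD in h2; rewrite /rnd ler_norml.
by apply/andP; split; lra.
Qed.

Lemma rnd_min a b : b \is a Num.int -> `|a - rnd a| <= `|a - b|.
Proof.
move=> bi; have [-> //|ne] := eqVneq b (rnd a).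
have h := rnd_le a.
have : 1 <= `|b - rnd a| by rewrite norm_intr_ge1 ?subr_eq0 // rpredB ?rnd_int.
have -> : b - rnd a = (a - rnd a) - (a - b) by ring.
move=> /le_trans /(_ (ler_normB _ _)) h'; lra.
Qed.

Lemma intv_comb a b x y : a \is a Num.int -> b \is a Num.int ->
  intv x -> intv y -> intv (comb a x b y).
Proof.
by move=> ai bi /and4P[? ? ? ?] /and4P[? ? ? ?]; rewrite /intv /=;
  rewrite !(rpredD, rpredM).
Qed.

Lemma det3_int (a1 a2 a3 b1 b2 b3 e1 e2 e3 : R) :
  a1 \is a Num.int -> a2 \is a Num.int -> a3 \is a Num.int ->
  b1 \is a Num.int -> b2 \is a Num.int -> b3 \is a Num.int ->
  e1 \is a Num.int -> e2 \is a Num.int -> e3 \is a Num.int ->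
  det3 a1 a2 a3 b1 b2 b3 e1 e2 e3 \is a Num.int.
Proof. by move=> *; rewrite /det3 !(rpredD, rpredB, rpredM, rpredN). Qed.

Lemma intv_cross x y z : intv x -> intv y -> intv z -> intv (cross x y z).
Proof.
move=> /and4P[? ? ? ?] /and4P[? ? ? ?] /and4P[? ? ? ?].
by rewrite /intv /= !rpredN !det3_int.
Qed.

Lemma dot_int x y : intv x -> intv y -> dot x y \is a Num.int.
Proof.
by move=> /and4P[? ? ? ?] /and4P[? ? ? ?]; rewrite /dot !(rpredD, rpredM).
Qed.

Lemma Cm_int x y : intv x -> intv y -> Cm x y \is a Num.int.
Proof. by move=> /and4P[? ? ? ?] /and4P[? ? ? ?]; rewrite /Cm det3_int. Qed.

Lemma Cp_int x y : intv x -> intv y -> Cp x y \is a Num.int.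
Proof. by move=> /and4P[? ? ? ?] /and4P[? ? ? ?]; rewrite /Cp det3_int. Qed.

Lemma vec_eqP x y : c0 x = c0 y -> c1 x = c1 y -> c2 x = c2 y -> c3 x = c3 y ->
  x = y.
Proof. by case: x => ? ? ? ?; case: y => ? ? ? ? /= -> -> -> ->. Qed.

Definition w01 x y := c0 x * c1 y - c1 x * c0 y.
Definition w02 x y := c0 x * c2 y - c2 x * c0 y.
Definition w03 x y := c0 x * c3 y - c3 x * c0 y.

(** For points with nonzero first coordinate this is linear independence; it is
    enough to look at the minors that involve the first coordinate. *)
Definition slope_neq x y := [|| w01 x y != 0, w02 x y != 0 | w03 x y != 0].

Lemma cross0_comb x y z : slope_neq x y -> cross x y z = vec0 ->
  exists a b, z = comb a x b y.
Proof.
move=> h [e0 e1 e2 e3].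
case/or3P: h => h.
- exists (w01 z y / w01 x y), (w01 x z / w01 x y).
  apply: vec_eqP; rewrite /= /w01 /det3 in h e0 e1 e2 e3 *; apply: (mulfI h).
  + by field.
  + by field.
  + by apply/eqP; rewrite -subr_eq0 -[X in _ == X]e3; apply/eqP; field.
  + apply/eqP; rewrite -subr_eq0 -[X in _ == X]oppr0 -[X in _ == - X]e2; apply/eqP; field.
    done.
- exists (w02 z y / w02 x y), (w02 x z / w02 x y).
  apply: vec_eqP; rewrite /= /w02 /det3 in h e0 e1 e2 e3 *; apply: (mulfI h).
  + by field.
  + by apply/eqP; rewrite -subr_eq0 -[X in _ == X]oppr0 -[X in _ == - X]e3; apply/eqP; field.
  + by field.
  + by apply/eqP; rewrite -subr_eq0 -[X in _ == X]e1; apply/eqP; field.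
- exists (w03 z y / w03 x y), (w03 x z / w03 x y).
  apply: vec_eqP; rewrite /= /w03 /det3 in h e0 e1 e2 e3 *; apply: (mulfI h).
  + by field.
  + by apply/eqP; rewrite -subr_eq0 -[X in _ == X]e2; apply/eqP; field.
  + by apply/eqP; rewrite -subr_eq0 -[X in _ == X]oppr0 -[X in _ == - X]e1; apply/eqP; field.
  + by field.
Qed.

End Integrality.

(** * Minimal points *)

Section MinimalSequence.
Variables (R : realType) (xi : R).
Notation L := (L xi).
Notation d1 := (d1 xi).
Notation d2 := (d2 xi).
Notation d3 := (d3 xi).

(** The successive records of L: no nonzero integer point of height below that of
    x_(k+1) comes closer to the line than x_k. *)
Record minimal_sequence (x : nat -> vec R) : Prop := MinimalSequence {
  ms_int : forall k, intv (x k);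
  ms_gt0 : forall k, 0 < c0 (x k);
  ms_X : forall k, X (x k) < X (x k.+1);
  ms_L : forall k, L (x k.+1) < L (x k);
  ms_min : forall k z, intv z -> X z < X (x k.+1) -> L z < L (x k) ->
    z = @vec0 R }.

Lemma L_comb a b x y : L (comb a x b y) <= `|a| * L x + `|b| * L y.
Proof.
rewrite L_le; case: (d_le xi x) => x1 x2 x3; case: (d_le xi y) => y1 y2 y3.
apply/and3P; split.
- have -> : d1 (comb a x b y) = a * d1 x + b * d1 y by rewrite /d1 /=; ring.
  by apply: normD_le; apply: normM_le.
- have -> : d2 (comb a x b y) = a * d2 x + b * d2 y by rewrite /d2 /=; ring.
  by apply: normD_le; apply: normM_le.
- have -> : d3 (comb a x b y) = a * d3 x + b * d3 y by rewrite /d3 /=; ring.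
  by apply: normD_le; apply: normM_le.
Qed.

Lemma X_comb (a b : R) x y : X (comb a x b y) <= `|a| * X x + `|b| * X y.
Proof. by apply: normD_le; apply: normM_le. Qed.

Variable x : nat -> vec R.
Hypothesis hx : minimal_sequence x.

Lemma ms_Xgt0 k : 0 < X (x k).
Proof. by rewrite normr_gt0 gt_eqF // ms_gt0. Qed.

Lemma ms_Lgt0 k : 0 < L (x k).
Proof. exact: le_lt_trans (L_ge0 _ _) (ms_L hx k). Qed.

(** The area of x_k and x_(k+1) is comparable to X x_(k+1) * L x_k.  When the
    height at least triples, the second product dominates in the minor of the
    coordinate where L x_k is attained.  Otherwise x_(k+1) - x_k has a smaller height
    than x_(k+1), so by minimality its distance to the line is at least L x_k. *)
Lemma wedge_lower k W :
    `|w01 (x k) (x k.+1)| <= W -> `|w02 (x k) (x k.+1)| <= W ->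
    `|w03 (x k) (x k.+1)| <= W ->
  X (x k.+1) * L (x k) <= 3 * W.
Proof.
have -> : w01 (x k) (x k.+1) = c0 (x k) * d1 (x k.+1) - c0 (x k.+1) * d1 (x k).
  by rewrite /w01 /d1; ring.
have -> : w02 (x k) (x k.+1) = c0 (x k) * d2 (x k.+1) - c0 (x k.+1) * d2 (x k).
  by rewrite /w02 /d2; ring.
have -> : w03 (x k) (x k.+1) = c0 (x k) * d3 (x k.+1) - c0 (x k.+1) * d3 (x k).
  by rewrite /w03 /d3; ring.
move=> h1 h2 h3.
have p0 := ms_gt0 hx k; have p1 := ms_gt0 hx k.+1.
have l0 := ms_Lgt0 k; have l1 := ms_L hx k; have lt := ms_X hx k.
rewrite /X !gtr0_norm // in lt *.
have [a1 a2 a3] := d_le xi (x k); have [b1 b2 b3] := d_le xi (x k.+1).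
have [big|small] := leP (3 * c0 (x k)) (c0 (x k.+1)).
  have key (d d' : R) : `|c0 (x k) * d' - c0 (x k.+1) * d| <= W ->
      `|d'| <= L (x k.+1) -> L (x k) <= `|d| -> c0 (x k.+1) * L (x k) <= 3 * W.
    move=> hW hd' hd.
    have : c0 (x k.+1) * `|d| - c0 (x k) * `|d'| <= W.
      apply: le_trans hW; rewrite distrC; apply: le_trans (lerB_dist _ _).
      by rewrite !normrM !(gtr0_norm (ms_gt0 hx _)).
    nra.
  have : L (x k) <= L (x k) by [].
  rewrite {2}/L !le_max => /or3P[] h.
  - exact: key h1 b1 h.
  - exact: key h2 b2 h.
  - exact: key h3 b3 h.
pose z := comb 1 (x k.+1) (-1) (x k).
have zi : intv z by apply: intv_comb; rewrite ?rpredN ?rpred1 ?(ms_int hx).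
have zX : X z < X (x k.+1).
  rewrite /X /z /= (gtr0_norm p1) ltr_norml; apply/andP; split; lra.
have : L (x k) <= L z.
  rewrite leNgt; apply/negP => /(ms_min hx zi zX) [/eqP + _ _ _].
  by rewrite mul1r mulN1r subr_eq0 => /eqP; lra.
have key (d d' : R) : `|c0 (x k) * d' - c0 (x k.+1) * d| <= W ->
    `|d| <= L (x k) -> `|d'| <= L (x k.+1) -> L (x k) <= `|d' - d| ->
    c0 (x k.+1) * L (x k) <= 3 * W.
  rewrite !ler_norml => /andP[u1 u2] /andP[v1 v2] /andP[t1 t2].
  by case: (lerP 0 (d' - d)) => s; rewrite ?(ger0_norm s) ?(ltr0_norm s) => r; nra.
rewrite {2}/L !le_max => /or3P[].
- have -> : d1 z = d1 (x k.+1) - d1 (x k) by rewrite /d1 /z /=; ring.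
  exact: key.
- have -> : d2 z = d2 (x k.+1) - d2 (x k) by rewrite /d2 /z /=; ring.
  exact: key.
- have -> : d3 z = d3 (x k.+1) - d3 (x k) by rewrite /d3 /z /=; ring.
  exact: key.
Qed.

Lemma ms_slope k : slope_neq (x k) (x k.+1).
Proof.
rewrite /slope_neq; apply/negPn/negP; rewrite !negb_or !negbK.
case/and3P => /eqP e1 /eqP e2 /eqP e3.
have := @wedge_lower k 0; rewrite e1 e2 e3 normr0 lexx mulr0 => /(_ isT isT isT).
by rewrite leNgt mulr_gt0 ?ms_Xgt0 ?ms_Lgt0.
Qed.

(** Subtracting the nearest integer combination leaves coefficients of absolute
    value at most 1/2, hence an integer point that contradicts minimality unless it
    is zero. *)
Lemma ms_basis k a b :
  intv (comb a (x k) b (x k.+1)) -> a \is a Num.int /\ b \is a Num.int.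
Proof.
move=> zi; pose t := comb (a - rnd a) (x k) (b - rnd b) (x k.+1).
have ti : intv t.
  have -> : t = comb 1 (comb a (x k) b (x k.+1)) (-1)
                  (comb (rnd a) (x k) (rnd b) (x k.+1)).
    by apply: vec_eqP; rewrite /t /=; ring.
  apply: intv_comb; rewrite ?rpredN ?rpred1 //.
  by apply: intv_comb; rewrite ?rnd_int ?(ms_int hx).
have ha := rnd_le a; have hb := rnd_le b.
have l0 := ms_Lgt0 k; have l1 := ms_L hx k; have lt := ms_X hx k.
have q0 := ms_Xgt0 k; have l2 := ms_Lgt0 k.+1.
have tX : X t < X (x k.+1).
  by apply: (le_lt_trans (X_comb _ _ _ _)); nra.
have tL : L t < L (x k).
  by apply: (le_lt_trans (L_comb _ _ _ _)); nra.
case: (ms_min hx ti tX tL) => e0 e1 e2 e3.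
have ab (p q r s : R) : (a - rnd a) * p + (b - rnd b) * q = 0 ->
    (a - rnd a) * r + (b - rnd b) * s = 0 -> p * s - r * q != 0 ->
    a \is a Num.int /\ b \is a Num.int.
  move=> h1 h2 h3.
  have /eqP : (a - rnd a) * (p * s - r * q) = 0.
    transitivity (((a - rnd a) * p + (b - rnd b) * q) * s -
      ((a - rnd a) * r + (b - rnd b) * s) * q); first by ring.
    by rewrite h1 h2; ring.
  rewrite mulf_eq0 (negbTE h3) orbF subr_eq0 => /eqP ->.
  have /eqP : (b - rnd b) * (p * s - r * q) = 0.
    transitivity (((a - rnd a) * r + (b - rnd b) * s) * p -
      ((a - rnd a) * p + (b - rnd b) * q) * r); first by ring.
    by rewrite h1 h2; ring.
  rewrite mulf_eq0 (negbTE h3) orbF subr_eq0 => /eqP ->.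
  by rewrite !rnd_int.
by case/or3P: (ms_slope k); [apply: (ab _ _ _ _ e0 e1) | apply: (ab _ _ _ _ e0 e2)
  | apply: (ab _ _ _ _ e0 e3)].
Qed.

Definition turn k := cross (x k) (x k.+1) (x k.+2) <> @vec0 R.

(** Both (x_k, x_(k+1)) and (x_(k+1), x_(k+2)) are bases of the integer points of
    the same plane, so the transition matrix is unimodular. *)
Lemma non_turn k : ~ turn k -> exists s m : R,
  [/\ x k.+2 = comb s (x k) m (x k.+1), m \is a Num.int & s = 1 \/ s = -1].
Proof.
move=> /contrapT /(cross0_comb (ms_slope k)) [a [b E]].
have [ai bi] : a \is a Num.int /\ b \is a Num.int.
  by apply: (@ms_basis k); rewrite -E (ms_int hx).
exists a, b; split => //.
have a0 : a != 0.
  apply/eqP => a0; have := ms_slope k.+1.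
  rewrite /slope_neq.
  have -> : w01 (x k.+1) (x k.+2) = 0 by rewrite E a0 /w01 /=; ring.
  have -> : w02 (x k.+1) (x k.+2) = 0 by rewrite E a0 /w02 /=; ring.
  have -> : w03 (x k.+1) (x k.+2) = 0 by rewrite E a0 /w03 /=; ring.
  by rewrite eqxx.
have E' : x k = comb (- b / a) (x k.+1) a^-1 (x k.+2).
  by rewrite E; apply: vec_eqP => /=; field.
have [_ ai'] : - b / a \is a Num.int /\ a^-1 \is a Num.int.
  by apply: (@ms_basis k.+1); rewrite -E' (ms_int hx).
have h1 := norm_intr_ge1 ai a0.
have h2 : 1 <= `|a^-1| by rewrite norm_intr_ge1 // invr_eq0.
have h3 : `|a^-1| * `|a| = 1 by rewrite -normrM mulVf ?normr1.
have /eqP : `|a| = 1 by nra.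
by rewrite eqr_norml ler01 andbT => /orP[/eqP|/eqP]; [left|right].
Qed.

Lemma plane_basis k l : (forall j, (j < l)%N -> ~ turn (k + j)) ->
  exists a b e f : R,
  [/\ x (k + l)%N = comb a (x k) b (x k.+1),
      x (k + l).+1 = comb e (x k) f (x k.+1),
      [/\ a \is a Num.int, b \is a Num.int, e \is a Num.int & f \is a Num.int]
    & a * f - b * e = 1 \/ a * f - b * e = -1].
Proof.
elim: l => [|l IH] h.
  exists 1, 0, 0, 1; split; last by left; ring.
  - by rewrite addn0; apply: vec_eqP => /=; ring.
  - by rewrite addn0; apply: vec_eqP => /=; ring.
  - by split; rewrite ?rpred0 ?rpred1.
have [j jl|a [b [e [f [Ea Ee [ai bi ei fi] D]]]]] := IH; first exact/h/ltnW.
have [s [m [E mi sD]]] := non_turn (h l (leqnn _)).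
have si : s \is a Num.int by case: sD => ->; rewrite ?rpredN rpred1.
exists e, f, (s * a + m * e), (s * b + m * f); split.
- by rewrite addnS.
- by rewrite addnS E Ea Ee; apply: vec_eqP => /=; ring.
- by split; rewrite // rpredD // rpredM.
- have -> : e * (s * b + m * f) - f * (s * a + m * e) = - s * (a * f - b * e) by ring.
  by case: sD => ->; case: D => ->; [right|left|left|right]; ring.
Qed.

End MinimalSequence.

Section Growth.
Variables (R : realType) (xi : R) (x : nat -> vec R).
Hypothesis hx : minimal_sequence xi x.

Lemma ms_Xge k : k%:R <= X (x k).
Proof.
elim: k => [|k IH]; first exact: X_ge0.
have ik j : X (x j) \is a Num.int.
  by rewrite /X gtr0_norm ?(ms_gt0 hx) //; case/and4P: (ms_int hx j).
have : 1 <= `|X (x k.+1) - X (x k)|.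
  by rewrite norm_intr_ge1 ?rpredB // subr_eq0 gt_eqF // (ms_X hx).
rewrite gtr0_norm ?subr_gt0 ?(ms_X hx) // -natr1; lra.
Qed.

Lemma ms_Xge1 k : 1 <= X (x k).
Proof.
rewrite /X; case/and4P: (ms_int hx k) => h _ _ _.
by rewrite norm_intr_ge1 // gt_eqF // (ms_gt0 hx).
Qed.

Lemma ms_lnX (B : R) : exists k0, forall k, (k0 <= k)%N -> B <= ln (X (x k)).
Proof.
exists (Num.truncn (expR B)).+1 => k hk.
rewrite -[B]expRK ler_ln ?posrE ?expR_gt0 ?(ms_Xgt0 hx) //.
apply: le_trans (ms_Xge k); apply/ltW/(lt_le_trans (truncnS_gt _)).
by rewrite ler_nat.
Qed.

End Growth.

(** * Recurrences of order two *)

(** If (x0, x1, x2, x3) is a geometric progression of ratio p/q in lowest terms,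
    then q^3 divides x0.  One factor q is gained at a time by expanding a power of
    the Bezout relation u q + v p = 1: every term carries a factor q except the
    last one, which contains x2 or x3 and is divisible by q as well. *)
Lemma geometric_denominator (x0 x1 x2 x3 : int) :
    x0 != 0 -> x0 * x2 = x1 * x1 -> x0 * x3 = x1 * x2 ->
  exists p q g : int, x0 = q ^+ 3 * g /\ q * x1 = p * x0.
Proof.
move=> x0n h2 h3.
have [u [v uv]] := Bezoutz x0 x1; set g := gcdz x0 x1 in uv.
have gn : g != 0 by rewrite gcdz_eq0 negb_and x0n.
have /dvdzP[q qE] : (g %| x0)%Z by apply: dvdz_gcdl.
have /dvdzP[p pE] : (g %| x1)%Z by apply: dvdz_gcdr.
have qn : q != 0 by apply: contra_neq x0n => q0; rewrite qE q0 mul0r.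
have b1 : u * q + v * p = 1.
  by apply: (mulIf gn); rewrite mul1r -[RHS]uv qE pE; ring.
have k2 : q * x2 = g * p ^+ 2.
  by apply: (mulIf gn); transitivity (x0 * x2); [rewrite qE|rewrite h2 pE]; ring.
have k3 : q * x3 = p * x2.
  by apply: (mulIf gn); transitivity (x0 * x3); [rewrite qE|rewrite h3 {1}pE]; ring.
pose g1 := g * (u ^+ 2 * q + 2 * u * v * p) + v ^+ 2 * x2.
have g1E : g = q * g1.
  transitivity (g * (u * q + v * p) ^+ 2); first by rewrite b1 expr1n mulr1.
  rewrite /g1; transitivity (q * (g * (u ^+ 2 * q + 2 * u * v * p)) + v ^+ 2 * (g * p ^+ 2)); first by ring.
  by rewrite -k2; ring.
have k2' : x2 = g1 * p ^+ 2.
  by apply: (mulfI qn); rewrite k2 g1E; ring.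
have k3' : q * x3 = g1 * p ^+ 3 by rewrite k3 k2'; ring.
pose g2 := g1 * (u ^+ 3 * q ^+ 2 + 3 * u ^+ 2 * v * q * p + 3 * u * v ^+ 2 * p ^+ 2) + v ^+ 3 * x3.
have g2E : g1 = q * g2.
  transitivity (g1 * (u * q + v * p) ^+ 3); first by rewrite b1 expr1n mulr1.
  rewrite /g2; transitivity (q * (g1 * (u ^+ 3 * q ^+ 2 + 3 * u ^+ 2 * v * q * p + 3 * u * v ^+ 2 * p ^+ 2)) + v ^+ 3 * (g1 * p ^+ 3)); first by ring.
  by rewrite -k3'; ring.
exists p, q, g2; split; first by rewrite qE g1E g2E; ring.
by rewrite {1}pE qE; ring.
Qed.

Lemma primitive_part (A0 A1 A2 : int) : [|| A0 != 0, A1 != 0 | A2 != 0] ->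
  exists g a0 a1 a2 u0 u1 u2 : int,
  [/\ A0 = g * a0, A1 = g * a1, A2 = g * a2, g != 0 &
      u0 * a0 + u1 * a1 + u2 * a2 = 1].
Proof.
move=> h.
have [u [v uv]] := Bezoutz A0 A1; set e := gcdz A0 A1 in uv.
have [s [t st]] := Bezoutz e A2; set g := gcdz e A2 in st.
have gn : g != 0.
  by rewrite gcdz_eq0 /e gcdz_eq0 -andbA !negb_and.
have /dvdzP[f fE] : (g %| e)%Z by apply: dvdz_gcdl.
have /dvdzP[a2 a2E] : (g %| A2)%Z by apply: dvdz_gcdr.
have /dvdzP[f0 f0E] : (e %| A0)%Z by apply: dvdz_gcdl.
have /dvdzP[f1 f1E] : (e %| A1)%Z by apply: dvdz_gcdr.
exists g, (f0 * f), (f1 * f), a2, (s * u), (s * v), t; split => //.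
- by rewrite {1}f0E fE; ring.
- by rewrite {1}f1E fE; ring.
- by rewrite {1}a2E mulrC.
- apply: (mulIf gn); rewrite mul1r -[RHS]st -uv f0E f1E fE a2E; ring.
Qed.

Section Hankel.
Variable R : comRingType.
Implicit Types x y z : vec R.

(** The vector product of x^- and x^+, up to sign: the two by two minors of the
    Hankel matrix of x, and the coefficients of the bracket as a form in y. *)
Definition hk0 x := c1 x * c3 x - c2 x * c2 x.
Definition hk1 x := c2 x * c1 x - c0 x * c3 x.
Definition hk2 x := c0 x * c2 x - c1 x * c1 x.
Definition nondeg x := [|| hk0 x != 0, hk1 x != 0 | hk2 x != 0].

Lemma CmE x y : Cm x y = hk0 x * c0 y + hk1 x * c1 y + hk2 x * c2 y.
Proof. by rewrite /Cm /det3 /hk0 /hk1 /hk2; ring. Qed.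

Lemma CpE x y : Cp x y = hk0 x * c1 y + hk1 x * c2 y + hk2 x * c3 y.
Proof. by rewrite /Cp /det3 /hk0 /hk1 /hk2; ring. Qed.

(** If a vector is orthogonal to x, y and z, it is parallel to their vector
    product: each minor of b and cross x y z is a three by three determinant with
    a column dot b x, dot b y, dot b z. *)
Lemma cross_parallel b x y z : dot b x = 0 -> dot b y = 0 -> dot b z = 0 ->
  let v := cross x y z in
  [/\ c1 v * c0 b = c0 v * c1 b, c2 v * c0 b = c0 v * c2 b,
      c3 v * c0 b = c0 v * c3 b & 
   [/\ c2 v * c1 b = c1 v * c2 b,
      c3 v * c1 b = c1 v * c3 b & c3 v * c2 b = c2 v * c3 b]].
Proof.
move=> hx hy hz v.
have key (p q : vec R -> R) (s : R) :
    s = det3 (dot b x) (p x) (q x) (dot b y) (p y) (q y) (dot b z) (p z) (q z) ->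
    s = 0.
  by move=> ->; rewrite hx hy hz /det3; ring.
split; last split; apply/eqP; rewrite -subr_eq0; apply/eqP.
- by apply: (key (@c2 R) (@c3 R)); rewrite /dot /det3 /v /=; rewrite /det3; ring.
- by apply: (key (@c3 R) (@c1 R)); rewrite /dot /det3 /v /=; rewrite /det3; ring.
- by apply: (key (@c1 R) (@c2 R)); rewrite /dot /det3 /v /=; rewrite /det3; ring.
- by apply: (key (@c0 R) (@c3 R)); rewrite /dot /det3 /v /=; rewrite /det3; ring.
- by apply: (key (@c2 R) (@c0 R)); rewrite /dot /det3 /v /=; rewrite /det3; ring.
- by apply: (key (@c0 R) (@c1 R)); rewrite /dot /det3 /v /=; rewrite /det3; ring.
Qed.

End Hankel.

Section HankelBounds.
Variables (R : realType) (xi : R).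
Notation L := (L xi).
Notation M := (M xi).
Implicit Types x y z : vec R.

Lemma shift_le x :
  [/\ `|c1 x - xi * c0 x| <= M * L x, `|c2 x - xi * c1 x| <= M * L x &
      `|c3 x - xi * c2 x| <= M * L x].
Proof.
case: (d_le xi x) => h1 h2 h3; have L0 := L_ge0 xi x.
have ME : M = 1 + `|xi| by [].
have xi0 := normr_ge0 xi.
split.
- by apply: (le_trans h1); nra.
- have -> : c2 x - xi * c1 x = d2 xi x - xi * d1 xi x by rewrite /d1 /d2; ring.
  apply: (le_trans (normB_le h2 (normM_le (lexx `|xi|) h1))); nra.
- have -> : c3 x - xi * c2 x = d3 xi x - xi * d2 xi x by rewrite /d3 /d2; ring.
  apply: (le_trans (normB_le h3 (normM_le (lexx `|xi|) h2))); nra.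
Qed.

Lemma coord_le x : L x <= X x ->
  [/\ `|c1 x| <= M * X x, `|c2 x| <= M ^+ 2 * X x & `|c3 x| <= M ^+ 3 * X x].
Proof.
case: (d_le xi x) => h1 h2 h3 LX.
have ME : M = 1 + `|xi| by []; have xi0 := normr_ge0 xi.
have X0 := X_ge0 x; have u0 : 0 <= `|xi| * X x by rewrite mulr_ge0.
have v0 : 0 <= `|xi| ^+ 2 * X x by rewrite mulr_ge0 ?exprn_ge0.
rewrite ME; split.
- have -> : c1 x = xi * c0 x + d1 xi x by rewrite /d1; ring.
  apply: (le_trans (normD_le (normM_le (lexx `|xi|) (lexx (X x))) h1)); lra.
- have -> : c2 x = xi ^+ 2 * c0 x + d2 xi x by rewrite /d2; ring.
  apply: (le_trans (normD_le (normM_le (lexx `|xi ^+ 2|) (lexx (X x))) h2)).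
  by rewrite normrX; lra.
- have -> : c3 x = xi ^+ 3 * c0 x + d3 xi x by rewrite /d3; ring.
  apply: (le_trans (normD_le (normM_le (lexx `|xi ^+ 3|) (lexx (X x))) h3)).
  by rewrite normrX; lra.
Qed.

Lemma minor_le (a b e f A B E F : R) :
    `|a| <= A -> `|b| <= B -> `|e| <= E -> `|f| <= F ->
  `|a * b - e * f| <= A * B + E * F.
Proof. by move=> *; apply: normB_le; apply: normM_le. Qed.

Lemma hk_le x : L x <= X x ->
  [/\ `|hk0 x| <= 2 * M ^+ 3 * (X x * L x), `|hk1 x| <= 2 * M ^+ 3 * (X x * L x) &
      `|hk2 x| <= 2 * M ^+ 3 * (X x * L x)].
Proof.
move=> LX; case: (shift_le x) => h1 h2 h3; case: (coord_le LX) => k1 k2 k3.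
have M1 := M_ge1 xi; have XL : 0 <= X x * L x by rewrite mulr_ge0 ?L_ge0 ?X_ge0.
have MM : M <= M ^+ 3 by rewrite ler_eXnr.
have MM2 : M ^+ 2 <= M ^+ 3 by rewrite ler_weXn2l.
split.
- have -> : hk0 x = c1 x * (c3 x - xi * c2 x) - c2 x * (c2 x - xi * c1 x).
    by rewrite /hk0; ring.
  apply: (le_trans (minor_le k1 h3 k2 h2)).
  have -> : M * X x * (M * L x) + M ^+ 2 * X x * (M * L x) =
    (M ^+ 2 + M ^+ 3) * (X x * L x) by ring.
  by apply: ler_wpM2r => //; lra.
- have -> : hk1 x = c2 x * (c1 x - xi * c0 x) - c0 x * (c3 x - xi * c2 x).
    by rewrite /hk1; ring.
  apply: (le_trans (minor_le k2 h1 (lexx (X x)) h3)).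
  have -> : M ^+ 2 * X x * (M * L x) + X x * (M * L x) =
    (M ^+ 3 + M) * (X x * L x) by ring.
  by apply: ler_wpM2r => //; lra.
- have -> : hk2 x = c0 x * (c2 x - xi * c1 x) - c1 x * (c1 x - xi * c0 x).
    by rewrite /hk2; ring.
  apply: (le_trans (minor_le (lexx (X x)) h2 k1 h1)).
  have -> : X x * (M * L x) + M * X x * (M * L x) =
    (M + M ^+ 2) * (X x * L x) by ring.
  by apply: ler_wpM2r => //; lra.
Qed.

Variable x : nat -> vec R.
Hypothesis hx : minimal_sequence xi x.

(** If x_(k+1) is degenerate, its coordinates form a geometric progression of ratio
    p/q with q^3 at most X x_(k+1).  The integers q y_(j+1) - p y_j, where y is
    x_k, are of size at most about q * L x_k, and they cannot all vanish since x_k and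
    x_(k+1) are independent.  So q is at least about 1 / L x_k. *)
Lemma deg_large k : L (x k) <= X (x k) -> ~~ nondeg (x k.+1) ->
  1 <= X (x k.+1) * (2 * M ^+ 2 * L (x k)) ^+ 3.
Proof.
move=> LX; rewrite /nondeg !negb_or !negbK => /and3P[/eqP e0 /eqP e1 /eqP e2].
have := ms_slope hx k; have := ms_X hx k; have := ms_L hx k.
have := ms_gt0 hx k.+1.
have := ms_int hx k; have := ms_int hx k.+1.
move: (x k) (x k.+1) LX e0 e1 e2 => y z LX e0 e1 e2.
case/and4P => z0 z1 z2 z3 /and4P[y0 y1 y2 y3] zp LL XX sl.
have [a0 a0E] := intrP z0; have [a1 a1E] := intrP z1.
have [a2 a2E] := intrP z2; have [a3 a3E] := intrP z3.
have [p [q [g [E1 E2]]]] : exists p q g : int, a0 = q ^+ 3 * g /\ q * a1 = p * a0.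
  apply: (@geometric_denominator a0 a1 a2 a3).
  - by apply: contraTneq zp => a00; rewrite a0E a00 ltxx.
  - apply: (@intr_inj R); rewrite !intrM -a0E -a1E -a2E.
    by have := e2; rewrite /hk2; lra.
  - apply: (@intr_inj R); rewrite !intrM -a0E -a1E -a2E -a3E.
    by have := e1; rewrite /hk1; lra.
have zn : c0 z != 0 by rewrite gt_eqF.
have qn : (q%:~R : R) != 0.
  by apply: contra_neq zn => q0; rewrite a0E E1 intrM rmorphXn /= q0 expr0n mul0r.
have gn : (g%:~R : R) != 0.
  by apply: contra_neq zn => g0; rewrite a0E E1 intrM g0 mulr0.
have E2' : q%:~R * c1 z = p%:~R * c0 z :> R by rewrite a1E a0E -!intrM E2.
have qX : `|q%:~R : R| ^+ 3 <= X z.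
  rewrite /X a0E E1 intrM rmorphXn /= normrM normrX ler_peMr ?exprn_ge0 //.
  by rewrite norm_intr_ge1 ?intr_int.
have [h1 h2 h3] := shift_le y; have [k1 k2 _] := coord_le LX.
have [dz _ _] := d_le xi z.
have M1 := M_ge1 xi; have M0 := M_ge0 xi.
have X0 : 0 < X z by rewrite normr_gt0.
have Ly0 := L_ge0 xi y; have Lz0 := L_ge0 xi z; have Xy0 := X_ge0 y.
have K (s t : R) : `|t - xi * s| <= M * L y -> `|s| <= M ^+ 2 * X y ->
    s \is a Num.int -> t \is a Num.int ->
    c0 z * t = c1 z * s \/ 1 <= `|q%:~R| * (2 * M ^+ 2 * L y).
  move=> hs hs' si ti.
  have [/eqP|N] := eqVneq (q%:~R * t - p%:~R * s) 0.
    rewrite subr_eq0 => /eqP e; left; apply: (mulfI qn).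
    by rewrite mulrCA e mulrCA (mulrA p%:~R) -E2' mulrA.
  right; have := norm_intr_ge1 _ N.
  rewrite rpredB ?rpredM ?intr_int // => /(_ isT) /le_trans; apply.
  rewrite -(ler_pM2l X0) -normrM.
  have -> : c0 z * (q%:~R * t - p%:~R * s) = q%:~R * (c0 z * (t - xi * s) - d1 xi z * s).
    by rewrite mulrBr (mulrCA _ p%:~R) (mulrA p%:~R) -E2' /d1; ring.
  rewrite normrM mulrCA; apply: ler_wpM2l => //.
  apply: (le_trans (minor_le (lexx (X z)) hs dz hs')).
  have -> : X z * (M * L y) + L z * (M ^+ 2 * X y) = M * (X z * L y) + M ^+ 2 * (X y * L z) by ring.
  have -> : X z * (2 * M ^+ 2 * L y) = M ^+ 2 * (X z * L y) + M ^+ 2 * (X z * L y) by ring.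
  have P : 0 <= X z * L y by rewrite mulr_ge0 // ltW.
  apply: lerD; first by rewrite ler_wpM2r // ler_eXnr.
  by rewrite ler_wpM2l ?exprn_ge0 // ler_pM // ltW.
have big : 1 <= `|q%:~R| * (2 * M ^+ 2 * L y) -> 1 <= X z * (2 * M ^+ 2 * L y) ^+ 3.
  move=> h; have : 1 <= (`|q%:~R| * (2 * M ^+ 2 * L y)) ^+ 3 by rewrite exprn_ege1.
  rewrite exprMn => /le_trans; apply; apply: ler_wpM2r => //.
  by rewrite exprn_ge0 // mulr_ge0 // mulr_ge0 // exprn_ge0.
have XM : X y <= M ^+ 2 * X y by rewrite ler_peMl // exprn_ege1.
have XM1 : `|c1 y| <= M ^+ 2 * X y.
  by apply: (le_trans k1); rewrite ler_wpM2r // ler_eXnr.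
have [f1|/big //] := K _ _ h1 XM y0 y1.
have [f2|/big //] := K _ _ h2 XM1 y1 y2.
have [f3|/big //] := K _ _ h3 k2 y2 y3.
exfalso; move: sl; rewrite /slope_neq /w01 /w02 /w03.
have g1 : c0 y * c1 z - c1 y * c0 z = 0 by lra.
have g2 : c0 y * c2 z - c2 y * c0 z = 0.
  apply: (mulfI zn); rewrite mulr0.
  transitivity (c0 y * hk2 z - (c0 z * c2 y - c1 z * c1 y) * c0 z +
      c1 z * (c0 y * c1 z - c1 y * c0 z)); first by rewrite /hk2; ring.
  by rewrite e2 f2 g1; ring.
have g3 : c0 y * c3 z - c3 y * c0 z = 0.
  apply: (mulfI zn); rewrite mulr0.
  transitivity (- (c0 y * hk1 z) - (c0 z * c3 y - c1 z * c2 y) * c0 z +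
      c1 z * (c0 y * c2 z - c2 y * c0 z)); first by rewrite /hk1; ring.
  by rewrite e1 f3 g2; ring.
by rewrite g1 g2 g3 eqxx.
Qed.

End HankelBounds.

(** * The bracket after a turn *)

Section Recurrence.
Variable R : realType.
Implicit Types x y z : vec R.

Definition w12 x y : R := c1 x * c2 y - c2 x * c1 y.
Definition w13 x y : R := c1 x * c3 y - c3 x * c1 y.
Definition w23 x y : R := c2 x * c3 y - c3 x * c2 y.

(** The Pluecker coordinates of the plane cut out by the two consecutive
    conditions a0 t_j + a1 t_(j+1) + a2 t_(j+2) = 0 (j = 0, 1) are, in terms of
    the coefficients, the six quadratic forms below. *)
Definition recurrent_wedge (a0 a1 a2 r : R) x y :=
  [/\ w01 x y = r * a2 ^+ 2, w02 x y = - (r * a1 * a2),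
      w03 x y = r * (a1 ^+ 2 - a0 * a2) &
    [/\ w12 x y = r * a0 * a2, w13 x y = - (r * a0 * a1) & w23 x y = r * a0 ^+ 2]].

(** The linear relations between the Pluecker coordinates determine them up to a
    factor r.  Expanding (u0 a0 + u1 a1 + u2 a2)^2 = 1 writes r as an integer
    combination of these coordinates. *)
Lemma plucker_multiple (a0 a1 a2 u0 u1 u2 : R) x y :
    u0 * a0 + u1 * a1 + u2 * a2 = 1 ->
    u0 \is a Num.int -> u1 \is a Num.int -> u2 \is a Num.int ->
    intv x -> intv y ->
    dot (Vec a0 a1 a2 0) x = 0 -> dot (Vec 0 a0 a1 a2) x = 0 ->
    dot (Vec a0 a1 a2 0) y = 0 -> dot (Vec 0 a0 a1 a2) y = 0 ->
  exists2 r : R, r \is a Num.int & recurrent_wedge a0 a1 a2 r x y.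
Proof.
rewrite /recurrent_wedge /dot /= => ua u0i u1i u2i /and4P[x0 x1 x2 x3] /and4P[y0 y1 y2 y3] ex ex' ey ey'.
have lin (p q s t : R) : p = 0 -> q = 0 -> p * s - q * t = 0.
  by move=> -> ->; ring.
have l1 : a1 * w01 x y + a2 * w02 x y = 0.
  rewrite -[RHS](lin _ _ (- c0 y) (- c0 x) ex ey) /w01 /w02; ring.
have l2 : a0 * w01 x y - a2 * w12 x y = 0.
  rewrite -[RHS](lin _ _ (c1 y) (c1 x) ex ey) /w01 /w12; ring.
have l4 : a1 * w12 x y + a2 * w13 x y = 0.
  rewrite -[RHS](lin _ _ (- c1 y) (- c1 x) ex' ey') /w12 /w13; ring.
have l5 : a0 * w12 x y - a2 * w23 x y = 0.
  rewrite -[RHS](lin _ _ (c2 y) (c2 x) ex' ey') /w12 /w23; ring.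
have l6 : a0 * w13 x y + a1 * w23 x y = 0.
  rewrite -[RHS](lin _ _ (c3 y) (c3 x) ex' ey') /w13 /w23; ring.
have l3 : a0 * w02 x y + a1 * w12 x y = 0.
  rewrite -[RHS](lin _ _ (c2 y) (c2 x) ex ey) /w02 /w12; ring.
have l7 : a0 * w03 x y + a1 * w13 x y + a2 * w23 x y = 0.
  rewrite -[RHS](lin _ _ (c3 y) (c3 x) ex ey) /w03 /w13 /w23; ring.
have l8 : a0 * w01 x y + a1 * w02 x y + a2 * w03 x y = 0.
  rewrite -[RHS](lin _ _ (- c0 y) (- c0 x) ex' ey') /w01 /w02 /w03; ring.
have i01 : w01 x y \is a Num.int by rewrite rpredB ?rpredM.
have i02 : w02 x y \is a Num.int by rewrite rpredB ?rpredM.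
have i03 : w03 x y \is a Num.int by rewrite rpredB ?rpredM.
have i12 : w12 x y \is a Num.int by rewrite rpredB ?rpredM.
have i13 : w13 x y \is a Num.int by rewrite rpredB ?rpredM.
have i23 : w23 x y \is a Num.int by rewrite rpredB ?rpredM.
move: (w01 x y) (w02 x y) (w03 x y) (w12 x y) (w13 x y) (w23 x y)
  l1 l2 l3 l4 l5 l6 l7 l8 i01 i02 i03 i12 i13 i23
  => p01 p02 p03 p12 p13 p23 l1 l2 l3 l4 l5 l6 l7 l8 i01 i02 i03 i12 i13 i23.
have [r E] : exists r : R,
  [/\ p01 = r * a2 ^+ 2, p02 = - (r * a1 * a2),
      p03 = r * (a1 ^+ 2 - a0 * a2) &
    [/\ p12 = r * a0 * a2, p13 = - (r * a0 * a1) & p23 = r * a0 ^+ 2]].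
  have [a20|a2n] := eqVneq a2 0; last first.
    exists (p01 / a2 ^+ 2).
    have E02 : p02 = - (a1 * p01) / a2.
      by apply: (mulfI a2n); rewrite mulrCA divff // mulr1; lra.
    have E12 : p12 = a0 * p01 / a2.
      by apply: (mulfI a2n); rewrite mulrCA divff // mulr1; lra.
    have E13 : p13 = - (a1 * p12) / a2.
      by apply: (mulfI a2n); rewrite mulrCA divff // mulr1; lra.
    have E23 : p23 = a0 * p12 / a2.
      by apply: (mulfI a2n); rewrite mulrCA divff // mulr1; lra.
    have E03 : p03 = - (a0 * p01 + a1 * p02) / a2.
      by apply: (mulfI a2n); rewrite mulrCA divff // mulr1; lra.
    by rewrite E03 E23 E13 E12 E02; split; last split; field.
  rewrite a20 !mul0r !subr0 !addr0 in l1 l2 l4 l5 l7 l8.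
  have [a00|a0n] := eqVneq a0 0; last first.
    exists (p23 / a0 ^+ 2).
    have E12 : p12 = 0 by apply: (mulfI a0n); rewrite mulr0.
    have E01 : p01 = 0 by apply: (mulfI a0n); rewrite mulr0.
    have E02 : p02 = 0 by apply: (mulfI a0n); rewrite mulr0 -l3 E12; ring.
    have E13 : p13 = - (a1 * p23) / a0.
      by apply: (mulfI a0n); rewrite mulrCA divff // mulr1; lra.
    have E03 : p03 = - (a1 * p13) / a0.
      by apply: (mulfI a0n); rewrite mulrCA divff // mulr1; lra.
    by rewrite E03 E13 E12 E02 E01 a20; split; last split; field.
  have a1n : a1 != 0.
    apply/eqP => a10; move/eqP: ua; rewrite a20 a10 a00 !mulr0 !addr0.
    by rewrite eq_sym oner_eq0.
  rewrite a00 !mul0r ?add0r in l3 l6 l7 l8.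
  exists (p03 / a1 ^+ 2).
  have E01 : p01 = 0 by apply: (mulfI a1n); rewrite mulr0.
  have E02 : p02 = 0 by apply: (mulfI a1n); rewrite mulr0.
  have E12 : p12 = 0 by apply: (mulfI a1n); rewrite mulr0.
  have E13 : p13 = 0 by apply: (mulfI a1n); rewrite mulr0.
  have E23 : p23 = 0 by apply: (mulfI a1n); rewrite mulr0.
  by rewrite E01 E02 E12 E13 E23 a20 a00; split; last split; field.
exists r => //.
have -> : r = u0 ^+ 2 * p23 + u1 ^+ 2 * (p03 + p12) + u2 ^+ 2 * p01
    - (u0 * u1 + u0 * u1) * p13 + (u0 * u2 + u0 * u2) * p12 - (u1 * u2 + u1 * u2) * p02.
  transitivity (r * (u0 * a0 + u1 * a1 + u2 * a2) ^+ 2).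
    by rewrite ua expr1n mulr1.
  by case: E => -> -> -> [-> -> ->]; ring.
by rewrite ?(rpredB, rpredD, rpredM, rpredX).
Qed.

Variable xi : R.
Notation L := (L xi).
Notation M := (M xi).

Lemma wedge_le x y : X x <= X y -> L y <= L x -> L x <= X x ->
  [/\ `|w01 x y| <= 2 * (X y * L x), `|w12 x y| <= 2 * M ^+ 2 * (X y * L x),
      `|w03 x y| <= 2 * (X y * L x) & `|w23 x y| <= 2 * M ^+ 3 * (X y * L x)].
Proof.
move=> XX LL LX; have [a1 a2 a3] := d_le xi x; have [b1 b2 b3] := d_le xi y.
have [f1 f2 f3] := shift_le xi x; have [g1 g2 g3] := shift_le xi y.
have LXy : L y <= X y by apply: (le_trans LL); apply: (le_trans LX).
have [k1 k2 k3] := coord_le LX; have [l1 l2 l3] := coord_le LXy.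
have M0 := M_ge0 xi; have Lx0 := L_ge0 xi x; have Ly0 := L_ge0 xi y.
have Xx0 := X_ge0 x; have Xy0 := X_ge0 y.
have P : X x * L y <= X y * L x by apply: ler_pM.
have P0 : 0 <= X x * L y by apply: mulr_ge0.
split.
- have -> : w01 x y = c0 x * d1 xi y - d1 xi x * c0 y by rewrite /w01 /d1; ring.
  by apply: (le_trans (minor_le (lexx (X x)) b1 a1 (lexx (X y)))); lra.
- have -> : w12 x y = c1 x * (c2 y - xi * c1 y) - (c2 x - xi * c1 x) * c1 y.
    by rewrite /w12; ring.
  apply: (le_trans (minor_le k1 g2 f2 l1)).
  have -> : M * X x * (M * L y) + M * L x * (M * X y) =
    M ^+ 2 * (X x * L y + X y * L x) by ring.
  have -> : 2 * M ^+ 2 * (X y * L x) = M ^+ 2 * (2 * (X y * L x)) by ring.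
  by apply: ler_wpM2l; [rewrite exprn_ge0|lra].
- have -> : w03 x y = c0 x * d3 xi y - d3 xi x * c0 y by rewrite /w03 /d3; ring.
  by apply: (le_trans (minor_le (lexx (X x)) b3 a3 (lexx (X y)))); lra.
- have -> : w23 x y = c2 x * (c3 y - xi * c2 y) - (c3 x - xi * c2 x) * c2 y.
    by rewrite /w23; ring.
  apply: (le_trans (minor_le k2 g3 f3 l2)).
  have -> : M ^+ 2 * X x * (M * L y) + M * L x * (M ^+ 2 * X y) =
    M ^+ 3 * (X x * L y + X y * L x) by ring.
  have -> : 2 * M ^+ 3 * (X y * L x) = M ^+ 3 * (2 * (X y * L x)) by ring.
  by apply: ler_wpM2l; [rewrite exprn_ge0|lra].
Qed.

End Recurrence.

Section Bracket.
Variables (R : realType) (xi : R) (x : nat -> vec R).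
Notation L := (L xi).
Notation M := (M xi).
Hypothesis hx : minimal_sequence xi x.

Lemma bracket0_plane (a0 a1 a2 : R) (u v w : vec R) : a0 != 0 \/ a1 != 0 \/ a2 != 0 ->
    dot (Vec a0 a1 a2 0) u = 0 -> dot (Vec 0 a0 a1 a2) u = 0 ->
    dot (Vec a0 a1 a2 0) v = 0 -> dot (Vec 0 a0 a1 a2) v = 0 ->
    dot (Vec a0 a1 a2 0) w = 0 -> dot (Vec 0 a0 a1 a2) w = 0 ->
  cross u v w = @vec0 R.
Proof.
move=> an u0 u1 v0 v1 w0 w1.
have [e1 e2 e3 [e4 e5 e6]] := cross_parallel u0 v0 w0.
have [f1 f2 f3 [f4 f5 f6]] := cross_parallel u1 v1 w1.
case: (cross u v w) e1 e2 e3 e4 e5 e6 f1 f2 f3 f4 f5 f6 => p0 p1 p2 p3 /=.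
rewrite !mulr0 => e1 e2 e3 e4 e5 e6 f1 f2 f3 f4 f5 f6.
have z3 : p3 = 0.
  by case: an => [|[|]] an; apply: (mulIf an); rewrite mul0r.
have z0 : p0 = 0.
  by case: an => [|[|]] an; apply: (mulIf an); rewrite mul0r.
rewrite z0 z3 !mul0r in e1 e2 e3 e4 e5 e6 f1 f2 f3 f4 f5 f6.
have z1 : p1 = 0.
  case: an => [|[|]] an; apply: (mulIf an); rewrite mul0r //.
  by rewrite -f4.
have z2 : p2 = 0.
  case: an => [|[|]] an; apply: (mulIf an); rewrite mul0r //.
  by rewrite e4.
by rewrite z0 z1 z2 z3.
Qed.

Lemma primitive_part_real (h0 h1 h2 : R) :
    h0 \is a Num.int -> h1 \is a Num.int -> h2 \is a Num.int ->
    [|| h0 != 0, h1 != 0 | h2 != 0] ->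
  exists g a0 a1 a2 u0 u1 u2 : R,
  [/\ h0 = g * a0, h1 = g * a1, h2 = g * a2, 1 <= `|g| &
      [/\ u0 * a0 + u1 * a1 + u2 * a2 = 1,
        [/\ a0 \is a Num.int, a1 \is a Num.int & a2 \is a Num.int] &
        [/\ u0 \is a Num.int, u1 \is a Num.int & u2 \is a Num.int]]].
Proof.
move=> /intrP[A0 ->] /intrP[A1 ->] /intrP[A2 ->]; rewrite !intr_eq0.
case/primitive_part => g [a0 [a1 [a2 [u0 [u1 [u2 [-> -> -> gn ua]]]]]]].
exists g%:~R, a0%:~R, a1%:~R, a2%:~R, u0%:~R, u1%:~R, u2%:~R.
split; rewrite ?intrM // ?norm_intr_ge1 ?intr_int ?intr_eq0 //.
by split; [rewrite -!intrM -!intrD ua | split; rewrite ?intr_int | split; rewrite ?intr_int].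
Qed.

Definition max3 (a0 a1 a2 : R) : R := Num.max `|a0| (Num.max `|a1| `|a2|).

Lemma max3_ge a0 a1 a2 :
  [/\ `|a0| <= max3 a0 a1 a2, `|a1| <= max3 a0 a1 a2 & `|a2| <= max3 a0 a1 a2].
Proof. by rewrite /max3 !le_max !lexx !orbT. Qed.

Lemma max3_case a0 a1 a2 :
  max3 a0 a1 a2 = `|a0| \/ max3 a0 a1 a2 = `|a1| \/ max3 a0 a1 a2 = `|a2|.
Proof. by rewrite /max3 !maxEle; do 2?case: ifP => _; auto. Qed.

(** The polynomial f = a0 + a1 T + a2 T^2 takes a small value at xi, because the
    large point u satisfies the recurrence.  As z is not higher than u, both
    recurrence forms are small at z, whereas one of them is a nonzero integer there. *)
Lemma recurrence_miss (a0 a1 a2 : R) (u z : vec R) :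
    [/\ a0 \is a Num.int, a1 \is a Num.int & a2 \is a Num.int] ->
    dot (Vec a0 a1 a2 0) u = 0 -> intv z -> X z <= X u -> L u <= L z ->
    dot (Vec a0 a1 a2 0) z != 0 \/ dot (Vec 0 a0 a1 a2) z != 0 ->
  1 <= 5 * M * (max3 a0 a1 a2 * L z).
Proof.
move=> [i0 i1 i2] au zi XX LL miss; set N := max3 _ _ _.
have [n0 n1 n2] : [/\ `|a0| <= N, `|a1| <= N & `|a2| <= N] := max3_ge a0 a1 a2.
have N0 : 0 <= N := le_trans (normr_ge0 _) n0.
have M1 := M_ge1 xi; have Lz0 := L_ge0 xi z.
have [u1 u2 u3] := d_le xi u; have [z1 z2 z3] := d_le xi z.
have P : 0 <= N * L z by apply: mulr_ge0.
have MP : N * L z <= M * (N * L z) by apply: ler_peMl.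
pose f := a0 + a1 * xi + a2 * xi ^+ 2.
have fle : `|f * c0 z| <= 2 * (N * L z).
  have h : `|f| * X u <= N * L u + N * L u.
    rewrite /X -normrM.
    have -> : f * c0 u = - (a1 * d1 xi u + a2 * d2 xi u).
      apply/eqP; rewrite -subr_eq0 -[X in _ == X]au; apply/eqP.
      by rewrite /f /dot /d1 /d2 /=; ring.
    by rewrite normrN; apply: normD_le; apply: normM_le.
  rewrite normrM; apply: le_trans (_ : `|f| * X u <= _); first exact: ler_wpM2l.
  by apply: (le_trans h); rewrite mulr_natl mulr2n lerD // ler_wpM2l.
case: miss => dn.
- have := norm_intr_ge1 _ dn; rewrite dot_int // => [/(_ isT)|]; last first.
    by rewrite /intv /= i0 i1 i2 rpred0.
  move=> /le_trans; apply.
  have -> : dot (Vec a0 a1 a2 0) z = f * c0 z + (a1 * d1 xi z + a2 * d2 xi z).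
    by rewrite /dot /f /d1 /d2 /=; ring.
  have h2 : `|a1 * d1 xi z + a2 * d2 xi z| <= N * L z + N * L z.
    by apply: normD_le; apply: normM_le.
  apply: (le_trans (normD_le fle h2)); rewrite -mulrA.
  by move: (N * L z) (M * (N * L z)) P MP; clear=> *; lra.
- have := norm_intr_ge1 _ dn; rewrite dot_int // => [/(_ isT)|]; last first.
    by rewrite /intv /= i0 i1 i2 rpred0.
  move=> /le_trans; apply.
  have -> : dot (Vec 0 a0 a1 a2) z =
      xi * (f * c0 z) + (a0 * d1 xi z + a1 * d2 xi z + a2 * d3 xi z).
    by rewrite /dot /f /d1 /d2 /d3 /=; ring.
  have h2 : `|a0 * d1 xi z + a1 * d2 xi z + a2 * d3 xi z| <= N * L z + N * L z + N * L z.
    by do 2?[apply: normD_le]; apply: normM_le.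
  apply: (le_trans (normD_le (normM_le (xi_leM xi) fle) h2)).
  rewrite (mulrCA M 2) -[5 * M * _]mulrA.
  by move: (N * L z) (M * (N * L z)) P MP; clear=> *; lra.
Qed.

Lemma recurrence_le (a0 a1 a2 r : R) (u v : vec R) :
    X u <= X v -> L v <= L u -> L u <= X u -> 1 <= `|r| ->
    recurrent_wedge a0 a1 a2 r u v ->
  max3 a0 a1 a2 ^+ 2 <= 4 * M ^+ 3 * (X v * L u).
Proof.
move=> XX LL LX r1 [p01 p02 p03 [p12 p13 p23]].
have [q01 q12 q03 q23] := wedge_le XX LL LX.
have M1 := M_ge1 xi; have M3 : M ^+ 2 <= M ^+ 3 by rewrite ler_weXn2l.
have M31 : 1 <= M ^+ 3 by rewrite exprn_ege1.
have Q0 : 0 <= X v * L u by rewrite mulr_ge0 ?X_ge0 ?L_ge0.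
have Q1 : X v * L u <= M ^+ 3 * (X v * L u) by apply: ler_peMl.
have Q2 : M ^+ 2 * (X v * L u) <= M ^+ 3 * (X v * L u) by apply: ler_wpM2r.
have key (s t : R) : r * s ^+ 2 = t -> `|t| <= 4 * (M ^+ 3 * (X v * L u)) ->
    `|s| ^+ 2 <= 4 * M ^+ 3 * (X v * L u).
  rewrite -(mulrA 4) => <- /(le_trans _); apply.
  by rewrite normrM normrX ler_peMl ?exprn_ge0.
rewrite -[2 * _ * _]mulrA in q12; rewrite -[2 * _ * _]mulrA in q23.
have [->|[->|->]] := max3_case a0 a1 a2.
- apply: (key _ _ (esym p23)); apply: (le_trans q23).
  by move: (X v * L u) (M ^+ 3 * (X v * L u)) Q0 Q1; clear=> *; lra.
- apply: (key _ (w03 u v + w12 u v)); first by rewrite p03 p12; ring.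
  apply: (le_trans (normD_le q03 q12)).
  by move: (X v * L u) (M ^+ 2 * (X v * L u)) (M ^+ 3 * (X v * L u)) Q0 Q1 Q2; clear=> *; lra.
- apply: (key _ _ (esym p01)); apply: (le_trans q01).
  by move: (X v * L u) (M ^+ 3 * (X v * L u)) Q0 Q1; clear=> *; lra.
Qed.

Lemma ms_primitive k (t : R) : t \is a Num.int -> t != 0 ->
  intv (comb t^-1 (x k) 0 (x k)) -> `|t| = 1.
Proof.
move=> ti tn ci; apply/eqP; rewrite eq_le norm_intr_ge1 // andbT leNgt.
apply/negP => t1.
have tv : `|t^-1| < 1 by rewrite normfV invf_lt1 // (lt_trans ltr01).
have X0 := ms_Xgt0 hx k; have L0 := ms_Lgt0 hx k; have XX := ms_X hx k.
have : comb t^-1 (x k) 0 (x k) = @vec0 R.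
  apply: (ms_min hx ci (k := k)).
  - apply: (le_lt_trans (X_comb _ _ _ _)); rewrite normr0 mul0r addr0.
    by apply: lt_trans XX; rewrite gtr_pMl.
  - apply: (le_lt_trans (L_comb _ _ _ _ _)); rewrite normr0 mul0r addr0.
    by rewrite gtr_pMl.
case=> /eqP; rewrite mul0r addr0 mulf_eq0 invr_eq0 (negbTE tn) /= => /eqP e _ _ _.
by have := ms_gt0 hx k; rewrite e ltxx.
Qed.

(** Each coordinate of x_k divided by r is the coordinate on x_(k+1) of an
    explicit integer vector of the plane of x_k and x_(k+1), hence an integer;
    but x_k is a primitive vector. *)
Lemma recurrence_unit k (a0 a1 a2 r : R) :
    [/\ a0 \is a Num.int, a1 \is a Num.int & a2 \is a Num.int] ->
    r \is a Num.int -> r != 0 ->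
    recurrent_wedge a0 a1 a2 r (x k) (x k.+1) -> `|r| = 1.
Proof.
move=> [i0 i1 i2] ri rn [p01 p02 p03 [p12 p13 p23]].
have basis := @ms_basis R xi x hx k.
apply: (ms_primitive (k := k)) => //.
move: (x k) (x k.+1) p01 p02 p03 p12 p13 p23 basis => u v p01 p02 p03 p12 p13 p23 basis.
have B (w : vec R) (s t : R) : intv w -> w = comb (- (t / r)) u (s / r) v -> s / r \is a Num.int.
  by move=> wi E; rewrite E in wi; case: (basis _ _ wi).
have [i01 i02 i12 i00 [i11 i22]] :
    [/\ a0 * a1 \is a Num.int, a0 * a2 \is a Num.int, a1 * a2 \is a Num.int,
     a0 ^+ 2 \is a Num.int & [/\ a1 ^+ 2 \is a Num.int & a2 ^+ 2 \is a Num.int]].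
  by split; [..|split]; rewrite ?rpredM ?rpredX.
have s0 : c0 u / r \is a Num.int.
  apply: (B (Vec 0 (a2 ^+ 2) (- (a1 * a2)) (a1 ^+ 2 - a0 * a2)) _ (c0 v)).
    by rewrite /intv /= rpred0 i22 rpredN i12 rpredB.
  apply: vec_eqP => /=; apply: (mulfI rn).
  + by field.
  + by rewrite -p01 /w01; field.
  + by rewrite mulrN mulrA -p02 /w02; field.
  + by rewrite -p03 /w03; field.
have s1 : c1 u / r \is a Num.int.
  apply: (B (Vec (- a2 ^+ 2) 0 (a0 * a2) (- (a0 * a1))) _ (c1 v)).
    by rewrite /intv /= rpred0 !rpredN i22 i02 i01.
  apply: vec_eqP => /=; apply: (mulfI rn).
  + by rewrite mulrN -p01 /w01; field.
  + by field.
  + by rewrite mulrA -p12 /w12; field.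
  + by rewrite mulrN mulrA -p13 /w13; field.
have s2 : c2 u / r \is a Num.int.
  apply: (B (Vec (a1 * a2) (- (a0 * a2)) 0 (a0 ^+ 2)) _ (c2 v)).
    by rewrite /intv /= rpred0 !rpredN i12 i02 i00.
  apply: vec_eqP => /=; apply: (mulfI rn).
  + by rewrite mulrA -[LHS]opprK -p02 /w02; field.
  + by rewrite mulrN mulrA -p12 /w12; field.
  + by field.
  + by rewrite -p23 /w23; field.
have s3 : c3 u / r \is a Num.int.
  apply: (B (Vec (- (a1 ^+ 2 - a0 * a2)) (a0 * a1) (- a0 ^+ 2) 0) _ (c3 v)).
    by rewrite /intv /= rpred0 !rpredN i01 i00 rpredB.
  apply: vec_eqP => /=; apply: (mulfI rn).
  + by rewrite mulrN -p03 /w03; field.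
  + by rewrite mulrA -[LHS]opprK -p13 /w13; field.
  + by rewrite mulrN -p23 /w23; field.
  + by field.
by rewrite /intv /= !mul0r !addr0 ![r^-1 * _]mulrC s0 s1 s2 s3.
Qed.

(** If the bracket of two consecutive minimal points u, v vanishes, then u and v
    satisfy a common integral recurrence with a primitive coefficient vector m, and
    (hk0 u, hk1 u, hk2 u) is a multiple of m.  The preceding point z is off the plane
    of u and v, which forces |m| to be at least of order 1 / L z.  The wedge of u and
    v, of size about X v * L u, is up to sign the vector of size |m|^2 of
    recurrent_wedge.  Finally |m| is at most the size of the minors, which is of order
    X u * L u. *)
Lemma bracket0_large k : L (x k) <= X (x k) -> L (x k.+1) <= X (x k.+1) ->
    turn x k -> nondeg (x k.+1) ->
    Cm (x k.+1) (x k.+2) = 0 -> Cp (x k.+1) (x k.+2) = 0 ->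
  1 <= 100 * M ^+ 5 * (X (x k.+2) * L (x k.+1) * L (x k) ^+ 2) /\
  X (x k.+2) <= 24 * M ^+ 6 * (X (x k.+1) ^+ 2 * L (x k.+1)).
Proof.
move=> LXz LXx tk nd Cm0 Cp0.
have M0 := M_ge0 xi.
have /and4P[iu0 iu1 iu2 iu3] := ms_int hx k.+1.
have [||||g [a0 [a1 [a2 [e0 [e1 [e2 [G0 G1 G2 g1 [ua ai [j0 j1 j2]]]]]]]]]] :=
  @primitive_part_real (hk0 (x k.+1)) (hk1 (x k.+1)) (hk2 (x k.+1)) => //.
  by rewrite /hk0 rpredB ?rpredM.
  by rewrite /hk1 rpredB ?rpredM.
  by rewrite /hk2 rpredB ?rpredM.
have unit := @recurrence_unit k.+1 a0 a1 a2 _ ai.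
have lower := @wedge_lower R xi x hx k.+1.
have slope := ms_slope hx k.+1; rewrite /turn in tk.
have ui := ms_int hx k.+1; have vi := ms_int hx k.+2; have zi := ms_int hx k.
have XX := ltW (ms_X hx k); have LL := ltW (ms_L hx k).
have XX1 := ltW (ms_X hx k.+1); have LL1 := ltW (ms_L hx k.+1).
have Lu0 := ms_Lgt0 hx k.+1.
move: (x k) (x k.+1) (x k.+2) tk ui vi zi XX LL XX1 LL1 Lu0 LXz LXx Cm0 Cp0 G0 G1 G2
   unit lower slope {nd iu0 iu1 iu2 iu3}
  => z u v tk ui vi zi XX LL XX1 LL1 Lu0 LXz LXx Cm0 Cp0 G0 G1 G2 unit lower slope.
have gn : g != 0 by rewrite -normr_gt0 (lt_le_trans ltr01).
have au : dot (Vec a0 a1 a2 0) u = 0.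
  apply: (mulfI gn); rewrite mulr0 /dot /=.
  transitivity ((g * a0) * c0 u + (g * a1) * c1 u + (g * a2) * c2 u); first by ring.
  by rewrite -G0 -G1 -G2 /hk0 /hk1 /hk2; ring.
have au' : dot (Vec 0 a0 a1 a2) u = 0.
  apply: (mulfI gn); rewrite mulr0 /dot /=.
  transitivity ((g * a0) * c1 u + (g * a1) * c2 u + (g * a2) * c3 u); first by ring.
  by rewrite -G0 -G1 -G2 /hk0 /hk1 /hk2; ring.
have av : dot (Vec a0 a1 a2 0) v = 0.
  apply: (mulfI gn); rewrite mulr0 /dot /= -[RHS]Cm0 CmE G0 G1 G2; ring.
have av' : dot (Vec 0 a0 a1 a2) v = 0.
  apply: (mulfI gn); rewrite mulr0 /dot /= -[RHS]Cp0 CpE G0 G1 G2; ring.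
have an : a0 != 0 \/ a1 != 0 \/ a2 != 0.
  case: (eqVneq a0 0) => [a00|]; last by left.
  case: (eqVneq a1 0) => [a10|]; last by right; left.
  right; right; apply/eqP => a20; move/eqP: ua.
  by rewrite a00 a10 a20 !mulr0 !addr0 eq_sym oner_eq0.
have hz : 1 <= 5 * M * (max3 a0 a1 a2 * L z).
  apply: (recurrence_miss ai au zi XX LL).
  have [dm|] := eqVneq (dot (Vec a0 a1 a2 0) z) 0; last by left.
  have [dp|] := eqVneq (dot (Vec 0 a0 a1 a2) z) 0; last by right.
  by case: tk; apply: (bracket0_plane an).
have [r ri pl] := plucker_multiple ua j0 j1 j2 ui vi au au' av av'.
have rn : r != 0.
  case: pl => p01 p02 p03 _.
  apply/eqP => r0; move: slope; rewrite /slope_neq p01 p02 p03 r0 !mul0r oppr0.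
  by rewrite eqxx.
have N2 := recurrence_le XX1 LL1 LXx (norm_intr_ge1 ri rn) pl.
have rI := unit _ ri rn pl; case: pl => p01 p02 p03 _.
have [n0 n1 n2] := max3_ge a0 a1 a2.
have up : max3 a0 a1 a2 <= 2 * M ^+ 3 * (X u * L u).
  have [b0 b1 b2] := hk_le LXx.
  have key (a h : R) : h = g * a -> `|h| <= 2 * M ^+ 3 * (X u * L u) ->
      `|a| <= 2 * M ^+ 3 * (X u * L u).
    by move=> -> /(le_trans _); apply; rewrite normrM ler_peMl.
  by rewrite {1}/max3 !ge_max (key _ _ G0 b0) (key _ _ G1 b1) (key _ _ G2 b2).
move: (max3 a0 a1 a2) n0 n1 n2 hz N2 up => N n0 n1 n2 hz N2 up.
have N0 : 0 <= N := le_trans (normr_ge0 _) n0.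
have Lz0 := L_ge0 xi z.
split.
  have : 1 <= (5 * M * (N * L z)) ^+ 2 by apply: exprn_ege1.
  have -> : (5 * M * (N * L z)) ^+ 2 = 25 * M ^+ 2 * L z ^+ 2 * N ^+ 2 by ring.
  move=> /le_trans; apply.
  have -> : 100 * M ^+ 5 * (X v * L u * L z ^+ 2) =
    25 * M ^+ 2 * L z ^+ 2 * (4 * M ^+ 3 * (X v * L u)) by ring.
  by apply: ler_wpM2l => //; rewrite !mulr_ge0 // ?exprn_ge0.
have NN (a b : R) : `|a| <= N -> `|b| <= N -> `|a * b| <= N ^+ 2.
  by move=> *; rewrite expr2; apply: normM_le.
have N20 : N ^+ 2 <= 2 * N ^+ 2 by rewrite mulr_natl mulr2n lerDl exprn_ge0.
have low : X v * L u <= 3 * (2 * N ^+ 2).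
  apply: lower.
  - by rewrite p01 normrM rI mul1r expr2; apply: le_trans N20; apply: NN.
  - by rewrite p02 normrN -mulrA normrM rI mul1r; apply: le_trans N20; apply: NN.
  - rewrite p03 normrM rI mul1r expr2 mulr_natl mulr2n.
    by apply: normB_le; apply: NN.
rewrite -(ler_pM2r Lu0); apply: (le_trans low).
have -> : 24 * M ^+ 6 * (X u ^+ 2 * L u) * L u =
    3 * (2 * (2 * M ^+ 3 * (X u * L u)) ^+ 2) by ring.
by do 2!rewrite ler_pM2l //; rewrite ler_pXn2r ?nnegrE // (le_trans N0).
Qed.

End Bracket.

(** The two conclusions of bracket0_large, in logarithms.  Without the constants
    and with exponent l they read 2 l x1 <= (1 - l) x2 and (1 + l) x2 <= 2 x1, which
    is impossible for l > sqrt 2 - 1 = 0.4142..., in particular for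
    l = 14/33 = 0.4242... *)
Lemma bracket_exponents (R : realFieldType) (K1 K2 n1 n2 l0 l1 x1 x2 : R) :
    0 <= K1 + (x2 + l1 + (l0 + l0)) -> x2 <= K2 + (x1 + x1 + l1) ->
    l0 <= - (14 / 33 * x1) -> l1 <= - (14 / 33 * x2) ->
    47 * n1 + 47 * n2 + 1 <= x1 ->
    K1 <= n1 -> K2 <= n2 -> 0 <= n1 -> 0 <= n2 ->
  False.
Proof.
move=> i1 i2 d0 d1 h k1 k2 p1 p2.
have a1 : 28 * x1 <= 19 * x2 + 33 * n1 by lra.
have a2 : 47 * x2 <= 66 * x1 + 33 * n2 by lra.
clear - a1 a2 h p1 p2; lra.
Qed.

(** * Turning points *)

Section Turning.
Variables (R : realType) (xi : R).
Notation L := (L xi).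
Notation M := (M xi).

Definition bracket_neq0 (u v : vec R) := (Cm u v != 0) || (Cp u v != 0).

(** Everything that is used about the minimal points near the turns.  At the n-th
    turn the points e n, a n, b n are three consecutive minimal points that are
    linearly independent.  Up to the next turn all minimal points stay in the plane
    of a n and b n, so (e n.+1, a n.+1) is another basis of that plane.  The
    exponent -kappa stands for a factor that makes up for all absolute constants. *)
Record turning_sequence (kappa lambda : R) (e a b : nat -> vec R) : Prop := Turning {
  ts_int : forall n, [/\ intv (e n), intv (a n) & intv (b n)];
  ts_cross : forall n, cross (e n) (a n) (b n) <> @vec0 R;
  ts_X1 : forall n, 1 <= X (e n);
  ts_ea : forall n, X (e n) < X (a n) /\ L (a n) < L (e n);
  ts_ab : forall n, X (a n) < X (b n) /\ L (b n) < L (a n);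
  ts_ba : forall n, X (b n) <= X (a n.+1) /\ L (a n.+1) <= L (b n);
  ts_ae : forall n, X (a n) <= X (e n.+1) /\ L (e n.+1) <= L (a n);
  ts_L0 : forall n, 0 < L (b n);
  ts_L1 : forall n, L (e n) <= 1;
  ts_plane : forall n, exists p q r s : R,
    [/\ e n.+1 = comb p (a n) q (b n), a n.+1 = comb r (a n) s (b n),
        [/\ p \is a Num.int, q \is a Num.int, r \is a Num.int & s \is a Num.int] &
        p * s - q * r = 1 \/ p * s - q * r = -1];
  ts_low : forall n, X (a n.+1) * L (e n.+1) <= 6 * (X (b n) * L (a n));
  ts_dec_e : forall n, ln (L (e n)) <= - kappa - lambda * ln (X (a n));
  ts_dec_a : forall n, ln (L (a n)) <= - kappa - lambda * ln (X (b n));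
  ts_Cab : forall n, bracket_neq0 (a n) (b n);
  ts_Cae : forall n, bracket_neq0 (a n.+1) (e n.+1);
  ts_grow : forall n, n%:R <= X (a n) }.

(** A linear form that vanishes at points of unbounded height which stay at bounded
    distance from the line of (1, xi, xi^2, xi^3) vanishes on that line. *)
Lemma ceval0_of_orth (b : vec R) (y : nat -> vec R) :
    (forall n, dot b (y n) = 0) -> (forall n, n%:R <= X (y n)) ->
    (forall n, L (y n) <= 1) -> ceval xi b = 0.
Proof.
move=> h hX hL.
pose B := Num.max `|c1 b| (Num.max `|c2 b| `|c3 b|).
have [b1 b2 b3] : [/\ `|c1 b| <= B, `|c2 b| <= B & `|c3 b| <= B].
  by rewrite /B !le_max !lexx !orbT.
have B0 : 0 <= B := le_trans (normr_ge0 _) b1.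
have key n : `|ceval xi b| * n%:R <= 3 * B.
  have : `|ceval xi b| * X (y n) <= 3 * (B * L (y n)).
    rewrite /X -normrM mulrC; have := h n; rewrite (dotE xi) => /eqP.
    by rewrite addr_eq0 => /eqP ->; rewrite normrN; apply: dot_tail_le.
  have := hX n; have := hL n; have := normr_ge0 (ceval xi b) => e0 l1 x1.
  have : `|ceval xi b| * n%:R <= `|ceval xi b| * X (y n) by apply: ler_wpM2l.
  have : B * L (y n) <= B by apply: ler_piMr.
  lra.
apply/eqP; rewrite -normr_eq0; apply/eqP/le_anti; rewrite normr_ge0 andbT.
rewrite leNgt; apply/negP => e0.
have := key (Num.truncn (3 * B / `|ceval xi b|)).+1.
rewrite -ler_pdivlMl // mulrC leNgt; apply/negP; rewrite negbK.
exact: truncnS_gt.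
Qed.

Hypothesis xi_deg : forall b : vec R, intv b -> b <> @vec0 R -> ceval xi b <> 0.

Variable x : nat -> vec R.
Hypothesis hx : minimal_sequence xi x.
Hypothesis L1 : forall k, L (x k) <= 1.

Let LX k : L (x k) <= X (x k).
Proof. exact: le_trans (L1 k) (ms_Xge1 hx k). Qed.

(** Otherwise all minimal points beyond some rank lie in one plane, and hence are
    orthogonal to a nonzero integer vector. *)
Lemma turns_infinite k0 : exists k, (k0 <= k)%N /\ turn x k.
Proof.
apply: contrapT => no.
have nt k : (k0 <= k)%N -> ~ turn x k by move=> kk tk; apply: no; exists k.
have [z [zi zn]] : exists z, intv z /\ cross (x k0) (x k0.+1) z <> @vec0 R.
  have := ms_slope hx k0; rewrite /slope_neq => /or3P[] w.
  - exists (Vec 0 0 1 0); split; first by rewrite /intv /= !rpred0 rpred1.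
    case=> _ _ _ h; move/eqP: w; apply; rewrite -h /w01 /det3 /=; ring.
  - exists (Vec 0 1 0 0); split; first by rewrite /intv /= !rpred0 rpred1.
    case=> _ _ _ h; move/eqP: w; apply; apply: oppr_inj; rewrite oppr0 -[RHS]h /w02 /det3 /=; ring.
  - exists (Vec 0 0 1 0); split; first by rewrite /intv /= !rpred0 rpred1.
    case=> _ h _ _; move/eqP: w; apply; apply: oppr_inj; rewrite oppr0 -[RHS]h /w03 /det3 /=; ring.
have bi : intv (cross (x k0) (x k0.+1) z) by apply: intv_cross; rewrite ?(ms_int hx).
case: (xi_deg bi zn); apply: (@ceval0_of_orth _ (fun l => x (k0 + l)%N)) => l //.
- have [j jl|a [b [_ [_ [-> _ _ _]]]]] := @plane_basis _ _ _ hx k0 l.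
    by apply: nt; rewrite leq_addr.
  by rewrite /dot /cross /det3 /=; ring.
- apply: (le_trans _ (ms_Xge hx _)); by rewrite ler_nat leq_addl.
Qed.

Variables (kappa lambda : R).
Hypothesis kappa_ge0 : 0 <= kappa.
Hypothesis lambda_ge : 14 / 33 <= lambda.
Hypothesis dec : forall k, ln (L (x k)) <= - kappa - lambda * ln (X (x k.+1)).

Let lnX0 k : 0 <= ln (X (x k)).
Proof. exact: ln_ge0 (ms_Xge1 hx k). Qed.

Let dec' k : ln (L (x k)) <= - (14 / 33 * ln (X (x k.+1))).
Proof. by apply: (le_trans (dec k)); have := ler_wpM2r (lnX0 k.+1) lambda_ge; have := kappa_ge0; lra. Qed.

Let M0 : 0 < M. Proof. exact: lt_le_trans ltr01 (M_ge1 xi). Qed.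

(** Degeneracy of x_(k+1) bounds X x_(k+1) * (L x_k)^3 from below, but
    3 * 14/33 > 1. *)
Lemma eventually_nondeg : exists k0, forall k, (k0 <= k)%N -> nondeg (x k).
Proof.
pose K := ln (2 * M ^+ 2).
have [k0 hk0] := ms_lnX hx (11 * K + 1).
exists k0.+1 => -[//|k] hk; apply/negPn/negP => nd.
have := deg_large hx (LX k) nd; set t := 2 * M ^+ 2.
have t0 : 0 < t by rewrite /t mulr_gt0 // exprn_gt0.
have Xp := ms_Xgt0 hx k.+1; have Lp := ms_Lgt0 hx k.
move=> /ln_ge0; rewrite lnM ?posrE ?exprn_gt0 ?mulr_gt0 //.
rewrite lnXn ?mulr_gt0 // lnM ?posrE // -/K.
have := dec' k; have := hk0 k.+1 (leqW hk); rewrite -mulr_natr; lra.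
Qed.

Lemma eventually_bracket : exists k0, forall k, (k0 <= k)%N ->
  turn x k -> bracket_neq0 (x k.+1) (x k.+2).
Proof.
have [k1 nd] := eventually_nondeg.
pose K1 := ln (100 * M ^+ 5); pose K2 := ln (24 * M ^+ 6).
have [k0 hk0] := ms_lnX hx (47 * `|K1| + 47 * `|K2| + 1).
exists (maxn k0 k1) => k; rewrite geq_max => /andP[h0 h1] tk.
rewrite /bracket_neq0 -negb_and; apply/negP => /andP[/eqP Cm0 /eqP Cp0].
have [] := bracket0_large hx (LX k) (LX k.+1) tk (nd _ (leqW h1)) Cm0 Cp0.
have X1p := ms_Xgt0 hx k.+1; have X2p := ms_Xgt0 hx k.+2.
have Lp := ms_Lgt0 hx k; have L1p := ms_Lgt0 hx k.+1.
have s0 : 0 < 100 * M ^+ 5 by rewrite mulr_gt0 // exprn_gt0.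
have s1 : 0 < 24 * M ^+ 6 by rewrite mulr_gt0 // exprn_gt0.
move=> /ln_ge0.
rewrite lnM ?posrE ?mulr_gt0 ?exprn_gt0 // -/K1.
rewrite lnM ?posrE ?mulr_gt0 ?exprn_gt0 // lnM ?posrE // lnXn // => i1.
rewrite -ler_ln ?posrE ?mulr_gt0 ?exprn_gt0 // lnM ?posrE ?mulr_gt0 ?exprn_gt0 //.
rewrite -/K2 lnM ?posrE ?exprn_gt0 // lnXn // => i2.
rewrite mulr2n in i1; rewrite mulr2n in i2.
exact: (bracket_exponents i1 i2 (dec' k) (dec' k.+1) (hk0 _ (leqW h0))
  (ler_norm K1) (ler_norm K2) (normr_ge0 K1) (normr_ge0 K2)).
Qed.

(** The vanishing of the bracket means that v satisfies the recurrence of order two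
    attached to the Hankel minors of u.  The minors of v are then proportional to
    those of u, so u satisfies the recurrence attached to v. *)
Lemma bracket_sym (u v : vec R) : nondeg u -> nondeg v -> ~~ bracket_neq0 u v ->
  ~~ bracket_neq0 v u.
Proof.
rewrite /bracket_neq0 !negb_or !negbK !CmE !CpE => nu nv /andP[/eqP e1 /eqP e2].
have c0E : hk1 v * hk0 u = hk0 v * hk1 u.
  transitivity (hk1 v * hk0 u + (c3 v * (hk0 u * c0 v + hk1 u * c1 v + hk2 u * c2 v)
    - c2 v * (hk0 u * c1 v + hk1 u * c2 v + hk2 u * c3 v))).
    by rewrite e1 e2; ring.
  by rewrite /(hk1 v) /(hk0 v); ring.
have c1E : hk2 v * hk0 u = hk0 v * hk2 u.
  transitivity (hk2 v * hk0 u - (c2 v * (hk0 u * c0 v + hk1 u * c1 v + hk2 u * c2 v)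
    - c1 v * (hk0 u * c1 v + hk1 u * c2 v + hk2 u * c3 v))).
    by rewrite e1 e2; ring.
  by rewrite /(hk2 v) /(hk0 v); ring.
have c2E : hk2 v * hk1 u = hk1 v * hk2 u.
  transitivity (hk2 v * hk1 u + (c1 v * (hk0 u * c0 v + hk1 u * c1 v + hk2 u * c2 v)
    - c0 v * (hk0 u * c1 v + hk1 u * c2 v + hk2 u * c3 v))).
    by rewrite e1 e2; ring.
  by rewrite /(hk2 v) /(hk1 v); ring.
have m1 : hk0 u * c0 u + hk1 u * c1 u + hk2 u * c2 u = 0.
  by rewrite /hk0 /hk1 /hk2; ring.
have m2 : hk0 u * c1 u + hk1 u * c2 u + hk2 u * c3 u = 0.
  by rewrite /hk0 /hk1 /hk2; ring.
have fin (h h' p q r s : R) : h != 0 -> h * (hk0 v * p + hk1 v * q + hk2 v * r) = h' * s ->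
   s = 0 -> hk0 v * p + hk1 v * q + hk2 v * r == 0.
  by move=> hn E s0; apply/eqP; apply: (mulfI hn); rewrite E s0 !mulr0.
have lin (h h' p q r : R) : hk0 v * h = h' * hk0 u -> hk1 v * h = h' * hk1 u ->
    hk2 v * h = h' * hk2 u ->
    h * (hk0 v * p + hk1 v * q + hk2 v * r) = h' * (hk0 u * p + hk1 u * q + hk2 u * r).
  move=> E0 E1 E2; transitivity ((hk0 v * h) * p + (hk1 v * h) * q + (hk2 v * h) * r); first by ring.
  by rewrite E0 E1 E2; ring.
case/or3P: nu => hn; apply/andP; split.
- by apply: (fin _ (hk0 v) _ _ _ _ hn _ m1); apply: lin => //; rewrite // mulrC.
- by apply: (fin _ (hk0 v) _ _ _ _ hn _ m2); apply: lin => //; rewrite // mulrC.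
- by apply: (fin _ (hk1 v) _ _ _ _ hn _ m1); apply: lin => //; rewrite mulrC.
- by apply: (fin _ (hk1 v) _ _ _ _ hn _ m2); apply: lin => //; rewrite mulrC.
- by apply: (fin _ (hk2 v) _ _ _ _ hn _ m1); apply: lin => //; rewrite mulrC.
- by apply: (fin _ (hk2 v) _ _ _ _ hn _ m2); apply: lin => //; rewrite mulrC.
Qed.

End Turning.

Section TurningExists.
Variables (R : realType) (xi : R).
Notation L := (L xi).
Hypothesis xi_deg : forall b : vec R, intv b -> b <> @vec0 R -> ceval xi b <> 0.
Variable x : nat -> vec R.
Hypothesis hx : minimal_sequence xi x.
Hypothesis L1 : forall k, L (x k) <= 1.
Variables (kappa lambda : R).
Hypothesis kappa_ge0 : 0 <= kappa.
Hypothesis lambda_ge : 14 / 33 <= lambda.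
Hypothesis dec : forall k, ln (L (x k)) <= - kappa - lambda * ln (X (x k.+1)).

Lemma ms_mono i j : (i <= j)%N -> X (x i) <= X (x j) /\ L (x j) <= L (x i).
Proof.
move=> /subnKC <-; elim: (j - i)%N => [|l [IX IL]]; first by rewrite addn0.
rewrite addnS; split.
- exact: le_trans IX (ltW (ms_X hx _)).
- exact: le_trans (ltW (ms_L hx _)) IL.
Qed.

Lemma turn_times k0 : exists t : nat -> nat,
  [/\ forall n, turn x (t n), forall n, (t n < t n.+1)%N,
      forall n, (k0 <= t n)%N &
      forall n j, (t n < j)%N -> (j < t n.+1)%N -> ~ turn x j].
Proof.
have ex k : exists j, (k <= j)%N && `[< turn x j >].
  have [j [kj tj]] := turns_infinite xi_deg hx L1 k.
  by exists j; rewrite kj; apply/asboolP.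
pose nxt k := ex_minn (ex k).
have nxtP k : [/\ (k <= nxt k)%N, turn x (nxt k) &
    forall j, (k <= j)%N -> (j < nxt k)%N -> ~ turn x j].
  rewrite /nxt; case: ex_minnP => j /andP[kj /asboolP tj] mn; split => // i ki ij ti.
  by have := mn i; rewrite ki (asboolT ti) => /(_ isT); rewrite leqNgt ij.
pose fix t n := if n is m.+1 then nxt (t m).+1 else nxt k0.
have tS n : t n.+1 = nxt (t n).+1 by [].
have lt n : (t n < t n.+1)%N by rewrite tS; case: (nxtP (t n).+1).
exists t; split => //.
- by case=> [|n]; rewrite /=; [case: (nxtP k0) | case: (nxtP (t n).+1)].
- elim=> [|n IH]; first by case: (nxtP k0).
  by apply: (leq_trans IH); apply: ltnW.
- by move=> n j h1 h2; case: (nxtP (t n).+1) => _ _; apply.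
Qed.

(** The points e n, a n, b n are x_k, x_(k+1), x_(k+2), where k is the n-th turn
    beyond the rank from which the points are nondegenerate and the brackets after
    a turn do not vanish.  That the bracket of a n.+1 and e n.+1 does not vanish
    either comes from the change of basis formula for brackets. *)
Lemma turning_exists : exists e a b, turning_sequence xi kappa lambda e a b.
Proof.
have [k1 nd] := eventually_nondeg hx L1 kappa_ge0 lambda_ge dec.
have [k2 br] := eventually_bracket hx L1 kappa_ge0 lambda_ge dec.
have [t [tt tlt tk nt]] := turn_times (maxn k1 k2).
have nd' n j : nondeg (x (t n + j)%N).
  apply: nd; apply: (leq_trans (leq_maxl k1 k2)); apply: (leq_trans (tk n)).
  exact: leq_addr.
have br' n : bracket_neq0 (x (t n).+1) (x (t n).+2).
  by apply: br => //; apply: (leq_trans (leq_maxr k1 k2)).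
have plane n : exists p q r s : R,
    [/\ x (t n.+1) = comb p (x (t n).+1) q (x (t n).+2),
        x (t n.+1).+1 = comb r (x (t n).+1) s (x (t n).+2),
        [/\ p \is a Num.int, q \is a Num.int, r \is a Num.int & s \is a Num.int] &
        p * s - q * r = 1 \/ p * s - q * r = -1].
  have E : ((t n).+1 + (t n.+1 - (t n).+1))%N = t n.+1 by rewrite subnKC.
  have [j jl|p [q [r [s [E1 E2 E3 E4]]]]] := @plane_basis _ _ _ hx (t n).+1 (t n.+1 - (t n).+1).
    by apply: (nt n); [rewrite addSn ltnS leq_addr | rewrite -ltn_subRL].
  by rewrite E in E1 E2; exists p, q, r, s; split.
exists (fun n => x (t n)), (fun n => x (t n).+1), (fun n => x (t n).+2); split => //.
- by move=> n; split; apply: (ms_int hx).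
- by move=> n; apply: (ms_Xge1 hx).
- by move=> n; split; [apply: (ms_X hx)|apply: (ms_L hx)].
- by move=> n; split; [apply: (ms_X hx)|apply: (ms_L hx)].
- by move=> n; apply: ms_mono; rewrite ltnS.
- by move=> n; apply: ms_mono; apply: tlt.
- by move=> n; apply: (ms_Lgt0 hx).
- move=> n; have [p [q [r [s [Ee Ea _ D]]]]] := plane n.
  have := ms_mono (leqnSn (t n).+1); set u := x (t n).+1; set v := x (t n).+2 => -[XX LL].
  have -> : 6 * (X v * L u) = 3 * (2 * (X v * L u)) by ring.
  have P : X u * L v <= X v * L u by apply: ler_pM; rewrite ?X_ge0 ?L_ge0.
  have D1 : `|p * s - q * r| = 1 by case: D => ->; rewrite ?normrN normr1.
  have bd (d d' : R) : `|d| <= L u -> `|d'| <= L v ->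
     `|c0 u * d' - d * c0 v| <= 2 * (X v * L u).
    by move=> h h'; apply: (le_trans (minor_le (lexx (X u)) h' h (lexx (X v)))); lra.
  have [u1 u2 u3] := d_le xi u; have [v1 v2 v3] := d_le xi v.
  apply: (wedge_lower hx); rewrite Ee Ea.
  + have -> : w01 (comb p u q v) (comb r u s v) =
       (p * s - q * r) * (c0 u * d1 xi v - d1 xi u * c0 v) by rewrite /w01 /d1 /=; ring.
    by rewrite normrM D1 mul1r; apply: bd.
  + have -> : w02 (comb p u q v) (comb r u s v) =
       (p * s - q * r) * (c0 u * d2 xi v - d2 xi u * c0 v) by rewrite /w02 /d2 /=; ring.
    by rewrite normrM D1 mul1r; apply: bd.
  + have -> : w03 (comb p u q v) (comb r u s v) =
       (p * s - q * r) * (c0 u * d3 xi v - d3 xi u * c0 v) by rewrite /w03 /d3 /=; ring.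
    by rewrite normrM D1 mul1r; apply: bd.
- move=> n; have [p [q [r [s [Ee Ea _ D]]]]] := plane n.
  apply: contraT => C0.
  have := nd' n.+1 0%N; have := nd' n.+1 1%N; rewrite addn0 addn1 => na ne.
  have C1 := bracket_sym na ne C0.
  have := br' n; rewrite /bracket_neq0.
  move: C0 C1; rewrite /bracket_neq0 !negb_or !negbK.
  move=> /andP[/eqP m1 /eqP p1] /andP[/eqP m2 /eqP p2].
  set f := p * s - q * r in D.
  have f2 : f * f = 1 by case: D => ->; ring.
  have Eu : x (t n).+1 = comb (f * s) (x (t n.+1)) (- (f * q)) (x (t n.+1).+1).
    rewrite Ee Ea; apply: vec_eqP; rewrite /= -[LHS]mul1r -f2 /f; ring.
  have Ev : x (t n).+2 = comb (- (f * r)) (x (t n.+1)) (f * p) (x (t n.+1).+1).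
    rewrite Ee Ea; apply: vec_eqP; rewrite /= -[LHS]mul1r -f2 /f; ring.
  by rewrite Eu Ev Cm_comb Cp_comb m1 m2 p1 p2 !mulr0 subrr !mulr0 eqxx.
- move=> n; apply: (le_trans _ (ms_Xge hx _)); rewrite ler_nat.
  have tn : (n <= t n)%N by elim: n => [|n IH] //; apply: (leq_ltn_trans IH).
  exact: leqW.
Qed.

End TurningExists.

(** * Successive turns span different spaces *)

Section Det4.
Variable R : comRingType.
Implicit Types b v w x y z : vec R.

(** The vectors b and cross x y z are parallel, so the two linear forms are
    proportional in the ratio of any pair of corresponding coordinates. *)
Lemma parallel_dot b x y z w : dot b x = 0 -> dot b y = 0 -> dot b z = 0 ->
  let v := cross x y z in
  [/\ c0 v * dot b w = c0 b * dot v w, c1 v * dot b w = c1 b * dot v w,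
      c2 v * dot b w = c2 b * dot v w & c3 v * dot b w = c3 b * dot v w].
Proof.
move=> bx yb bz v; have [e1 e2 e3 [e4 e5 e6]] := cross_parallel bx yb bz.
rewrite -/v in e1 e2 e3 e4 e5 e6; rewrite /dot; split; apply/eqP; rewrite -subr_eq0; apply/eqP.
- transitivity (c1 w * (c0 v * c1 b - c1 v * c0 b) + c2 w * (c0 v * c2 b - c2 v * c0 b) +
    c3 w * (c0 v * c3 b - c3 v * c0 b)); first by ring.
  by rewrite e1 e2 e3; ring.
- transitivity (c0 w * (c1 v * c0 b - c0 v * c1 b) + c2 w * (c1 v * c2 b - c2 v * c1 b) +
    c3 w * (c1 v * c3 b - c3 v * c1 b)); first by ring.
  by rewrite e1 e4 e5; ring.
- transitivity (c0 w * (c2 v * c0 b - c0 v * c2 b) + c1 w * (c2 v * c1 b - c1 v * c2 b) +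
    c3 w * (c2 v * c3 b - c3 v * c2 b)); first by ring.
  by rewrite e2 e4 e6; ring.
- transitivity (c0 w * (c3 v * c0 b - c0 v * c3 b) + c1 w * (c3 v * c1 b - c1 v * c3 b) +
    c2 w * (c3 v * c2 b - c2 v * c3 b)); first by ring.
  by rewrite e3 e5 e6; ring.
Qed.

Lemma dot_crossl x y z : dot (cross x y z) x = 0.
Proof. by rewrite /dot /cross /det3 /=; ring. Qed.
Lemma dot_crossm x y z : dot (cross x y z) y = 0.
Proof. by rewrite /dot /cross /det3 /=; ring. Qed.
Lemma dot_crossr x y z : dot (cross x y z) z = 0.
Proof. by rewrite /dot /cross /det3 /=; ring. Qed.

Lemma dot_comb (s t : R) w x y : dot w (comb s x t y) = s * dot w x + t * dot w y.
Proof. by rewrite /dot /=; ring. Qed.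

End Det4.

(** This is where the value of lambda3 matters.  Eliminating x and w gives
    l^2 y < (1 - 2 l) z and (1 - l) (3 l - 1 - l^2) z < l (1 - 2 l) y; by the
    equation for l both pairs of coefficients are in the same ratio. *)
Lemma growth_exponents (R : realFieldType) (l x y z w : R) :
    0 < l -> l < 1 -> 2 * l < 1 ->
    l * (1 - l) * (3 * l - 1 - l ^+ 2) = (1 - 2 * l) ^+ 2 ->
    l * y < (1 - l) * x -> l * w < (1 - l) * z ->
    l * (z + y) < (1 - l) * w -> z + l * x < (1 - l) * (y + w) ->
  False.
Proof.
move=> l0 l1 l2 E h1 h2 h3 h4.
have l1' : 0 < 1 - l by lra.
have a1 : l ^+ 2 * y < (1 - 2 * l) * z.
  have p3 : l * (l * (z + y)) < l * ((1 - l) * w) by rewrite ltr_pM2l.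
  have p2 : (1 - l) * (l * w) < (1 - l) * ((1 - l) * z) by rewrite ltr_pM2l.
  lra.
have a2 : (1 - l) * (3 * l - 1 - l ^+ 2) * z < l * (1 - 2 * l) * y.
  have ll : 0 < l * (1 - l) by rewrite mulr_gt0.
  have p4 : l * (1 - l) * (z + l * x) < l * (1 - l) * ((1 - l) * (y + w)).
    by rewrite ltr_pM2l.
  have p1 : l ^+ 2 * (l * y) < l ^+ 2 * ((1 - l) * x) by rewrite ltr_pM2l ?exprn_gt0.
  have p2 : (1 - l) ^+ 2 * (l * w) < (1 - l) ^+ 2 * ((1 - l) * z).
    by rewrite ltr_pM2l ?exprn_gt0.
  lra.
have a3 : l * ((1 - l) * (3 * l - 1 - l ^+ 2) * z) < l * (l * (1 - 2 * l) * y).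
  by rewrite ltr_pM2l.
have a4 : (1 - 2 * l) * (l ^+ 2 * y) < (1 - 2 * l) * ((1 - 2 * l) * z).
  by rewrite ltr_pM2l //; lra.
have a5 : l * ((1 - l) * (3 * l - 1 - l ^+ 2) * z) = (1 - 2 * l) ^+ 2 * z.
  by rewrite -E; ring.
lra.
Qed.

(** The same inequalities as they arise: the arguments le, la are logarithms of L
    at points e, a, and the excess of k over the constants k0, k1, k2 makes the
    inequalities strict. *)
Lemma block_exponents (R : realFieldType)
    (l k k0 k1 k2 x y z w t le1 la1 le2 la2 le3 : R) :
    0 < l -> 2 * l < 1 ->
    l * (1 - l) * (3 * l - 1 - l ^+ 2) = (1 - 2 * l) ^+ 2 ->
    0 < k -> k0 < k -> k1 < k -> k2 < k -> y <= t ->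
    le1 <= - k - l * x -> la1 <= - k - l * y -> le2 <= - k - l * z ->
    la2 <= - k - l * w -> le3 <= - k - l * t ->
    0 <= k0 + (x + la1 + le1) -> 0 <= k0 + (z + la2 + le2) ->
    0 <= k1 + (w + le3 + le2 + la2) -> z <= k2 + (y + le1 + la1 + (w + la2)) ->
  False.
Proof.
move=> l0 l2 E k0p kk0 kk1 kk2 yt de1 da1 de2 da2 de3 T1 T1' T2 EE.
have yt' : l * y <= l * t by rewrite ler_pM2l.
apply: (@growth_exponents _ l x y z w) => //; last 4 first.
- clear - T1 de1 da1 kk0 k0p; lra.
- clear - T1' de2 da2 kk0 k0p; lra.
- clear - T2 de2 da2 de3 yt' kk1 k0p; lra.
- clear - EE de1 da1 da2 kk2 k0p; lra.
clear - l2 l0; lra.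
Qed.

Section Blocks.
Variables (R : realType) (xi : R).
Notation L := (L xi).
Notation M := (M xi).
Hypothesis xi_deg : forall b : vec R, intv b -> b <> @vec0 R -> ceval xi b <> 0.
Variables (kappa lambda : R) (e a b : nat -> vec R).
Hypothesis ts : turning_sequence xi kappa lambda e a b.

Let Xa n : 0 < X (a n).
Proof. by have [h _] := ts_ea ts n; apply: lt_trans h; apply: lt_le_trans (ts_X1 ts n). Qed.
Let Xb n : 0 < X (b n). Proof. by have [h _] := ts_ab ts n; apply: lt_trans h. Qed.
Let La n : 0 < L (a n). Proof. by have [_ h] := ts_ab ts n; apply: lt_trans h; apply: ts_L0 ts n. Qed.
Let Le n : 0 < L (e n). Proof. by have [_ h] := ts_ea ts n; apply: lt_trans h. Qed.
Let Ma : 1 <= M := M_ge1 xi.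
Let M0 : 0 < M := lt_le_trans ltr01 Ma.

Lemma ts_LX n : L (a n) <= X (a n).
Proof.
have [h1 h2] := ts_ea ts n; have := ts_X1 ts n; have := ts_L1 ts n; lra.
Qed.

Lemma bracket_ge1 (u v : vec R) B : intv u -> intv v -> bracket_neq0 u v ->
  `|Cm u v| <= B -> `|Cp u v| <= B -> 1 <= B.
Proof.
move=> ui vi; rewrite /bracket_neq0 => /orP[] h h1 h2.
- by apply: le_trans h1; apply: norm_intr_ge1 => //; apply: Cm_int.
- by apply: le_trans h2; apply: norm_intr_ge1 => //; apply: Cp_int.
Qed.

Lemma bracket_le (u v : vec R) P : L u <= X u -> X u * L u * L v <= P ->
    X v * L u ^+ 2 <= P ->
  `|Cm u v| <= 64 * M ^+ 4 * P /\ `|Cp u v| <= 64 * M ^+ 4 * P.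
Proof.
move=> LX h1 h2.
have M24 : M ^+ 2 <= M ^+ 4 by rewrite ler_weXn2l.
have P0 : 0 <= P by apply: le_trans h2; rewrite mulr_ge0 ?exprn_ge0 ?L_ge0 ?X_ge0.
have s : X u * L u * L v + X v * L u ^+ 2 <= 2 * P by lra.
have M40 : 0 <= M ^+ 4 by rewrite exprn_ge0 // ltW.
have M20 : 0 <= M ^+ 2 by rewrite exprn_ge0 // ltW.
have MP : M ^+ 2 * P <= M ^+ 4 * P by apply: ler_wpM2r.
have MP0 : 0 <= M ^+ 4 * P by apply: mulr_ge0.
split.
- apply: (le_trans (Cm_le _ LX)).
  have := ler_wpM2l M20 s; lra.
- apply: (le_trans (Cp_le _ LX)).
  have := ler_wpM2l M40 s; lra.
Qed.

(** The bracket of a n.+1 and e n.+1 is a nonzero pair of integers. *)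
Lemma turning_bracket n :
  1 <= 64 * M ^+ 4 * (X (a n.+1) * L (a n.+1) * L (e n.+1)).
Proof.
have [ei ai _] := ts_int ts n.+1; have [XX LL] := ts_ea ts n.+1.
have h : X (e n.+1) * L (a n.+1) ^+ 2 <= X (a n.+1) * L (a n.+1) * L (e n.+1).
  rewrite expr2 mulrA; apply: ler_pM; rewrite ?mulr_ge0 ?L_ge0 ?X_ge0 ?(ltW LL) //.
  by rewrite ler_wpM2r ?L_ge0 // ltW.
have [h1 h2] := bracket_le (ts_LX n.+1) (lexx _) h.
exact: bracket_ge1 (ts_Cae ts n) h1 h2.
Qed.

(** As e n.+1 and a n.+1 lie in the plane of a n and b n, this vanishes if and only
    if the turns n and n.+1 span the same space. *)
Definition Delta n := det4 (e n) (a n) (b n) (b n.+1).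

(** Replacing the basis (a n, b n) by (e n.+1, a n.+1) changes the determinant at
    most by a sign and makes the points as close to the line as possible. *)
Lemma turning_det4 n : Delta n != 0 ->
  1 <= 24 * (X (b n.+1) * L (e n) * L (e n.+1) * L (a n.+1)).
Proof.
move=> D0; have [p [q [r [s [Ee Ea _ D]]]]] := ts_plane ts n.
have [ei ai bi] := ts_int ts n; have [ei' ai' bi'] := ts_int ts n.+1.
have E : det4 (e n) (e n.+1) (a n.+1) (b n.+1) = (p * s - q * r) * Delta n.
  by rewrite {1}Ee {1}Ea cross_comb.
have D1 : 1 <= `|det4 (e n) (e n.+1) (a n.+1) (b n.+1)|.
  rewrite norm_intr_ge1 //; first by apply: dot_int => //; apply: intv_cross.
  by rewrite E mulf_neq0 //; case: D => ->; rewrite ?oppr_eq0 oner_eq0.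
apply: (le_trans D1).
have [X1 L1] := ts_ea ts n; have [X2 L2] := ts_ea ts n.+1.
have [X3 L3] := ts_ab ts n.+1; have [X4 L4] := ts_ae ts n.
apply: det4_le; rewrite ?(ltW X2) ?(ltW L2) ?(ltW X3) ?(ltW L3) //.
- by apply: le_trans X4; apply: ltW.
- by apply: (le_trans L4); apply: ltW.
Qed.

Lemma block_orth n m : (forall l, (n <= l)%N -> (l < m)%N -> Delta l = 0) ->
  (n <= m)%N ->
  let v := cross (e n) (a n) (b n) in
  [/\ dot v (e m) = 0, dot v (a m) = 0 & dot v (b m) = 0].
Proof.
move=> D nm v; move: nm D => /subnKC <-; elim: (m - n)%N => [|l IH] D.
  by rewrite addn0 dot_crossl dot_crossm dot_crossr.
have [j nj jl|oe oa ob] := IH; first by apply: D => //; rewrite addnS ltnW.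
rewrite addnS; have [p [q [r [s [Ee Ea _ _]]]]] := ts_plane ts (n + l).
rewrite Ee Ea !dot_comb oa ob !mulr0 addr0; split=> //.
have D0 : dot (cross (e (n + l)%N) (a (n + l)%N) (b (n + l)%N)) (b (n + l).+1) = 0.
  by apply: D; rewrite ?leq_addr // addnS.
have := parallel_dot (b (n + l).+1) oe oa ob; rewrite /= D0 !mulr0 => -[f0 f1 f2 f3].
apply/eqP; apply: contraT => h; exfalso; apply: (ts_cross ts (n := (n + l)%N)).
by apply: vec_eqP => /=; apply: (mulIf h); rewrite mul0r.
Qed.

(** The vector v = cross (e n) (a n) (b n) defines the space common to the turns
    n, ..., m.  It is orthogonal to a m.+1, which bounds |ceval v| by
    3 |v| L (a m.+1) / X (a m.+1), but it is not orthogonal to b m.+1, so that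
    |ceval v| * X (b m.+1) cannot be small. *)
Lemma block_exit n m : (forall l, (n <= l)%N -> (l < m)%N -> Delta l = 0) ->
    (n <= m)%N -> Delta m != 0 ->
  X (a m.+1) <= 36 * (X (b n) * L (e n) * L (a n) * (X (b m.+1) * L (a m.+1))).
Proof.
move=> D nm Dm.
have [oe oa ob] := block_orth D nm; set v := cross (e n) (a n) (b n) in oe oa ob.
have [ei ai bi] := ts_int ts n; have [_ ai' bi'] := ts_int ts m.+1.
have [p [q [r [s [_ Ea _ _]]]]] := ts_plane ts m.
have oa' : dot v (a m.+1) = 0 by rewrite Ea dot_comb oa ob !mulr0 addr0.
have ob' : 1 <= `|dot v (b m.+1)|.
  rewrite norm_intr_ge1 ?dot_int ?intv_cross //; apply/eqP => z.
  have := parallel_dot (b m.+1) oe oa ob; rewrite /= z !mulr0 => -[f0 f1 f2 f3].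
  apply: (ts_cross ts (n := n)).
  by apply: vec_eqP; apply: (mulIf Dm); rewrite mul0r.
have [X1 L1] := ts_ea ts n; have [X2 L2] := ts_ab ts n; have [X3 L3] := ts_ab ts m.+1.
have [b1 b2 b3] := cross_le (ltW X1) (ltW X2) (ltW L1) (ltW L2).
rewrite -/v in b1 b2 b3.
set B := 6 * _ in b1 b2 b3.
have B0 : 0 <= B := le_trans (normr_ge0 _) b1.
have h1 : `|ceval xi v| * X (a m.+1) <= 3 * (B * L (a m.+1)).
  rewrite /X -normrM mulrC; move/eqP: oa'; rewrite (dotE xi) addr_eq0 => /eqP ->.
  by rewrite normrN; apply: dot_tail_le.
have h2 : 1 <= `|ceval xi v| * X (b m.+1) + 3 * (B * L (b m.+1)).
  apply: (le_trans ob'); rewrite (dotE xi) (mulrC (c0 _) (ceval _ _)).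
  apply: (le_trans (normD_le (lexx `|ceval xi v * c0 (b m.+1)|) (dot_tail_le xi (b m.+1) b1 b2 b3))).
  by rewrite normrM.
have h3 : X (b m.+1) * (`|ceval xi v| * X (a m.+1)) <= X (b m.+1) * (3 * (B * L (a m.+1))).
  by rewrite ler_pM2l.
have h4 : X (a m.+1) * 1 <= X (a m.+1) * (`|ceval xi v| * X (b m.+1) + 3 * (B * L (b m.+1))).
  by rewrite ler_pM2l.
have h5 : X (a m.+1) * (B * L (b m.+1)) <= X (b m.+1) * (B * L (a m.+1)).
  apply: ler_pM; [exact: X_ge0 | | exact: ltW |].
  - by apply: mulr_ge0 => //; apply: L_ge0.
  - by apply: ler_wpM2l => //; apply: ltW.
have -> : 36 * (X (b n) * L (e n) * L (a n) * (X (b m.+1) * L (a m.+1))) =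
  6 * (X (b m.+1) * (B * L (a m.+1))) by rewrite /B; ring.
lra.
Qed.

(** Otherwise all turns beyond the n-th lie in one space, which has a nonzero
    integer normal vector. *)
Lemma block_ends n : exists m, (n <= m)%N /\ Delta m != 0.
Proof.
apply: contrapT => no.
have D l : (n <= l)%N -> Delta l = 0.
  by move=> nl; apply/eqP; apply: contraT => h; case: no; exists l.
have [ei ai bi] := ts_int ts n.
case: (xi_deg (intv_cross ei ai bi) (ts_cross ts (n := n))).
apply: (@ceval0_of_orth _ _ _ (fun l => a (n + l)%N)) => l.
- by have [|_ ->] := @block_orth n (n + l)%N _ (leq_addr _ _) => // j nj _; apply: D.
- by apply: le_trans (ts_grow ts _); rewrite ler_nat leq_addl.
- have [_ h] := ts_ea ts (n + l); exact: le_trans (ltW h) (ts_L1 ts _).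
Qed.

Hypothesis lambda_ge : 14 / 33 <= lambda.
Hypothesis lambda_lt : 2 * lambda < 1.
Hypothesis lambda_eq :
  lambda * (1 - lambda) * (3 * lambda - 1 - lambda ^+ 2) = (1 - 2 * lambda) ^+ 2.
Hypothesis kappa_gt : ln (64 * M ^+ 4) < kappa.

Let k24 : ln (24 : R) < kappa.
Proof.
apply: le_lt_trans kappa_gt; rewrite ler_ln ?posrE ?mulr_gt0 ?exprn_gt0 //.
have : 1 <= M ^+ 4 by apply: exprn_ege1.
lra.
Qed.

Let k36 : ln (36 : R) < kappa.
Proof.
apply: le_lt_trans kappa_gt; rewrite ler_ln ?posrE ?mulr_gt0 ?exprn_gt0 //.
have : 1 <= M ^+ 4 by apply: exprn_ege1.
lra.
Qed.

Let kappa_gt0 : 0 < kappa.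
Proof. by apply: le_lt_trans k24; apply: ln_ge0; lra. Qed.

Lemma turning_bracket_ln n :
  0 <= ln (64 * M ^+ 4) + (ln (X (a n.+1)) + ln (L (a n.+1)) + ln (L (e n.+1))).
Proof.
have := ln_ge0 (turning_bracket n).
by rewrite lnM ?posrE ?mulr_gt0 ?exprn_gt0 // [X in _ + X]lnM ?posrE ?mulr_gt0 //
   [X in _ + (X + _)]lnM ?posrE.
Qed.

Lemma turning_det4_ln n : Delta n != 0 ->
  0 <= ln 24 + (ln (X (b n.+1)) + ln (L (e n)) + ln (L (e n.+1)) + ln (L (a n.+1))).
Proof.
move/turning_det4/ln_ge0.
by rewrite lnM ?posrE ?mulr_gt0 // [X in _ + X]lnM ?posrE ?mulr_gt0 //
   [X in _ + (X + _)]lnM ?posrE ?mulr_gt0 // [X in _ + (X + _ + _)]lnM ?posrE.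
Qed.

(** Suppose that the turns n.+1, ..., m span the same space and that m.+1 does not,
    with m > n.+1.  The brackets at both ends, the determinant on leaving the space
    and block_exit give the four inequalities of growth_exponents. *)
Lemma Delta_neq0 n : Delta n.+1 != 0.
Proof.
apply/negP => D0.
have [m0 [nm0 Dm0]] := block_ends n.+1.
have [m /andP[nm Dm] mmin] := ex_minnP (ex_intro (fun m => (n.+1 <= m)%N && (Delta m != 0)) m0
   (introT andP (conj nm0 Dm0))).
have Dl l : (n.+1 <= l)%N -> (l < m)%N -> Delta l = 0.
  move=> nl lm; apply/eqP; apply: contraT => Dl.
  by have := mmin l; rewrite nl Dl => /(_ isT); rewrite leqNgt lm.
have nm' : (n.+1 < m)%N.
  rewrite ltn_neqAle nm andbT; apply: contraNneq Dm => <-; exact: D0.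
case: m nm nm' Dm Dl {mmin} => // m nm nm' Dm Dl.
have exit := block_exit Dl nm Dm.
have mono j : X (a n.+2) <= X (a (n.+2 + j)%N).
  elim: j => [|j IH]; first by rewrite addn0.
  apply: (le_trans IH); rewrite addnS.
  by have [h _] := ts_ab ts (n.+2 + j); have [h' _] := ts_ba ts (n.+2 + j); apply: le_trans h'; apply: ltW.
have yx : ln (X (b n.+1)) <= ln (X (a m.+1)).
  rewrite ler_ln ?posrE //; have [h _] := ts_ba ts n.+1; apply: (le_trans h).
  by have := mono (m.+1 - n.+2)%N; rewrite subnKC.
have T1 := turning_bracket_ln n; have T1' := turning_bracket_ln m.+1.
have T2 := turning_det4_ln Dm.
have {exit} E : ln (X (a m.+2)) <= ln 36 + (ln (X (b n.+1)) + ln (L (e n.+1)) + ln (L (a n.+1))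
    + (ln (X (b m.+2)) + ln (L (a m.+2)))).
  rewrite -ler_ln ?posrE ?mulr_gt0 // in exit.
  by rewrite !lnM ?posrE ?mulr_gt0 // in exit.
have de1 := ts_dec_e ts n.+1; have da1 := ts_dec_a ts n.+1.
have de2 := ts_dec_e ts m.+2; have da2 := ts_dec_a ts m.+2; have de3 := ts_dec_e ts m.+1.
have k1 := kappa_gt; have k2 := k24; have k3 := k36; have k0 := kappa_gt0.
have l0 : 0 < lambda by apply: lt_le_trans lambda_ge; lra.
exact: (block_exponents l0 lambda_lt lambda_eq k0 k1 k2 k3 yx de1 da1 de2 da2 de3 T1 T1' T2 E).
Qed.

End Blocks.

(** The inequalities are those for the exponent 14/33 in place of lambda, multiplied
    by 33, so that 1 - 2 * lambda becomes 5 and 1 - lambda becomes 19; y and x with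
    the indices f, g, h, i, j belong to five successive turns.  The conclusion is
    the linear programming bound; since 14/33 exceeds the critical exponent of this
    step, a negative multiple of yh is left over, and 1/50 and 100 are convenient
    values for it and for the constant. *)
Lemma class_exponents (R : realFieldType) (K yf yg yh yi yj xg xh xi xj : R) :
    0 <= K ->
    14 * yg <= 19 * yf + K -> 14 * yh <= 19 * yg + K ->
    14 * yi <= 19 * yh + K -> 14 * yj <= 19 * yi + K ->
    33 * (xg + xh) <= 19 * (yf + yg + yh) + K ->
    33 * (xh + xi) <= 19 * (yg + yh + yi) + K ->
    33 * (xi + xj) <= 19 * (yh + yi + yj) + K ->
    yf <= xg -> yg <= xh -> yh <= xi -> yi <= xj ->
  5 * yi + 33 * xh - 14 * (yh + yi) <= 100 * K - yh / 50 /\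
  5 * yh + 33 * xi - 14 * (yi + yj) <= 100 * K - yh / 50.
Proof.
move=> K0 g1 g2 g3 g4 t1 t2 t3 m1 m2 m3 m4; split.
- clear - K0 g1 g2 g3 t1 t2 m1 m2 m3; lra.
- clear - K0 g2 g3 g4 t2 t3 m2 m3 m4; lra.
Qed.

Lemma class_decay (R : realFieldType) (k ka nB B x2 x3 y2 y3 y4 l2 l3 l4 : R) :
    0 <= k -> 0 <= ka -> 50 * (100 * k) + 50 * (33 * (ka + ka + nB)) <= y2 ->
    5 * y3 + 33 * x2 - 14 * (y2 + y3) <= 100 * k - y2 / 50 ->
    5 * y2 + 33 * x3 - 14 * (y3 + y4) <= 100 * k - y2 / 50 ->
    0 <= y3 -> l2 <= - (14 / 33 * y2) -> l3 <= - (14 / 33 * y3) ->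
    l4 <= - (14 / 33 * y4) -> B <= nB ->
  [/\ ka + x2 + l2 + l3 <= - B,
      ka + x2 + l2 + l3 + (ka + y3 + l3 + l3) <= - B &
      ka + y2 + l2 + l2 + (ka + x3 + l3 + l4) <= - B].
Proof.
move=> k0 ka0 hy c1 c2 y30 h2 h3 h4 hB.
have w : 100 * k + 33 * (ka + ka + nB) <= y2 / 50 by lra.
move: (y2 / 50) w c1 c2 => w hw c1 c2; clear hy.
split; lra.
Qed.

(** * Brackets at successive turns are proportional *)

Section Classes.
Variables (R : realType) (xi : R).
Notation L := (L xi).
Notation M := (M xi).
Hypothesis xi_deg : forall b : vec R, intv b -> b <> @vec0 R -> ceval xi b <> 0.
Variables (kappa lambda : R) (e a b : nat -> vec R).
Hypothesis ts : turning_sequence xi kappa lambda e a b.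
Hypothesis lambda_ge : 14 / 33 <= lambda.
Hypothesis lambda_lt : 2 * lambda < 1.
Hypothesis lambda_eq :
  lambda * (1 - lambda) * (3 * lambda - 1 - lambda ^+ 2) = (1 - 2 * lambda) ^+ 2.
Hypothesis kappa_gt : ln (64 * M ^+ 4) < kappa.

Let Xa n : 0 < X (a n).
Proof. by have [h _] := ts_ea ts n; apply: lt_trans h; apply: lt_le_trans (ts_X1 ts n). Qed.
Let Xb n : 0 < X (b n). Proof. by have [h _] := ts_ab ts n; apply: lt_trans h. Qed.
Let La n : 0 < L (a n). Proof. by have [_ h] := ts_ab ts n; apply: lt_trans h; apply: ts_L0 ts n. Qed.
Let Le n : 0 < L (e n). Proof. by have [_ h] := ts_ea ts n; apply: lt_trans h. Qed.
Let M1 : 1 <= M := M_ge1 xi.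
Let M0 : 0 < M := lt_le_trans ltr01 M1.
Let M41 : 1 <= M ^+ 4. Proof. exact: exprn_ege1. Qed.

Let kA := ln (64 * M ^+ 4).
Let kA0 : 0 <= kA. Proof. by apply: ln_ge0; have := M41; lra. Qed.
Let k6 := ln (6 : R).
Let k60 : 0 <= k6. Proof. by apply: ln_ge0; lra. Qed.
Let k24 := ln (24 : R).
Let k240 : 0 <= k24. Proof. by apply: ln_ge0; lra. Qed.
Let K := 33 * (kA + k24 + k6 + k6).
Let K0 : 0 <= K.
Proof. by rewrite /K; have := kA0; have := k60; have := k240; lra. Qed.

Let x n := ln (X (a n)).
Let y n := ln (X (b n)).
Let l n := ln (L (a n)).

Let y0 n : 0 <= y n.
Proof.
apply: ln_ge0; have [h _] := ts_ab ts n; have [h' _] := ts_ea ts n; have := ts_X1 ts n; lra.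
Qed.

Let l_le n : l n <= - (14 / 33 * y n).
Proof.
apply: (le_trans (ts_dec_a ts n)); rewrite -/(y n).
have := ler_wpM2r (y0 n) lambda_ge; have := le_lt_trans kA0 kappa_gt; lra.
Qed.

(** Here x, y and l are the logarithms of X at a, of X at b and of L at
    a; the point e is eliminated by means of the area of the plane. *)
Let low_ln n : ln (L (e n.+1)) <= k6 + y n + l n - x n.+1.
Proof.
have h := ts_low ts n; rewrite -ler_ln ?posrE ?mulr_gt0 // in h.
rewrite !lnM ?posrE ?mulr_gt0 // in h.
by move: h; rewrite -/(x _) -/(y _) -/(l _) -/k6; lra.
Qed.

Let yx n : y n <= x n.+1.
Proof. by rewrite ler_ln ?posrE //; have [] := ts_ba ts n. Qed.

(** The bracket inequality of turning_bracket. *)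
Let F1 n : 14 * y n.+1 <= 19 * y n + K.
Proof.
have := turning_bracket_ln ts n; rewrite -/kA -/(x _) -/(l _).
have := low_ln n; have := l_le n; have := l_le n.+1; rewrite /K.
have := kA0; have := k60; have := k240.
move: (x n.+1) (y n) (y n.+1) (l n) (l n.+1) (ln (L (e n.+1))) => x1 y1 y2 l1 l2 e1.
lra.
Qed.

(** The determinant inequality of turning_det4, which holds at every turn. *)
Let F2 n : 33 * (x n.+1 + x n.+2) <= 19 * (y n + y n.+1 + y n.+2) + K.
Proof.
have := turning_det4_ln ts (Delta_neq0 xi_deg ts lambda_ge lambda_lt lambda_eq kappa_gt n).
rewrite -/(y _) -/(l _) -/k24.
have := low_ln n; have := low_ln n.+1.
have := l_le n; have := l_le n.+1; have := l_le n.+2; rewrite /K.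
have := kA0; have := k60; have := k240.
lra.
Qed.

Definition Dxi n := Cp (a n) (b n) - xi * Cm (a n) (b n).
Let U n := 64 * M ^+ 4 * (X (b n) * L (a n) ^+ 2).
Let V n := 64 * M ^+ 4 * (X (a n) * L (a n) * L (a n.+1)).

Let U_gt0 n : 0 < U n. Proof. by rewrite !mulr_gt0 ?exprn_gt0. Qed.
Let V_gt0 n : 0 < V n. Proof. by rewrite !mulr_gt0 ?exprn_gt0. Qed.

Lemma Cm_turning_le n : `|Cm (a n) (b n)| <= U n.
Proof.
have [XX LL] := ts_ab ts n.
have h : X (a n) * L (a n) * L (b n) <= X (b n) * L (a n) ^+ 2.
  rewrite expr2 mulrA; apply: ler_pM; rewrite ?mulr_ge0 ?L_ge0 ?X_ge0 ?(ltW LL) //.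
  by rewrite ler_wpM2r ?L_ge0 // ltW.
by have [] := bracket_le (ts_LX ts n) h (lexx _).
Qed.

(** The bracket of a n and a n.+1 is a nonzero integer multiple of that of a n and
    b n, and a n.+1 is closer to the line than b n. *)
Lemma Dxi_le n : `|Dxi n| <= V n.
Proof.
have [p [q [r [s [_ Ea [pi qi ri si] D]]]]] := ts_plane ts n.
have E0 : a n = comb 1 (a n) 0 (b n) by apply: vec_eqP => /=; ring.
have Em : Cm (a n) (a n.+1) = s * Cm (a n) (b n).
  by rewrite Ea {1}E0 Cm_comb; ring.
have Ep : Cp (a n) (a n.+1) = s * Cp (a n) (b n).
  by rewrite Ea {1}E0 Cp_comb; ring.
have sn : s != 0.
  apply/eqP => s0; have [_ LL] := ts_ab ts n; have [_ LL'] := ts_ba ts n.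
  have rn : r != 0.
    by apply/eqP => r0; move: D; rewrite s0 r0 => -[]; lra.
  have r1 := norm_intr_ge1 ri rn.
  have : L (a n) <= L (a n.+1).
    have -> : a n = comb r^-1 (a n.+1) 0 (a n.+1).
      by rewrite Ea s0; apply: vec_eqP => /=; field.
    apply: (le_trans (L_comb _ _ _ _ _)); rewrite normr0 mul0r addr0 normfV.
    by rewrite ler_piMl ?L_ge0 // invf_le1 // (lt_le_trans ltr01).
  lra.
have s1 := norm_intr_ge1 si sn.
have : `|s * Dxi n| <= 24 * M ^+ 4 * (X (a n) * L (a n) * L (a n.+1)).
  have -> : s * Dxi n = Cp (a n) (a n.+1) - xi * Cm (a n) (a n.+1).
    by rewrite Em Ep /Dxi; ring.
  exact: Cp_xi_le (ts_LX ts n).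
rewrite normrM => h.
have h' : `|Dxi n| <= `|s| * `|Dxi n| by rewrite ler_peMl.
apply: (le_trans h'); apply: (le_trans h); rewrite /V ler_wpM2r ?mulr_ge0 ?L_ge0 ?X_ge0 //.
by have := M41; lra.
Qed.

Let lnUE n : ln (U n) = kA + y n + l n + l n.
Proof.
rewrite /U expr2 lnM ?posrE ?mulr_gt0 ?exprn_gt0 // -/kA.
by rewrite !lnM ?posrE ?mulr_gt0 //; rewrite /y /l; ring.
Qed.

Let lnVE n : ln (V n) = kA + x n + l n + l n.+1.
Proof.
rewrite /V lnM ?posrE ?mulr_gt0 ?exprn_gt0 // -/kA.
by rewrite !lnM ?posrE ?mulr_gt0 //; rewrite /x /l; ring.
Qed.

(** Here U bounds |Cm (a n) (b n)| and V bounds |Dxi n|.  The last two bounds make the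
    determinant of two successive brackets less than 1 in absolute value. *)
Lemma class_bounds (B : R) : exists n0, forall n, (n0 <= n)%N ->
  [/\ ln (V n) <= - B, ln (V n) + ln (U n.+1) <= - B & ln (U n) + ln (V n.+1) <= - B].
Proof.
pose T := 50 * (100 * K) + 50 * (33 * (kA + kA + `|B|)).
exists (Num.truncn (expR T)).+3 => -[//|[//|n]] hn.
have yT : T <= y n.+2.
  rewrite -[T]expRK ler_ln ?posrE ?expR_gt0 //.
  have [h _] := ts_ab ts n.+2; apply: le_trans (ltW h).
  apply: le_trans (ts_grow ts n.+2); apply/ltW/(lt_le_trans (truncnS_gt _)).
  by rewrite ler_nat; apply: leq_trans hn; rewrite ltnS -addn2 leq_addr.
have [c1 c2] := class_exponents K0 (F1 n) (F1 n.+1) (F1 n.+2) (F1 n.+3) (F2 n) (F2 n.+1)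
  (F2 n.+2) (yx n) (yx n.+1) (yx n.+2) (yx n.+3).
rewrite !lnUE !lnVE.
exact: (class_decay K0 kA0 yT c1 c2 (y0 n.+3) (l_le n.+2) (l_le n.+3) (l_le n.+4)
  (ler_norm B)).
Qed.

Lemma Dxi_neq0 n : Dxi n != 0.
Proof.
apply/eqP => D0; have [_ ai bi] := ts_int ts n.
have := xi_deg (b := Vec (Cp (a n) (b n)) (- Cm (a n) (b n)) 0 0).
rewrite /intv /= rpredN Cp_int // Cm_int // !rpred0 => /(_ isT); apply.
- case=> h1 /eqP; rewrite oppr_eq0 => h2.
  by have := ts_Cab ts n; rewrite /bracket_neq0 h1 h2 eqxx.
- rewrite /ceval /=; move: D0; rewrite /Dxi; lra.
Qed.

Lemma turning_absurd : False.
Proof.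
have [n0 hn0] := class_bounds (ln 4).
have ln4 : 0 < ln (4 : R) by apply: ln_gt0; lra.
have par n : (n0 <= n)%N ->
    Cm (a n) (b n) * Cp (a n.+1) (b n.+1) = Cp (a n) (b n) * Cm (a n.+1) (b n.+1).
  move=> hn; have [_ h1 h2] := hn0 n hn.
  have small (u v : R) : 0 < u -> 0 < v -> ln u + ln v <= - ln 4 -> u * v <= 4^-1.
    move=> u0 v0; rewrite -lnM ?posrE // -lnV ?posrE //.
    by rewrite ler_ln ?posrE ?mulr_gt0 ?invr_gt0.
  have s1 := small _ _ (V_gt0 n) (U_gt0 n.+1) h1.
  have s2 := small _ _ (U_gt0 n) (V_gt0 n.+1) h2.
  have [_ ai bi] := ts_int ts n; have [_ ai' bi'] := ts_int ts n.+1.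
  apply/eqP; rewrite -subr_eq0; apply: contraT => h.
  have := norm_intr_ge1 _ h; rewrite rpredB ?rpredM ?Cm_int ?Cp_int // => /(_ isT).
  have -> : Cm (a n) (b n) * Cp (a n.+1) (b n.+1) - Cp (a n) (b n) * Cm (a n.+1) (b n.+1) =
    Cm (a n) (b n) * Dxi n.+1 - Dxi n * Cm (a n.+1) (b n.+1) by rewrite /Dxi; ring.
  move=> /le_trans /(_ (minor_le (Cm_turning_le n) (Dxi_le n.+1) (Dxi_le n) (Cm_turning_le n.+1))).
  move=> h'; have := le_trans h' (lerD s2 s1); lra.
pose q := Cm (a n0) (b n0); pose p := Cp (a n0) (b n0).
have all n : (n0 <= n)%N -> q * Cp (a n) (b n) = p * Cm (a n) (b n).
  move=> /subnKC <-; elim: (n - n0)%N => [|j IH]; first by rewrite addn0 mulrC.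
  rewrite addnS; have := par (n0 + j)%N (leq_addr _ _); move: IH (ts_Cab ts (n0 + j)).
  rewrite /bracket_neq0; move: (Cm (a (n0 + j)%N) _) (Cp (a (n0 + j)%N) _) => s t.
  move: (Cm _ _) (Cp (a (n0 + j).+1) _) => s' t' E1 nz E2.
  case/orP: nz => nz; apply: (mulfI nz).
  - transitivity (q * (s * t')); first by ring.
    rewrite E2; transitivity ((q * t) * s'); first by ring.
    by rewrite E1; ring.
  - transitivity ((q * t) * t'); first by ring.
    rewrite E1; transitivity (p * (s * t')); first by ring.
    by rewrite E2; ring.
have D0 := Dxi_neq0 n0; pose d := `|Dxi n0|.
have d0 : 0 < d by rewrite normr_gt0.
pose Q := 1 + `|q| + `|p|.
have Q0 : 0 < Q by rewrite /Q -addrA ltr_pwDl // addr_ge0.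
have [n1 hn1] := class_bounds (1 - ln (d / Q)).
pose n := maxn n0 n1.
have [h _ _] := hn1 n (leq_maxr _ _).
have VQ : V n < d / Q.
  rewrite -ltr_ln ?posrE ?divr_gt0 //; lra.
have E := all n (leq_maxl _ _).
have Em : q * Dxi n = Cm (a n) (b n) * Dxi n0.
  by rewrite /Dxi -/q -/p mulrBr E; ring.
have Ep : p * Dxi n = Cp (a n) (b n) * Dxi n0.
  rewrite /Dxi -/q -/p; transitivity (p * Cp (a n) (b n) - xi * (p * Cm (a n) (b n))); first by ring.
  by rewrite -E; ring.
have [_ ai bi] := ts_int ts n.
have : d <= Q * `|Dxi n|.
  have D00 := normr_ge0 (Dxi n).
  case/orP: (ts_Cab ts n) => h0.
  - have : d <= `|q * Dxi n|.
      by rewrite Em normrM; apply: ler_peMl; [exact: ltW|]; apply: norm_intr_ge1 => //; apply: Cm_int.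
    by rewrite normrM => /le_trans; apply; apply: ler_wpM2r => //; rewrite /Q; have := normr_ge0 p; lra.
  - have : d <= `|p * Dxi n|.
      by rewrite Ep normrM; apply: ler_peMl; [exact: ltW|]; apply: norm_intr_ge1 => //; apply: Cp_int.
    by rewrite normrM => /le_trans; apply; apply: ler_wpM2r => //; rewrite /Q; have := normr_ge0 q; lra.
apply/negP; rewrite -ltNge mulrC -ltr_pdivlMr //.
exact: le_lt_trans (Dxi_le n) VQ.
Qed.

End Classes.

(** * The uniform exponent of approximation *)

Section Records.
Variables (R : realType) (xi : R).
Notation L := (L xi).
Notation M := (M xi).
Hypothesis xi_deg : forall b : vec R, intv b -> b <> @vec0 R -> ceval xi b <> 0.

(** The integer point of height q closest to the line. *)
Definition pt (q : nat) : vec R :=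
  Vec q%:R (rnd (xi * q%:R)) (rnd (xi ^+ 2 * q%:R)) (rnd (xi ^+ 3 * q%:R)).

Lemma pt_int q : intv (pt q).
Proof. by rewrite /intv /= !rnd_int natr_int. Qed.

Lemma pt_half q : L (pt q) <= 2^-1.
Proof.
by rewrite L_le /d1 /d2 /d3 /=; apply/and3P; split; rewrite distrC rnd_le.
Qed.

Lemma pt_gt0 q : (0 < q)%N -> 0 < L (pt q).
Proof.
move=> q0; rewrite lt_neqAle L_ge0 andbT eq_sym; apply/eqP => h.
have [h1 _ _] := d_le xi (pt q); move: h1; rewrite h normr_le0 => /eqP h1.
apply: (xi_deg (b := Vec (rnd (xi * q%:R)) (- q%:R) 0 0)).
- by rewrite /intv /= rnd_int rpredN natr_int rpred0.
- by case=> _ /eqP; rewrite oppr_eq0 pnatr_eq0 eqn0Ngt q0.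
- by move: h1; rewrite /ceval /d1 /=; lra.
Qed.

Lemma L_ge1 (z : vec R) : intv z -> z <> @vec0 R -> c0 z = 0 -> 1 <= L z.
Proof.
move=> /and4P[_ z1 z2 z3] zn z0; have [h1 h2 h3] := d_le xi z.
move: h1 h2 h3; rewrite /d1 /d2 /d3 z0 !mulr0 !subr0 => h1 h2 h3.
have [e1|n1] := eqVneq (c1 z) 0; last by apply: le_trans h1; apply: norm_intr_ge1.
have [e2|n2] := eqVneq (c2 z) 0; last by apply: le_trans h2; apply: norm_intr_ge1.
have [e3|n3] := eqVneq (c3 z) 0; last by apply: le_trans h3; apply: norm_intr_ge1.
by case: zn; apply: vec_eqP.
Qed.

Lemma pt_min (z : vec R) : intv z -> c0 z != 0 ->
  exists q, [/\ (0 < q)%N, q%:R = X z & L (pt q) <= L z].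
Proof.
move=> zi zn; have /and4P[z0 z1 z2 z3] := zi.
have [q qE] : exists q : nat, X z = q%:R by apply/natrP; apply: natr_norm_int.
exists q; split => //.
  by rewrite -(ltr_nat R) -qE normr_gt0.
have [h1 h2 h3] := d_le xi z.
have key (t s : R) : t \is a Num.int -> `|t - s * c0 z| <= L z ->
    `|rnd (s * q%:R) - s * q%:R| <= L z.
  move=> ti; apply: le_trans; rewrite -qE /X distrC.
  have [c|c] := leP 0 (c0 z).
  - by rewrite (ger0_norm c) (distrC t); apply: rnd_min.
  - have nt : - t \is a Num.int by rewrite rpredN.
    by rewrite (ltr0_norm c); apply: (le_trans (rnd_min _ nt)); rewrite mulrN opprK addrC.
rewrite L_le /d1 /d2 /d3 /=; apply/and3P; split.
- exact: (key (c1 z)).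
- exact: (key (c2 z)).
- exact: (key (c3 z)).
Qed.

Hypothesis small : forall eps : R, 0 < eps ->
  exists z, [/\ intv z, z <> @vec0 R & L z < eps].

(** The points of heights q_0 = 1 < q_1 < ..., where q_(k+1) is the least q whose
    multiples q xi, q xi^2, q xi^3 are closer to integers, in the maximum norm, than
    those of q_k. *)
Lemma minimal_sequence_exists : exists x : nat -> vec R,
  minimal_sequence xi x /\ forall k, L (x k) <= 1.
Proof.
have ex q : exists j, (0 < q)%N ==> ((0 < j)%N && (L (pt j) < L (pt q))).
  case: q => [|q]; first by exists 0%N.
  have [z [zi zn zL]] := small (pt_gt0 (ltn0Sn q)).
  have zc : c0 z != 0.
    apply/eqP => z0; have := L_ge1 zi zn z0; have := pt_half q.+1; lra.
  have [j [j0 _ jL]] := pt_min zi zc; exists j.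
  by rewrite /= j0 (le_lt_trans jL).
pose nxt q := ex_minn (ex q).
have nxtP q : (0 < q)%N -> [/\ (0 < nxt q)%N, L (pt (nxt q)) < L (pt q) &
    forall j, (0 < j)%N -> (j < nxt q)%N -> L (pt q) <= L (pt j)].
  move=> q0; rewrite /nxt; case: ex_minnP => j; rewrite q0 => /andP[j0 jL] mn.
  split => // i i0 ij; rewrite leNgt; apply/negP => iL.
  by have := mn i; rewrite i0 iL => /(_ isT); rewrite leqNgt ij.
pose fix Q k := if k is j.+1 then nxt (Q j) else 1%N.
have Q0 k : (0 < Q k)%N by elim: k => // k /nxtP[].
have QL k : L (pt (Q k.+1)) < L (pt (Q k)) by case: (nxtP _ (Q0 k)).
have Qmin k j : (0 < j)%N -> (j < Q k.+1)%N -> L (pt (Q k)) <= L (pt j).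
  by case: (nxtP _ (Q0 k)) => _ _; apply.
have Qlt k : (Q k < Q k.+1)%N.
  rewrite ltnNge; apply/negP; rewrite leq_eqVlt => /orP[/eqP e|].
    by have := QL k; rewrite e ltxx.
  case: k => [|k]; first by rewrite ltnS leqn0 => /eqP e; have := Q0 1%N; rewrite e.
  by move=> /(Qmin k _ (Q0 _)); rewrite leNgt (lt_trans (QL k.+1) (QL k)).
exists (fun k => pt (Q k)); split=> [|k]; last by have := pt_half (Q k); lra.
split.
- by move=> k; apply: pt_int.
- by move=> k; rewrite ltr0n.
- by move=> k; rewrite /X /= !normr_nat ltr_nat.
- exact: QL.
- move=> k z zi zX zL.
  have [z0|zc] := eqVneq (c0 z) 0.
    apply: contrapT => zn; have := L_ge1 zi zn z0; have := pt_half (Q k).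
    by move=> h1 h2; have := lt_le_trans zL h1; lra.
  have [q [q0 qE qL]] := pt_min zi zc.
  have : (q < Q k.+1)%N by move: zX; rewrite -qE /X /= normr_nat ltr_nat.
  by move=> /(Qmin k q q0); rewrite leNgt (le_lt_trans qL zL).
Qed.

End Records.

Section UniformExponent.
Variables (R : realType) (xi : R).
Notation L := (L xi).
Hypothesis xi_deg : forall b : vec R, intv b -> b <> @vec0 R -> ceval xi b <> 0.
Variable lambda : R.
Hypothesis lambda_ge : 14 / 33 <= lambda.
Hypothesis lambda_lt : 2 * lambda < 1.
Hypothesis lambda_eq :
  lambda * (1 - lambda) * (3 * lambda - 1 - lambda ^+ 2) = (1 - 2 * lambda) ^+ 2.

Lemma minimal_sequence_shift (x : nat -> vec R) k0 :
  minimal_sequence xi x -> minimal_sequence xi (fun k => x (k0 + k)%N).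
Proof.
case=> h1 h2 h3 h4 h5; split => k; rewrite ?addnS; [exact: h1|exact: h2|exact: h3|exact: h4|].
exact: h5.
Qed.

(** In the contrary case, a nonzero integer point of height at most
    T = X x_(k+1) / 2 cannot be closer to the line than x_k, by minimality; so
    L x_k <= c T^(-lambda).  The constant c is chosen so that the factor
    2^lambda due to the halving is absorbed and exp(-kappa) remains. *)
Theorem uniform_exponent : exists2 c : R, 0 < c & forall B : R,
  exists2 T, B <= T & forall z, intv z -> z <> @vec0 R -> X z <= T ->
    c * T `^ (- lambda) < L z.
Proof.
have l0 : 0 < lambda by apply: lt_le_trans lambda_ge; lra.
pose kappa := `|ln (64 * M xi ^+ 4)| + 1.
have kappa_gt : ln (64 * M xi ^+ 4) < kappa.
  by have := ler_norm (ln (64 * M xi ^+ 4)); rewrite /kappa; lra.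
have kappa0 : 0 <= kappa by rewrite addr_ge0.
pose c := expR (- kappa - lambda * ln 2).
exists c; first exact: expR_gt0.
apply: contrapT => no.
have [B sol] : exists B : R, forall T, B <= T -> exists z,
    [/\ intv z, z <> @vec0 R, X z <= T & L z <= c * T `^ (- lambda)].
  apply: contrapT => no'; apply: no => B; apply: contrapT => h; apply: no'.
  exists B => T BT; apply: contrapT => h'; apply: h; exists T => // z zi zn zT.
  by rewrite ltNge; apply/negP => zL; apply: h'; exists z.
have small (eps : R) : 0 < eps -> exists z, [/\ intv z, z <> @vec0 R & L z < eps].
  move=> e0; pose t := `|B| + 1 + (`|ln c| + `|ln eps| + 1) / lambda.
  have t0 : 0 <= (`|ln c| + `|ln eps| + 1) / lambda.
    by rewrite divr_ge0 ?(ltW l0) // !addr_ge0.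
  have [|z [zi zn _ zL]] := sol (expR t).
    have : t <= expR t by apply: (le_trans _ (expR_ge1Dx t)); lra.
    by have := ler_norm B; rewrite {1}/t; lra.
  exists z; split => //; apply: (le_lt_trans zL).
  rewrite -expRM -expRD -[ltRHS](lnK (_ : eps \is Num.pos)) ?posrE // ltr_expR.
  have tl : `|ln c| + `|ln eps| + 1 <= t * lambda.
    by rewrite /t mulrDl divfK ?gt_eqF // lerDr mulr_ge0 ?(ltW l0) //.
  have := ler_norm (ln c); have := ler_norm (- ln eps); rewrite normrN /c expRK in tl *.
  rewrite mulrN; lra.
have [x [hx L1]] := minimal_sequence_exists xi_deg small.
have [k0 hk0] := ms_lnX hx (ln 2 + `|B|).
pose x' k := x (k0 + k)%N.
have hx' : minimal_sequence xi x' := minimal_sequence_shift k0 hx.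
have L1' k : L (x' k) <= 1 by apply: L1.
have dec k : ln (L (x' k)) <= - kappa - lambda * ln (X (x' k.+1)).
  have Xp : 0 < X (x' k.+1) := ms_Xgt0 hx' k.+1.
  have lnX : ln 2 + `|B| <= ln (X (x' k.+1)) by apply: hk0; rewrite leq_addr.
  pose T := X (x' k.+1) / 2; have T0 : 0 < T by rewrite divr_gt0.
  have lnT : ln T = ln (X (x' k.+1)) - ln 2.
    by rewrite /T lnM ?posrE ?invr_gt0 // lnV ?posrE.
  have [|z [zi zn zX zL]] := sol T.
    have h1 : ln T + 1 <= T.
      by have := expR_ge1Dx (ln T); rewrite lnK ?posrE // addrC.
    have := ler_norm B; lra.
  have : L (x' k) <= L z.
    rewrite leNgt; apply/negP => h; apply: zn; apply: (ms_min hx' zi _ h).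
    by apply: (le_lt_trans zX); rewrite /T; lra.
  move=> /le_trans /(_ zL) h.
  rewrite -ler_ln ?posrE ?mulr_gt0 ?powR_gt0 ?expR_gt0 ?(ms_Lgt0 hx') // in h.
  rewrite lnM ?posrE ?powR_gt0 ?expR_gt0 // ln_powR expRK lnT in h.
  by apply: (le_trans h); rewrite mulNr mulrBr; lra.
have [e [a [b ts]]] := turning_exists xi_deg hx' L1' kappa0 lambda_ge dec.
exact: (turning_absurd xi_deg ts lambda_ge lambda_lt lambda_eq kappa_gt).
Qed.

End UniformExponent.

(** * Covering radius and dual vectors *)

Section Hermite.
Variable R : realType.

Definition iv n (z : 'rV[int]_n) : 'rV[R]_n := map_mx intr z.

(** Boundedness away from 0 on the integer vectors, rather than positive
    definiteness, is the property that survives projection along a near-minimal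
    vector by a direct estimate. *)
Record lattice_form n (b : 'rV[R]_n -> 'rV[R]_n -> R) : Prop := LatticeForm {
  lf_sym : forall u v, b u v = b v u;
  lf_lin : forall s u v w, b (s *: u + v) w = s * b u w + b v w;
  lf_ge0 : forall u, 0 <= b u u;
  lf_eps : exists2 eps : R, 0 < eps &
    forall z : 'rV[int]_n, z != 0 -> eps <= b (iv z) (iv z) }.

Lemma lf_quad n (b : 'rV[R]_n -> 'rV[R]_n -> R) s u v : lattice_form b ->
  b (s *: u + v) (s *: u + v) = s ^+ 2 * b u u + 2 * s * b u v + b v v.
Proof.
move=> hb; rewrite (lf_lin hb) (lf_sym hb u) (lf_sym hb v) !(lf_lin hb) (lf_sym hb v u); ring.
Qed.

Lemma lf_lin2 n (b : 'rV[R]_n -> 'rV[R]_n -> R) s u v w : lattice_form b ->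
  b w (s *: u + v) = s * b w u + b w v.
Proof. by move=> hb; rewrite (lf_sym hb) (lf_lin hb) !(lf_sym hb w). Qed.

Lemma lf0 n (b : 'rV[R]_n -> 'rV[R]_n -> R) w : lattice_form b -> b w 0 = 0.
Proof.
move=> hb; have := lf_lin2 1 0 0 w hb.
by rewrite scaler0 addr0 mul1r => /eqP; rewrite addrC -subr_eq subrr eq_sym => /eqP.
Qed.

Lemma lf_sub n (b : 'rV[R]_n -> 'rV[R]_n -> R) u v : lattice_form b ->
  b v v <= 2 * (b u u + b (u - v) (u - v)).
Proof.
move=> hb.
have e1 : b (u - v) (u - v) = b v v - 2 * b v u + b u u.
  rewrite -[u - v]addrC -scaleN1r (lf_quad _ _ _ hb); ring.
have e2 : b v v - 2 * (2 * b v u) + 4 * b u u = b ((-1 : R) *: v + 2 *: u) ((-1 : R) *: v + 2 *: u).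
  rewrite (lf_quad _ _ _ hb) -[2 *: u]addr0 (lf_lin hb) !(lf_lin2 _ _ _ _ hb).
  have z0 w := lf0 w hb.
  by rewrite (lf_sym hb 0) !z0; ring.
have := lf_ge0 hb ((-1 : R) *: v + 2 *: u); rewrite -e2 e1; lra.
Qed.

Definition int_pairing n (x : 'cV[int]_n) (z : 'rV[R]_n) : R := (z *m map_mx intr x) 0 0.

(** An integer vector v whose value is within a factor 2 of the infimum; the factor
    spares the proof that the infimum is attained.  By its Smith normal form v is a
    multiple of the first row of a unimodular matrix, and that row is even better. *)
Lemma near_minimal n (b : 'rV[R]_n.+1 -> 'rV[R]_n.+1 -> R) : lattice_form b ->
  exists2 U : 'M[int]_n.+1, U \in unitmx & forall z : 'rV[int]_n.+1, z != 0 ->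
    b (iv (row 0 U)) (iv (row 0 U)) <= 2 * b (iv z) (iv z).
Proof.
move=> hb; have [eps e0 he] := lf_eps hb.
pose S : set R := [set t | exists2 z : 'rV[int]_n.+1, z != 0 & t = b (iv z) (iv z)].
have S0 : has_inf S.
  split.
    exists (b (iv (delta_mx 0 0)) (iv (delta_mx 0 0))), (delta_mx 0 0) => //.
    by apply/eqP => /rowP /(_ 0); rewrite !mxE !eqxx.
  by exists eps => _ [z zn ->]; apply: he.
have iS : eps <= inf S by apply: lb_le_inf; [case: S0 | move=> _ [z zn ->]; apply: he].
have [_ [v vn ->] hv] := inf_adherent (lt_le_trans e0 iS) S0.
have minv z : z != 0 -> b (iv v) (iv v) <= 2 * b (iv z) (iv z).
  move=> zn; have : inf S <= b (iv z) (iv z) by apply: (ge_inf S0.2); exists z.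
  lra.
have [P Pu [U Uu [d _ vE]]] := int_Smith_normal_form v.
exists U => // z zn; apply: le_trans (minv z zn).
have vE' : v = (P 0 0 * d`_0) *: row 0 U.
  rewrite {1}vE; apply/rowP => j; rewrite !mxE.
  rewrite (bigD1 0) //= big1 ?addr0.
    by rewrite !mxE big_ord1 !mxE eqxx mulr1n.
  move=> i ni; rewrite !mxE big_ord1 !mxE.
  case: eqP => [e|_]; last by rewrite mulr0n mulr0 mul0r.
  by case/eqP: ni; apply: val_inj.
set s := P 0 0 * _ in vE'.
have sn : s != 0 by apply: contraNneq vn => s0; rewrite vE' s0 scale0r.
have -> : iv v = s%:~R *: iv (row 0 U) + 0 by rewrite addr0 /iv vE' map_mxZ.
rewrite (lf_quad _ _ _ hb).
have z0 w := lf0 w hb.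
rewrite !z0 mulr0 !addr0 ler_peMl ?(lf_ge0 hb) //.
rewrite -(real_normK (num_real _)) exprn_ege1 //.
by rewrite norm_intr_ge1 ?intr_int ?intr_eq0.
Qed.

(** A short vector x of the dual lattice, of squared dual norm at most 1 / A, while
    every real vector is within squared distance C A of an integer one. *)
Definition dual_pair n (b : 'rV[R]_n -> 'rV[R]_n -> R) (C A : R) (x : 'cV[int]_n) :=
  [/\ 0 < A, x != 0, forall z, A * int_pairing x z ^+ 2 <= b z z &
      forall g, exists m : 'rV[int]_n, b (g - iv m) (g - iv m) <= C * A].

Lemma near_int_sqr (a : R) : exists k : int, (k%:~R + a) ^+ 2 <= 4^-1.
Proof.
exists (- Num.floor (a + 2^-1)); have := rnd_le a; rewrite /rnd => h.
rewrite intrN addrC -(real_normK (num_real _)).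
have -> : (4^-1 : R) = 2^-1 ^+ 2 by field.
by rewrite ler_pXn2r ?nnegrE // invr_ge0.
Qed.

(** Let e be a near-minimal vector of a basis and b' the form induced on the
    orthogonal projection along e.  A dual vector of b' is one of b.  For covering,
    lift an approximation for b' and adjust the component along e, at an additional
    cost of A1 / 4 with A1 = b e e. *)
Lemma hermite_step n (C : R) : 0 < C ->
    (forall b : 'rV[R]_n.+1 -> 'rV[R]_n.+1 -> R, lattice_form b ->
      exists A x, dual_pair b C A x) ->
  forall b : 'rV[R]_(1 + n.+1) -> 'rV[R]_(1 + n.+1) -> R, lattice_form b ->
      exists A x, dual_pair b (11 * C) A x.
Proof.
move=> C0 IH b hb.
have [U Uu hU] := near_minimal hb.
pose V : 'M[int]_(1 + n.+1) := invmx U; pose Ur : 'M[R]_(1 + n.+1) := map_mx intr U.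
pose Vr : 'M[R]_(1 + n.+1) := map_mx intr V.
have UV : Ur *m Vr = 1%:M by rewrite -map_mxM mulmxV // map_mx1.
have VU : Vr *m Ur = 1%:M by rewrite -map_mxM mulVmx // map_mx1.
pose e := iv (row 0 U).
have rn : row 0 U != 0.
  apply/eqP => h; have : row 0 U *m V = 0 by rewrite h mul0mx.
  rewrite -row_mul mulmxV // => /rowP /(_ 0); rewrite !mxE eqxx.
  by move/eqP; rewrite oner_eq0.
pose A1 := b e e.
have A10 : 0 < A1 by have [eps e0 he] := lf_eps hb; apply: lt_le_trans e0 (he _ rn).
have eE : e = usubmx Ur.
  apply/rowP => j; rewrite !mxE; congr (U _ _)%:~R.
  by apply: val_inj.
pose inj (u : 'rV[R]_n.+1) : 'rV[R]_(1 + n.+1) := u *m dsubmx Ur.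
have inj_lin s u v : inj (s *: u + v) = s *: inj u + inj v.
  by rewrite /inj mulmxDl scalemxAl.
have splitE (y : 'rV[R]_(1 + n.+1)) : y *m Ur = y 0 0 *: e + inj (rsubmx y).
  rewrite -{1}[y]hsubmxK -[Ur]vsubmxK mul_row_col -eE [lsubmx y]mx11_scalar mul_scalar_mx.
  by rewrite mxE; congr (y _ _ *: _ + _); apply: val_inj.
pose l u := b e (inj u) / A1.
have l_lin s u v : l (s *: u + v) = s * l u + l v.
  by rewrite /l inj_lin (lf_lin2 _ _ _ _ hb) mulrDl mulrA.
pose p u := (- l u) *: e + inj u.
have p_lin s u v : p (s *: u + v) = s *: p u + p v.
  rewrite /p inj_lin l_lin; move: (inj u) (inj v) => iu iw.
  by apply/rowP => i; rewrite !mxE; ring.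
have ep u : b e (p u) = 0.
  rewrite /p (lf_lin2 _ _ _ _ hb) -/A1 /l; field; exact: lt0r_neq0.
pose b' u v := b (p u) (p v).
have dec (t : R) u : t *: e + inj u = (t + l u) *: e + p u.
  by rewrite /p addrA -scalerDl addrK.
have bE (t : R) u : b (t *: e + inj u) (t *: e + inj u) = (t + l u) ^+ 2 * A1 + b' u u.
  by rewrite dec (lf_quad _ _ _ hb) ep mulr0 addr0.
have ivE (k : int) (m : 'rV[int]_n.+1) :
    iv (row_mx k%:M m *m U) = k%:~R *: e + inj (iv m).
  rewrite /iv map_mxM -/Ur splitE map_row_mx row_mxKr; congr (_ *: _ + _).
  by rewrite !mxE; case: splitP => // i _; rewrite !mxE !ord1 eqxx mulr1n.
have nzU (k : int) (m : 'rV[int]_n.+1) : m != 0 -> row_mx k%:M m *m U != 0.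
  apply: contraNneq => h; have : row_mx k%:M m *m U *m V = 0 by rewrite h mul0mx.
  rewrite mulmxK // => /(congr1 (@rsubmx _ _ 1 n.+1)); rewrite row_mxKr => ->.
  by apply/eqP/rowP => i; rewrite !mxE.
(* An integer vector of the projection has a lift whose component along e is at
   most half of e; the near-minimality of e gives A1 <= 2 (A1 / 4 + b' m m). *)
have A1le (m : 'rV[int]_n.+1) : m != 0 -> A1 <= 4 * b' (iv m) (iv m).
  move=> mn; have [k hk] := near_int_sqr (l (iv m)).
  have := hU _ (nzU k m mn); rewrite ivE bE -/e -/A1 => h.
  have : (k%:~R + l (iv m)) ^+ 2 * A1 <= 4^-1 * A1 by rewrite ler_wpM2r // ltW.
  lra.
have hb' : lattice_form b'.
  split.
  - by move=> u v; rewrite /b' (lf_sym hb).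
  - by move=> s u v w; rewrite /b' p_lin (lf_lin hb).
  - by move=> u; apply: (lf_ge0 hb).
  - exists (4^-1 * A1); first by rewrite mulr_gt0.
    by move=> m /A1le; lra.
have [A [x [A0 xn hx hc]]] := IH b' hb'.
exists A, (V *m col_mx (0 : 'cV_1) x); split => //.
- apply: contraNneq xn => h; have : U *m (V *m col_mx (0 : 'cV_1) x) = 0 by rewrite h mulmx0.
  rewrite mulKVmx // => /(congr1 (@dsubmx _ 1 n.+1 _)); rewrite col_mxKd => ->.
  by apply/eqP/colP => i; rewrite !mxE.
- move=> z; pose y := z *m Vr.
  have zE : z = y 0 0 *: e + inj (rsubmx y) by rewrite -splitE /y -mulmxA VU mulmx1.
  have -> : int_pairing (V *m col_mx (0 : 'cV_1) x) z = int_pairing x (rsubmx y).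
    rewrite /int_pairing map_mxM map_col_mx map_mx0 mulmxA -/y -{1}[y]hsubmxK mul_row_col.
    by rewrite mulmx0 add0r.
  rewrite zE bE; apply: (le_trans (hx _)); rewrite lerDr.
  by rewrite mulr_ge0 ?sqr_ge0 // ltW.
-
  (* A real vector of b'-value 4 C A is within C A of an integer vector, which is
     therefore nonzero and of value at most 2 (4 C A + C A) = 10 C A. *)
  have A1A : A1 <= 40 * (C * A).
    pose m0 : 'rV[int]_n.+1 := delta_mx 0 0.
    have m0n : m0 != 0 by apply/eqP => /rowP /(_ 0); rewrite !mxE !eqxx.
    pose B := b' (iv m0) (iv m0).
    have B0 : 0 < B by have := A1le _ m0n; rewrite -/B; lra.
    have CA0 : 0 < C * A by rewrite mulr_gt0.
    pose s := Num.sqrt (4 * (C * A) / B).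
    have s2 : s ^+ 2 * B = 4 * (C * A).
      by rewrite sqr_sqrtr ?divfK ?gt_eqF // divr_ge0 ?(ltW B0) // mulr_ge0 // ltW.
    have z0 w := lf0 w hb'.
    have gE : b' (s *: iv m0) (s *: iv m0) = 4 * (C * A).
      by rewrite -[s *: iv m0]addr0 (lf_quad _ _ _ hb') !z0 -/B s2; ring.
    have [m hm] := hc (s *: iv m0).
    have mn : m != 0.
      by apply: contraTneq hm => ->; rewrite /iv map_mx0 subr0 gE -ltNge; lra.
    have := lf_sub (s *: iv m0) (iv m) hb'; rewrite gE => h.
    have := A1le _ mn; lra.
  move=> g; pose y := g *m Vr.
  have gE : g = y 0 0 *: e + inj (rsubmx y) by rewrite -splitE /y -mulmxA VU mulmx1.
  have [m hm] := hc (rsubmx y).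
  have [k hk] := near_int_sqr (- (y 0 0 + l (rsubmx y - iv m))).
  exists (row_mx k%:M m *m U).
  have -> : g - iv (row_mx k%:M m *m U) = (y 0 0 - k%:~R) *: e + inj (rsubmx y - iv m).
    rewrite ivE {1}gE; have -> : inj (rsubmx y - iv m) = inj (rsubmx y) - inj (iv m).
      exact: mulmxBl.
    move: (inj _) (inj _) (y 0 0) => iu iw t.
    by apply/rowP => i; rewrite !mxE; ring.
  rewrite bE.
  have : (y 0 0 - k%:~R + l (rsubmx y - iv m)) ^+ 2 * A1 <= 4^-1 * A1.
    rewrite ler_wpM2r ?(ltW A10) //; apply: le_trans hk.
    by rewrite -sqrrN le_eqVlt; apply/orP; left; apply/eqP; congr (_ ^+ 2); ring.
  lra.
Qed.

End Hermite.

(** * From simultaneous approximation to integer polynomials *)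

Section Transference.
Variable R : realType.

Lemma hermite n : exists2 C : R, 0 < C &
  forall b : 'rV[R]_n.+1 -> 'rV[R]_n.+1 -> R, lattice_form b ->
    exists A x, dual_pair b C A x.
Proof.
elim: n => [|n [C C0 IH]]; last first.
  by exists (11 * C); [rewrite mulr_gt0 | exact: hermite_step].
exists 1 => // b hb; pose o : 'rV[int]_1 := const_mx 1.
have on : o != 0 by apply/eqP => /rowP /(_ 0); rewrite !mxE.
have A0 : 0 < b (iv R o) (iv R o).
  by have [eps e0 he] := lf_eps hb; apply: lt_le_trans e0 (he _ on).
have zE (z : 'rV[R]_1) : z = z 0 0 *: iv R o + 0.
  by apply/rowP => i; rewrite !mxE ord1 mulr1 addr0.
have z0 w := lf0 w hb.
have bE z : b z z = z 0 0 ^+ 2 * b (iv R o) (iv R o).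
  by rewrite {1 2}[z]zE (lf_quad _ _ _ hb) !z0 mulr0 !addr0.
exists (b (iv R o) (iv R o)), (const_mx 1); split => //.
- by move=> z; rewrite (bE z) /int_pairing !mxE big_ord1 !mxE mulr1 mulrC.
- move=> g; have [k hk] := near_int_sqr (- g 0 0); exists (const_mx k).
  rewrite (bE (g - _)) ler_wpM2r ?(ltW A0) // !mxE -sqrrN opprB; lra.
Qed.

Variable xi : R.

(** Coordinates indexed by natural numbers; all uses have k < 4, the range in which
    inord is the inclusion. *)
Definition co (u : 'rV[R]_4) k : R := u 0 (inord k).
Definition vec_of (u : 'rV[R]_4) := Vec (co u 0) (co u 1) (co u 2) (co u 3).
Definition row_of (v : vec R) : 'rV[R]_4 :=
  \row_i [:: c0 v; c1 v; c2 v; c3 v]`_i.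

Lemma vec_ofK v : vec_of (row_of v) = v.
Proof. by apply: vec_eqP; rewrite /= /co mxE inordK. Qed.

Lemma sum4 (f : 'I_4 -> R) :
  \sum_i f i = f (inord 0) + f (inord 1) + f (inord 2) + f (inord 3).
Proof.
rewrite !big_ord_recl big_ord0 addr0 !addrA.
by congr (f _ + f _ + f _ + f _); apply: val_inj; rewrite /= ?inordK.
Qed.

(** On coefficient vectors, take the quadratic form T^2 ceval^2 + delta^2 (c1^2 + c2^2 + c3^2).
    A dual vector w of squared dual norm less than 1 would satisfy X w <= T and
    L w <= delta: test it against (T, 0, 0, 0), of value T^4, and against the
    polynomials Y^j - xi^j, of value delta^2.  Hence the covering constant is at
    most C. *)
Theorem transference : exists2 K : R, 0 < K & forall T delta : R, 0 < T -> 0 < delta ->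
  (forall z : vec R, intv z -> z <> @vec0 R -> X z <= T -> delta < L xi z) ->
  forall g : vec R, exists m : vec R,
    [/\ intv m, T * `|ceval xi (comb 1 g (-1) m)| <= K,
        delta * `|c1 g - c1 m| <= K, delta * `|c2 g - c2 m| <= K &
        delta * `|c3 g - c3 m| <= K].
Proof.
have [C C0 hC] := hermite 3; exists (Num.sqrt C); first by rewrite sqrtr_gt0.
move=> T delta T0 d0 noz g.
pose ev u := ceval xi (vec_of u).
pose b u v : R := T ^+ 2 * (ev u * ev v) +
  delta ^+ 2 * (co u 1 * co v 1 + co u 2 * co v 2 + co u 3 * co v 3).
have T20 : 0 < T ^+ 2 by rewrite exprn_gt0.
have d20 : 0 < delta ^+ 2 by rewrite exprn_gt0.
have coE s u v k : co (s *: u + v) k = s * co u k + co v k by rewrite /co !mxE.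
have bq u : b u u = T ^+ 2 * ev u ^+ 2 + delta ^+ 2 * (co u 1 ^+ 2 + co u 2 ^+ 2 + co u 3 ^+ 2).
  by rewrite /b; ring.
have hb : lattice_form b.
  split.
  - by move=> u v; rewrite /b; ring.
  - by move=> s u v w; rewrite /b /ev /ceval /= !coE; ring.
  - move=> u; rewrite bq addr_ge0 // mulr_ge0 ?(ltW T20) ?(ltW d20) ?sqr_ge0 //.
    by rewrite !addr_ge0 ?sqr_ge0.
  - exists (Num.min (T ^+ 2) (delta ^+ 2)); first by rewrite lt_min T20.
    move=> z zn; rewrite bq ge_min.
    have zi k : co (iv R z) k \is a Num.int by rewrite /co mxE intr_int.
    have sq1 k : co (iv R z) k != 0 -> 1 <= co (iv R z) k ^+ 2.
      by move=> h; rewrite -(real_normK (num_real _)) exprn_ege1 // norm_intr_ge1.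
    have s0 k := sqr_ge0 (co (iv R z) k).
    have e0 := sqr_ge0 (ev (iv R z)).
    have E0 : 0 <= T ^+ 2 * ev (iv R z) ^+ 2 by rewrite mulr_ge0 // ltW.
    have [z1|n1] := eqVneq (co (iv R z) 1) 0; last first.
      apply/orP; right; have := sq1 _ n1; have := s0 2%N; have := s0 3%N => a1 a2 a3.
      rewrite -[leLHS]add0r -[leLHS]addr0 ; nra.
    have [z2|n2] := eqVneq (co (iv R z) 2) 0; last first.
      apply/orP; right; have := sq1 _ n2; have := s0 1%N; have := s0 3%N => a1 a2 a3.
      nra.
    have [z3|n3] := eqVneq (co (iv R z) 3) 0; last first.
      apply/orP; right; have := sq1 _ n3; have := s0 1%N; have := s0 2%N => a1 a2 a3.
      nra.
    apply/orP; left; rewrite /ev /ceval /= z1 z2 z3.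
    have -> (s : R) : T ^+ 2 * (s + 0 * xi + 0 * xi ^+ 2 + 0 * xi ^+ 3) ^+ 2 +
      delta ^+ 2 * (0 ^+ 2 + 0 ^+ 2 + 0 ^+ 2) = T ^+ 2 * s ^+ 2 by ring.
    rewrite ler_peMr ?(ltW T20) //; apply: sq1; apply: contraNneq zn => z0.
    apply/eqP/rowP => j; rewrite !mxE; apply/eqP; rewrite -(intr_eq0 R); apply/eqP.
    have zE k : (k < 4)%N -> (z 0 (inord k))%:~R = co (iv R z) k by rewrite /co mxE.
    rewrite -[j]inord_val zE ?ltn_ord //.
    by case: j => -[|[|[|[|]]]].
have [A [x [A0 xn hx hc]]] := hC b hb.
pose w := vec_of (map_mx intr x)^T.
have wi : intv w by rewrite /intv /w /= /co !mxE !intr_int.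
have ZE v : int_pairing x (row_of v) = dot w v.
  rewrite /int_pairing mxE sum4 /dot /w /= /co !mxE !inordK //=; ring.
have wn : w <> @vec0 R.
  case=> w0 w1 w2 w3; case/eqP: xn; apply/colP => i; rewrite mxE; apply/eqP.
  rewrite -(intr_eq0 R); apply/eqP.
  have : i = inord i by rewrite inord_val.
  case: i => -[|[|[|[|//]]]] hi /= ->; [rewrite -[RHS]w0|rewrite -[RHS]w1|rewrite -[RHS]w2|rewrite -[RHS]w3];
    by rewrite /co !mxE.
have evE v : ev (row_of v) = ceval xi v by rewrite /ev vec_ofK.
have cE v : [/\ co (row_of v) 1 = c1 v, co (row_of v) 2 = c2 v & co (row_of v) 3 = c3 v].
  by have := vec_ofK v; case: v => v0 v1 v2 v3 [].
have bv v : b (row_of v) (row_of v) =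
    T ^+ 2 * ceval xi v ^+ 2 + delta ^+ 2 * (c1 v ^+ 2 + c2 v ^+ 2 + c3 v ^+ 2).
  by rewrite bq evE; case: (cE v) => -> -> ->.
have A1 : A <= 1.
  rewrite leNgt; apply/negP => A1.
  have key v B : 0 <= B -> b (row_of v) (row_of v) = B ^+ 2 -> `|dot w v| <= B.
    move=> B0 bB; rewrite -(ler_pXn2r (ltn0Sn 1)) ?nnegrE // -bB (real_normK (num_real _)) -ZE.
    by apply: le_trans (hx _); rewrite ler_peMl ?sqr_ge0 // ltW.
  have h0 : X w <= T.
    have := @key (Vec T 0 0 0) (T ^+ 2) (ltW T20).
    rewrite bv /ceval /dot /= !mul0r !addr0 !mulr0 !addr0 expr0n /= !addr0 mulr0 addr0.
    rewrite normrM (gtr0_norm T0) expr2 ler_pM2r // => -> //; ring.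
  have := noz w wi wn h0; rewrite ltNge L_le => /negP; apply; apply/and3P; split.
  - have := @key (Vec (- xi) 1 0 0) delta (ltW d0); rewrite bv /ceval /dot /d1 /=.
    have -> : c0 w * - xi + c1 w * 1 + c2 w * 0 + c3 w * 0 = c1 w - xi * c0 w by ring.
    by apply; ring.
  - have := @key (Vec (- xi ^+ 2) 0 1 0) delta (ltW d0); rewrite bv /ceval /dot /d2 /=.
    have -> : c0 w * - xi ^+ 2 + c1 w * 0 + c2 w * 1 + c3 w * 0 = c2 w - xi ^+ 2 * c0 w by ring.
    by apply; ring.
  - have := @key (Vec (- xi ^+ 3) 0 0 1) delta (ltW d0); rewrite bv /ceval /dot /d3 /=.
    have -> : c0 w * - xi ^+ 3 + c1 w * 0 + c2 w * 0 + c3 w * 1 = c3 w - xi ^+ 3 * c0 w by ring.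
    by apply; ring.
have [m hm] := hc (row_of g); exists (vec_of (iv R m)).
have mE : row_of g - iv R m = row_of (comb 1 g (-1) (vec_of (iv R m))).
  apply/rowP => i; rewrite !mxE.
  have mi : (m 0 i)%:~R = co (iv R m) i by rewrite /co mxE inord_val.
  rewrite mi; case: i {mi} => -[|[|[|[|//]]]] hi /=; ring.
rewrite mE bv /= in hm.
have {}hm : T ^+ 2 * ceval xi (comb 1 g (-1) (vec_of (iv R m))) ^+ 2 +
  delta ^+ 2 * ((c1 g - co (iv R m) 1) ^+ 2 + (c2 g - co (iv R m) 2) ^+ 2 + (c3 g - co (iv R m) 3) ^+ 2) <= C.
  apply: le_trans (_ : C * A <= C); last by rewrite ler_piMr // ltW.
  apply: le_trans hm; rewrite le_eqVlt; apply/orP; left; apply/eqP; ring.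
have sq (B t : R) : 0 < B -> B ^+ 2 * t ^+ 2 <= C -> B * `|t| <= Num.sqrt C.
  move=> B0 h; rewrite -[B](gtr0_norm B0) -normrM -sqrtr_sqr ler_sqrt ?(ltW C0) //.
  by rewrite exprMn.
have p0 := mulr_ge0 (ltW T20) (sqr_ge0 (ceval xi (comb 1 g (-1) (vec_of (iv R m))))).
have p1 := mulr_ge0 (ltW d20) (sqr_ge0 (c1 g - co (iv R m) 1)).
have p2 := mulr_ge0 (ltW d20) (sqr_ge0 (c2 g - co (iv R m) 2)).
have p3 := mulr_ge0 (ltW d20) (sqr_ge0 (c3 g - co (iv R m) 3)).
rewrite !mulrDr in hm.
have fin (p q r s : R) : 0 <= p -> 0 <= q -> 0 <= r -> 0 <= s -> p + (q + r + s) <= C ->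
  [/\ p <= C, q <= C, r <= C & s <= C] by move=> *; split; lra.
have [q0 q1 q2 q3] := fin _ _ _ _ p0 p1 p2 p3 hm.
by split; [rewrite /intv /= /co !mxE !intr_int | exact: sq..].
Qed.

End Transference.

(** * Degree and irreducible polynomial of a root *)

Section Numbers.
Variable F : numFieldType.
Implicit Types z : F.

Lemma irreducible_dvd_root (p q : {poly rat}) z : irreducible_poly p ->
    root (map_poly ratr p) z -> root (map_poly ratr q) z -> p %| q.
Proof.
move=> [_ pirr] pz qz; have [g1|gn] := eqVneq (size (gcdp p q)) 1%N.
  have : coprimep (map_poly (ratr : rat -> F) p) (map_poly ratr q).
    by rewrite coprimep_map /coprimep g1.
  by move/coprimep_root => /(_ _ pz); rewrite -rootE qz.
rewrite -(eqp_dvdl _ (pirr _ gn (dvdp_gcdl p q))); exact: dvdp_gcdr.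
Qed.

Lemma degreeQ_le (p : {poly rat}) z : p != 0 -> root (map_poly ratr p) z ->
  (degreeQ z <= (size p).-1)%N.
Proof.
move=> pn pz; rewrite /degreeQ /minpolyQ.
case: xgetP => [q _ [_ qi qz]|_]; last by rewrite size_poly0.
have := dvdp_leq pn (irreducible_dvd_root qi qz pz).
by case: (size q) => // m; case: (size p).
Qed.

Lemma map_ratr_intr (P : {poly int}) :
  map_poly (ratr : rat -> F) (map_poly intr P) = map_poly intr P.
Proof. by rewrite -map_poly_comp; apply: eq_map_poly => a /=; rewrite ratr_int. Qed.

Lemma irreducible_monicZX (P : {poly int}) :
  P \is monic -> irreducible_poly P -> irreducibleZX P.
Proof.
move=> Pm [P1 Pirr]; have Pn := monic_neq0 Pm.
split => // [|A B E].
  by apply/negP => /andP[/eqP]; move: P1; case: (size P) => // -[].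
have An : A != 0 by apply: contraNneq Pn => A0; rewrite E A0 mul0r.
have Bn : B != 0 by apply: contraNneq Pn => B0; rewrite E B0 mulr0.
have lc : lead_coef A * lead_coef B = 1.
  by rewrite -lead_coefM -E; apply/eqP; rewrite -monicE.
have lA : lead_coef A \is a GRing.unit by apply/unitrPr; exists (lead_coef B).
have lB : lead_coef B \is a GRing.unit.
  by apply/unitrPr; exists (lead_coef A); rewrite mulrC.
have sz : size P = (size A + size B).-1 by rewrite E size_mul.
have [A1|A1] := eqVneq (size A) 1%N.
  left; rewrite poly_unitE A1 eqxx /=.
  by move: lA; rewrite lead_coefE A1.
right.
have AP : A %| P by rewrite E dvdp_mulIl.
have /eqp_size sA := Pirr _ A1 AP.
have B1 : size B = 1%N.
  move: sz; rewrite -sA.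
  have : (0 < size A)%N by rewrite size_poly_gt0.
  have : (0 < size B)%N by rewrite size_poly_gt0.
  case: (size A) => // m; case: (size B) => // k _ _; rewrite addSn /= addnS.
  by move=> [/eqP]; rewrite -{1}[m]addn0 eqn_add2l => /eqP <-.
by rewrite poly_unitE B1 eqxx /=; move: lB; rewrite lead_coefE B1.
Qed.

(** Another candidate Q is divisible by P over the integers, because P is monic;
    irreducibility makes the quotient a unit, and the sign is fixed by the leading
    coefficient. *)
Lemma irrpolyZ_monic (P : {poly int}) z : P \is monic -> irreducible_poly P ->
  root (map_poly intr P) z -> irrpolyZ z = P.
Proof.
move=> Pm Pirr Pz; apply: xget_unique.
  split=> //; first exact: irreducible_monicZX.
  by rewrite (eqP (_ : lead_coef P == 1)) // -monicE.
move=> Q [[Qn Qu Qirr] Ql Qz].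
have : P %| Q.
  rewrite -dvdp_rat_int; apply: (@irreducible_dvd_root _ _ z).
  - exact/irreducible_rat_int.
  - by rewrite map_ratr_intr.
  - by rewrite map_ratr_intr.
move=> /(Pdiv.IdomainMonic.dvdpP Pm)[A E].
have [|] := Qirr _ _ E; last first.
  by case: (irreducible_monicZX Pm Pirr) => _ /negbTE ->.
rewrite poly_unitE => /andP[/size_poly1P[c cn Ac]].
rewrite Ac coefC eqxx => cu.
move: Ql; rewrite E Ac lead_coefM lead_coefC (eqP (_ : lead_coef P == 1)) -?monicE //.
rewrite mulr1 => c0.
by case/orP: cu c0 => /eqP ->; rewrite // mul1r.
Qed.

End Numbers.

(** * A root near a point with large derivative *)

Section NearRoot.
Variable F : numClosedFieldType.

(** If all four roots were farther than B from x, then each of the four products in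
    P'(x), times B, would be less than |P(x)|. *)
Lemma near_root (P : {poly F}) (x B : F) : P \is monic -> size P = 5%N ->
    0 <= B -> P^`().[x] != 0 -> 4 * `|P.[x]| <= `|P^`().[x]| * B ->
  exists2 z, root P z & `|x - z| <= B.
Proof.
move=> Pm P5 B0 dn h.
have [r E] := closed_field_poly_normal P.
have r4 : size r = 4%N.
  by move: P5; rewrite E (eqP (_ : lead_coef P == 1)) -?monicE // scale1r size_prod_XsubC => -[].
rewrite (eqP (_ : lead_coef P == 1)) -?monicE // scale1r in E.
case: r r4 E => [//|a [//|b [//|c [//|d [|//]]]]] _.
rewrite !big_cons big_nil mulr1 => E0.
have {E0} E : P = ('X - a%:P) * (('X - b%:P) * (('X - c%:P) * ('X - d%:P))) := E0.
have root_in z : z \in [:: a; b; c; d] -> root P z.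
  rewrite !inE => /or4P[] /eqP ->; rewrite E !rootM !root_XsubC eqxx ?orbT //.
have [le|no] := boolP (has (fun z => `|x - z| <= B) [:: a; b; c; d]).
  by have [z zr zB] := hasP le; exists z => //; apply: root_in.
exfalso; move/hasPn: no => no.
have gt z : z \in [:: a; b; c; d] -> B < `|x - z|.
  by move=> /no; rewrite -real_ltNge // ger0_real.
have ga := gt a; have gb := gt b; have gc := gt c; have gd := gt d.
rewrite !inE eqxx in ga; rewrite !inE eqxx orbT in gb.
rewrite !inE eqxx !orbT in gc; rewrite !inE eqxx !orbT in gd.
have {}ga := ga isT; have {}gb := gb isT; have {}gc := gc isT; have {}gd := gd isT.
have Px : P.[x] = (x - a) * ((x - b) * ((x - c) * (x - d))).
  by rewrite E !hornerM !hornerXsubC.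
have dPx : P^`().[x] = (x - b) * ((x - c) * (x - d)) + (x - a) * ((x - c) * (x - d)) +
   (x - a) * ((x - b) * (x - d)) + (x - a) * ((x - b) * (x - c)).
  rewrite E !derivM !derivXsubC !mul1r !mulr1 !(hornerXsubC, hornerM, hornerD); ring.
have pa := le_lt_trans B0 ga; have pb := le_lt_trans B0 gb.
have pc := le_lt_trans B0 gc; have pd := le_lt_trans B0 gd.
have tri : `|P^`().[x]| <= `|x - b| * (`|x - c| * `|x - d|) + `|x - a| * (`|x - c| * `|x - d|) +
   `|x - a| * (`|x - b| * `|x - d|) + `|x - a| * (`|x - b| * `|x - c|).
  rewrite dPx -!normrM.
  apply: (le_trans (ler_normD _ _)); rewrite lerD2r.
  apply: (le_trans (ler_normD _ _)); rewrite lerD2r.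
  exact: ler_normD.
suff : `|P^`().[x]| * B < 4 * `|P.[x]| by rewrite (le_gtF h).
have tri' := ler_wpM2r B0 tri; apply: (le_lt_trans tri').
rewrite Px !normrM.
move: ga gb gc gd pa pb pc pd; move: `|x - a| `|x - b| `|x - c| `|x - d| => s t u v.
move=> ga gb gc gd pa pb pc pd.
have -> : 4 * (s * (t * (u * v))) = t * (u * v) * s + s * (u * v) * t + s * (t * v) * u + s * (t * u) * v by ring.
by rewrite !mulrDl !ltrD // ltr_pM2l // !mulr_gt0.
Qed.

End NearRoot.

(** * The exponent lambda3 *)

Section Lambda.
Variable R : realType.
Let s : R := Num.sqrt 5.
Let t : R := Num.sqrt (7 + 2 * s).

Let s2 : s ^+ 2 = 5. Proof. by rewrite sqr_sqrtr. Qed.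
Let s0 : 0 <= s. Proof. exact: sqrtr_ge0. Qed.
Let t2 : t ^+ 2 = 7 + 2 * s.
Proof. by rewrite sqr_sqrtr // addr_ge0 // mulr_ge0. Qed.
Let t0 : 0 <= t. Proof. exact: sqrtr_ge0. Qed.

Lemma lambda3_ge : 14 / 33 <= lambda3 R.
Proof.
rewrite /lambda3 -/s -/t.
have s_ge : 223 / 100 <= s.
  by rewrite -(ler_pXn2r (ltn0Sn 1)) ?nnegrE ?divr_ge0 // s2; lra.
have : t <= s + 38 / 33.
  rewrite -(ler_pXn2r (ltn0Sn 1)) ?nnegrE //; last by rewrite addr_ge0 // divr_ge0.
  rewrite t2 sqrrD s2; lra.
lra.
Qed.

Lemma lambda3_lt : 2 * lambda3 R < 1.
Proof.
rewrite /lambda3 -/s -/t.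
have : 1 + s < t.
  rewrite -(ltr_pXn2r (ltn0Sn 1)) ?nnegrE // ?addr_ge0 // t2 sqrrD s2; lra.
lra.
Qed.

(** Let g be the golden ratio.  Then l = lambda3 is a root of l^2 - (2 g + 1) l + g, that
    is, l (1 - l) = g (1 - 2 l), and 3 l - 1 - l^2 = (g - 1) (1 - 2 l); finally
    g (g - 1) = 1. *)
Lemma lambda3_eq : lambda3 R * (1 - lambda3 R) * (3 * lambda3 R - 1 - lambda3 R ^+ 2) =
  (1 - 2 * lambda3 R) ^+ 2.
Proof.
set l := lambda3 R; pose g := (1 + s) / 2.
have q : l ^+ 2 - (2 + s) * l + (1 + s) / 2 = 0.
  have : (2 * l - (2 + s)) ^+ 2 = 7 + 2 * s.
    by rewrite -t2 /l /lambda3 -/s -/t; field.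
  rewrite sqrrB sqrrD s2; lra.
have e1 : l * (1 - l) = g * (1 - 2 * l).
  by move: q; rewrite /g; lra.
have e2 : 3 * l - 1 - l ^+ 2 = (g - 1) * (1 - 2 * l).
  transitivity (l * (1 - l) - (1 - 2 * l)); first by ring.
  by rewrite e1; ring.
rewrite e1 e2; have g2 : g * (g - 1) = 1.
  by rewrite /g; transitivity ((s ^+ 2 - 1) / 4); [field|rewrite s2; lra].
by transitivity (g * (g - 1) * (1 - 2 * l) ^+ 2); [ring|rewrite g2 mul1r].
Qed.

End Lambda.

(** * The polynomials Y^4 + 2 + 4 Q *)

Section Quartic.

Definition quartic (m0 m1 m2 m3 : int) : {poly int} :=
  Poly [:: 2 + 4 * m0; 4 * m1; 4 * m2; 4 * m3; 1].

Variables m0 m1 m2 m3 : int.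
Notation P := (quartic m0 m1 m2 m3).

Lemma quartic_seq : P = [:: 2 + 4 * m0; 4 * m1; 4 * m2; 4 * m3; 1] :> seq int.
Proof. by rewrite /quartic (@PolyK _ 0). Qed.

Lemma quartic_monic : P \is monic.
Proof. by rewrite monicE lead_coefE quartic_seq. Qed.

(** Eisenstein's criterion at 2: the constant coefficient 2 + 4 m0 is not divisible
    by 4. *)
Lemma quartic_irreducible : irreducible_poly P.
Proof.
apply: (@eisenstein_crit 2) => //.
- by rewrite quartic_seq.
- by rewrite lead_coefE quartic_seq.
- rewrite quartic_seq /=; apply/negP => /dvdzP[k]; rewrite expr2; lia.
- move=> i; rewrite quartic_seq /=.
  case: i => [|[|[|[|//]]]] _ /=; rewrite ?dvdz_mulr //.
  by rewrite rpredD // dvdz_mulr.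
Qed.

Lemma quarticE : P = 'X^4 + (4 * m3) *: 'X^3 + (4 * m2) *: 'X^2 + (4 * m1) *: 'X
    + (2 + 4 * m0)%:P.
Proof.
apply/polyP => i; rewrite quartic_seq !coefD !coefZ !coefXn coefX coefC.
by case: i => [|[|[|[|[|i]]]]] /=; rewrite ?nth_nil ?mulr0 ?mulr1 ?add0r ?addr0.
Qed.

Lemma quartic_eval (K : comNzRingType) (x : K) :
  (map_poly intr P).[x] =
    x ^+ 4 + 4 * m3%:~R * x ^+ 3 + 4 * m2%:~R * x ^+ 2 + 4 * m1%:~R * x + (2 + 4 * m0%:~R).
Proof.
have cE : (2 + 4 * m0)%:~R = 2 + 4 * m0%:~R :> K by rewrite intrD intrM.
rewrite quarticE -cE; move: (2 + 4 * m0) => c.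
rewrite !rmorphD /= !map_polyZ !map_polyXn map_polyX map_polyC.
by rewrite !(hornerXn, hornerX, hornerZ, hornerC, hornerD) /= !intrM.
Qed.

Lemma quartic_deriv_eval (K : comNzRingType) (x : K) :
  (map_poly intr P)^`().[x] =
    4 * x ^+ 3 + 12 * m3%:~R * x ^+ 2 + 8 * m2%:~R * x + 4 * m1%:~R.
Proof.
rewrite quarticE; move: (2 + 4 * m0) => c.
rewrite !rmorphD /= !map_polyZ !map_polyXn map_polyX map_polyC.
rewrite !derivD !derivZ !derivXn derivX derivC addr0 !(hornerMn, hornerXn, hornerX, hornerZ, hornerC, hornerD) /=.
by rewrite !intrM; ring.
Qed.

Variables (F : numFieldType) (z : F).
Hypothesis Pz : root (map_poly intr P) z.

Lemma quartic_integer : algebraic_integer z.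
Proof. by exists P; rewrite ?quartic_monic. Qed.

Lemma quartic_degree : (degreeQ z <= 4)%N.
Proof.
have Pn : map_poly (intr : int -> rat) P != 0.
  by apply: monic_neq0; apply: monic_map; apply: quartic_monic.
have := @degreeQ_le _ (map_poly intr P) z Pn; rewrite map_ratr_intr => /(_ Pz).
by rewrite size_map_poly_id0 ?intr_eq0 ?lead_coef_eq0 ?monic_neq0 ?quartic_monic // quartic_seq.
Qed.

Lemma quartic_irrpolyZ : irrpolyZ z = P.
Proof. exact: irrpolyZ_monic quartic_monic quartic_irreducible Pz. Qed.

Lemma quartic_height_ge i : (`|(P`_i)%R| <= height z)%N.
Proof.
rewrite /height quartic_irrpolyZ; case: (ltnP i (size P)) => [h|h].
  exact: (leq_bigmax_cond (F := fun j : 'I_(size P) => `|(P`_j)%R|%N) (Ordinal h)).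
by rewrite nth_default.
Qed.

Lemma quartic_height_le (R : realDomainType) (B : R) : `|2 + 4 * m0%:~R| <= B -> `|4 * m1%:~R| <= B ->
    `|4 * m2%:~R| <= B -> `|4 * m3%:~R| <= B -> 1 <= B ->
  (height z)%:R <= B.
Proof.
move=> b0 b1 b2 b3 b4.
rewrite /height quartic_irrpolyZ; apply: (big_ind (fun n => n%:R <= B)).
- exact: le_trans b4.
- by move=> n1 n2 h1 h2; rewrite /maxn; case: ifP.
move=> i _; have ab (n : int) : (`|n|%N)%:R = `|n%:~R| :> R by rewrite natr_absz intr_norm.
move: (nat_of_ord i) => k; rewrite ab quartic_seq.
case: k => [|[|[|[|[|k]]]]] /=; rewrite ?intrD ?intrM ?normr1 //.
by rewrite nth_nil normr0 (le_trans ler01).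
Qed.

End Quartic.

(** * Quartic integers close to xi *)

Section Final.
Variables (R : realType) (xi : R).
Notation M := (M xi).

Lemma ceval0_algebraic (b : vec R) : intv b -> b <> @vec0 R -> ceval xi b = 0 ->
  algebraic_number xi /\ (degreeQ xi <= 3)%N.
Proof.
case: b => b0 b1 b2 b3 /and4P[/intrP[m0 /= ->] /intrP[m1 /= ->] /intrP[m2 /= ->] /intrP[m3 /= ->]] bn b0E.
pose p : {poly rat} := Poly [:: m0%:~R; m1%:~R; m2%:~R; m3%:~R].
have coefp j : p`_j = [:: m0%:~R; m1%:~R; m2%:~R; m3%:~R]`_j by rewrite coef_Poly.
have pn : p != 0.
  apply/eqP => p0; apply: bn.
  have z (m : int) j : p`_j = m%:~R -> m%:~R = 0 :> R.
    by rewrite p0 coef0 => /esym/eqP; rewrite intr_eq0 => /eqP ->.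
  by apply: vec_eqP => /=; [apply: (z _ 0%N)|apply: (z _ 1%N)|apply: (z _ 2%N)|apply: (z _ 3%N)];
    rewrite coefp.
have sp : (size p <= 4)%N by apply: size_Poly.
have pz : root (map_poly ratr p) xi.
  apply/rootP; rewrite -b0E /ceval /=.
  rewrite (@horner_coef_wide _ 4) ?(leq_trans (size_map_poly_leq _ _)) ?size_map_poly //.
  rewrite !big_ord_recl big_ord0 !coef_map /= !coefp /= !ratr_int.
  by rewrite expr0 mulr1 expr1 addr0 !addrA.
split; first by exists p.
by apply: (leq_trans (degreeQ_le pn pz)); case: (size p) sp.
Qed.

(** The linear polynomial g is such that Y^4 + 2 + 4 g vanishes at xi and such that 4 g
    has derivative W.  Replacing g by its integer approximation moves the derivative
    at xi by at most 24 M^2 k, and the term Y^4 contributes at most 4 M^3; so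
    W = 4 M^3 + 25 M^2 k leaves at least k = K / delta. *)
Lemma quartic_approximation (K T delta : R) : 0 < K -> 1 <= T -> 0 < delta ->
    1 <= K / delta ->
    (forall g : vec R, exists m : vec R,
    [/\ intv m, T * `|ceval xi (comb 1 g (-1) m)| <= K,
        delta * `|c1 g - c1 m| <= K, delta * `|c2 g - c2 m| <= K &
        delta * `|c3 g - c3 m| <= K]) ->
  exists m0 m1 m2 m3 : int, let P : {poly R} := map_poly intr (quartic m0 m1 m2 m3) in
  [/\ `|P.[xi]| <= 4 * K / T, K / delta <= `|P^`().[xi]| &
    [/\ `|2 + 4 * m0%:~R| <= (4 * K + 42 * M ^+ 4) * (K / delta),
       `|4 * m1%:~R| <= (4 * K + 42 * M ^+ 4) * (K / delta),
       `|4 * m2%:~R| <= (4 * K + 42 * M ^+ 4) * (K / delta) &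
       `|4 * m3%:~R| <= (4 * K + 42 * M ^+ 4) * (K / delta)]].
Proof.
move=> K0 T1 d0 k1 tr; set k := K / delta in k1 *.
have T0 : 0 < T := lt_le_trans ltr01 T1.
have M1 := M_ge1 xi; have M0 := M_ge0 xi; have xM := xi_leM xi.
pose W := 4 * M ^+ 3 + 25 * M ^+ 2 * k.
have [m [/and4P[/intrP[m0 E0] /intrP[m1 E1] /intrP[m2 E2] /intrP[m3 E3]] h0 h1 h2 h3]] :=
  tr (Vec ((- xi ^+ 4 - 2 - W * xi) / 4) (W / 4) 0 0).
exists m0, m1, m2, m3; rewrite /= quartic_eval quartic_deriv_eval -E0 -E1 -E2 -E3.
set u := ceval _ _ in h0; rewrite /= in h1 h2 h3.
have k_le (a : R) : delta * `|a| <= K -> `|a| <= k by rewrite /k ler_pdivlMr // mulrC.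
have {}h1 := k_le _ h1; have {}h2 := k_le _ h2; have {}h3 := k_le _ h3.
rewrite sub0r normrN in h2; rewrite sub0r normrN in h3.
have u_le : `|u| <= K / T by rewrite ler_pdivlMr // mulrC.
have PE : xi ^+ 4 + 4 * c3 m * xi ^+ 3 + 4 * c2 m * xi ^+ 2 + 4 * c1 m * xi + (2 + 4 * c0 m) =
  - (4 * u) by rewrite /u /ceval /=; field.
have k0 : 0 <= k := le_trans ler01 k1.
have x2 : `|xi ^+ 2| <= M ^+ 2 by rewrite normrX ler_pXn2r ?nnegrE.
have x3 : `|xi ^+ 3| <= M ^+ 3 by rewrite normrX ler_pXn2r ?nnegrE.
have x4 : `|xi ^+ 4| <= M ^+ 4 by rewrite normrX ler_pXn2r ?nnegrE.
have n4 (a B : R) : `|a| <= B -> `|4 * a| <= 4 * B.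
  by move=> h; apply: normM_le => //; rewrite ger0_norm.
have Pb : `|- (4 * u)| <= 4 * K / T by rewrite normrN -mulrA; apply: n4.
have M2 : 1 <= M ^+ 2 by apply: exprn_ege1.
have MM12 : M <= M ^+ 2 by rewrite ler_eXnr.
have MM24 : M ^+ 2 <= M ^+ 4 by rewrite ler_weXn2l.
have MM34 : M ^+ 3 <= M ^+ 4 by rewrite ler_weXn2l.
have M4k : 0 <= M ^+ 4 * k by rewrite mulr_ge0 ?exprn_ge0.
have Kk : K <= K * k by rewrite ler_peMr // ltW.
have W0 : 0 <= W.
  by rewrite /W; have := exprn_ge0 3 M0; have := mulr_ge0 (exprn_ge0 2 M0) k0; lra.
have m1_le : `|4 * c1 m| <= W + 4 * k.
  have -> : 4 * c1 m = W - 4 * (W / 4 - c1 m) by field.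
  by apply: normB_le; [rewrite ger0_norm|apply: n4].
have Wk : M * (W + 4 * k) <= 33 * (M ^+ 4 * k).
  have -> : M * (W + 4 * k) = 4 * M ^+ 4 + 25 * (M ^+ 3 * k) + 4 * (M * k) by rewrite /W; ring.
  have a1 : M ^+ 4 <= M ^+ 4 * k by rewrite ler_peMr ?exprn_ge0.
  have a2 : M ^+ 3 * k <= M ^+ 4 * k by rewrite ler_wpM2r.
  have a3 : M * k <= M ^+ 4 * k by rewrite ler_wpM2r // (le_trans MM12).
  lra.
have Kk0 : 0 <= K * k by rewrite mulr_ge0 // ltW.
have C_ge (a : R) : a <= 33 * (M ^+ 4 * k) -> a <= (4 * K + 42 * M ^+ 4) * k.
  move=> h; apply: (le_trans h); rewrite mulrDl -!mulrA; lra.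
split; first by rewrite PE.
- have -> : 4 * xi ^+ 3 + 12 * c3 m * xi ^+ 2 + 8 * c2 m * xi + 4 * c1 m =
    W - (4 * (W / 4 - c1 m) - 12 * (c3 m * xi ^+ 2) - 8 * (c2 m * xi) - 4 * xi ^+ 3) by field.
  apply: le_trans (lerB_dist _ _); rewrite (ger0_norm W0).
  have b1 : `|c3 m * xi ^+ 2| <= k * M ^+ 2 by apply: normM_le.
  have b2 : `|c2 m * xi| <= k * M by apply: normM_le.
  have n12 (a B : R) : `|a| <= B -> `|12 * a| <= 12 * B.
    by move=> h; apply: normM_le => //; rewrite ger0_norm.
  have n8 (a B : R) : `|a| <= B -> `|8 * a| <= 8 * B.
    by move=> h; apply: normM_le => //; rewrite ger0_norm.
  have S := normB_le (normB_le (normB_le (n4 _ _ h1) (n12 _ _ b1)) (n8 _ _ b2)) (n4 _ _ x3).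
  rewrite lerBrDr -lerBrDl; apply: (le_trans S); rewrite /W.
  have a1 : k <= M ^+ 2 * k by rewrite ler_peMl.
  have a2 : k * M <= M ^+ 2 * k by rewrite mulrC ler_wpM2r.
  rewrite (mulrC k (M ^+ 2)); lra.
split.
- have -> : 2 + 4 * c0 m = - (4 * u) - 4 * c1 m * xi - 4 * (c2 m * xi ^+ 2) - 4 * (c3 m * xi ^+ 3) - xi ^+ 4.
    by rewrite -PE; ring.
  have b1 : `|c2 m * xi ^+ 2| <= k * M ^+ 2 by apply: normM_le.
  have b2 : `|c3 m * xi ^+ 3| <= k * M ^+ 3 by apply: normM_le.
  apply: (le_trans (normB_le (normB_le (normB_le (normB_le Pb (normM_le m1_le xM)) (n4 _ _ b1)) (n4 _ _ b2)) x4)).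
  have a1 : 4 * K / T <= 4 * K by rewrite ler_pdivrMr // ler_peMr // mulr_ge0 // ltW.
  have a2 : k * M ^+ 2 <= M ^+ 4 * k by rewrite mulrC ler_wpM2r.
  have a3 : k * M ^+ 3 <= M ^+ 4 * k by rewrite mulrC ler_wpM2r.
  have a4 : M ^+ 4 <= M ^+ 4 * k by rewrite ler_peMr ?exprn_ge0.
  have -> : (4 * K + 42 * M ^+ 4) * k = 4 * (K * k) + 42 * (M ^+ 4 * k) by ring.
  rewrite (mulrC (W + _)).
  move: (4 * K / T) (M * (W + 4 * k)) (k * M ^+ 2) (k * M ^+ 3) (M ^+ 4) (M ^+ 4 * k) (K * k)
    a1 Wk a2 a3 a4 Kk M4k; clear => *; lra.
- apply: (le_trans m1_le); apply: C_ge; apply: le_trans Wk.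
  by rewrite ler_peMl // addr_ge0 // mulr_ge0.
- apply: (le_trans (n4 _ _ h2)); apply: C_ge.
  have : k <= M ^+ 4 * k by rewrite ler_peMl // exprn_ege1.
  lra.
- apply: (le_trans (n4 _ _ h3)); apply: C_ge.
  have : k <= M ^+ 4 * k by rewrite ler_peMl // exprn_ege1.
  lra.
Qed.

Lemma real_complex_norm (a : R) : `|a%:C| = `|a|%:C.
Proof. by rewrite normc_def /= expr0n /= addr0 sqrtr_sqr. Qed.

(** The real point xi is moved to the complex numbers, where P splits. *)
Lemma complex_root_near (P : {poly int}) (B : R) : P \is monic -> size P = 5%N ->
    0 <= B -> (map_poly intr P)^`().[xi] != 0 ->
    4 * `|(map_poly intr P).[xi]| <= `|(map_poly intr P)^`().[xi]| * B ->
  exists2 z : R[i], root (map_poly intr P) z & `|xi%:C - z| <= B%:C.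
Proof.
move=> Pm P5 B0 dn h.
have PC : map_poly intr P = map_poly (real_complex R) (map_poly intr P) :> {poly R[i]}.
  by rewrite -map_poly_comp; apply: eq_map_poly => a /=; rewrite rmorph_int.
have ev : (map_poly intr P).[xi%:C] = ((map_poly intr P).[xi])%:C by rewrite PC horner_map.
have dev : (map_poly intr P)^`().[xi%:C] = ((map_poly intr P)^`().[xi])%:C.
  by rewrite PC deriv_map horner_map.
apply: near_root.
- exact: monic_map.
- by rewrite size_map_poly_id0 // intr_eq0 lead_coef_eq0 monic_neq0.
- by rewrite ler0c.
- by rewrite dev; apply: contraNneq dn => /complexI ->.
- rewrite ev dev !real_complex_norm -rmorphM /= -[4](rmorph_nat (real_complex R)) -rmorphM lecR.
  exact: h.
Qed.

End Final.

Section HeightBound.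
Variables (R : realType) (xi : R) (m0 m1 m2 m3 : int).
Notation M := (M xi).
Notation P := (quartic m0 m1 m2 m3).

(** All coefficients of P are bounded by the height of any of its roots. *)
Lemma deriv_le_height (z : R[i]) : root (map_poly intr P) z ->
  `|(map_poly intr P)^`().[xi]| <= 10 * M ^+ 3 * (height z)%:R.
Proof.
move=> Pz; pose H : R := (height z)%:R; rewrite -/H.
have coef_le i : `|(P`_i)%:~R| <= H.
  by have := quartic_height_ge Pz i; rewrite -(ler_nat R) natr_absz intr_norm.
have H1 := coef_le 4%N; rewrite quartic_seq /= normr1 in H1.
have h1 := coef_le 1%N; have h2 := coef_le 2%N; have h3 := coef_le 3%N.
rewrite quartic_seq /= intrM in h1; rewrite quartic_seq /= intrM in h2.
rewrite quartic_seq /= intrM in h3.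
have M1 := M_ge1 xi; have M0 := M_ge0 xi; have xM := xi_leM xi.
have H0 : 0 <= H := le_trans ler01 H1.
have x2 : `|xi ^+ 2| <= M ^+ 2 by rewrite normrX ler_pXn2r ?nnegrE.
have x3 : `|xi ^+ 3| <= M ^+ 3 by rewrite normrX ler_pXn2r ?nnegrE.
have MM1 : M <= M ^+ 3 by rewrite ler_eXnr.
have MM2 : M ^+ 2 <= M ^+ 3 by rewrite ler_weXn2l.
have n (k : nat) (a B : R) : `|a| <= B -> `|k%:R * a| <= k%:R * B.
  by move=> h; apply: normM_le => //; rewrite normr_nat.
rewrite quartic_deriv_eval.
have -> : 4 * xi ^+ 3 + 12 * m3%:~R * xi ^+ 2 + 8 * m2%:~R * xi + 4 * m1%:~R =
  4 * xi ^+ 3 + 3 * (4 * m3%:~R * xi ^+ 2) + 2 * (4 * m2%:~R * xi) + 4 * m1%:~R :> R by ring.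
apply: (le_trans (normD_le (normD_le (normD_le (n 4%N _ _ x3) (n 3%N _ _ (normM_le h3 x2)))
  (n 2%N _ _ (normM_le h2 xM))) h1)).
have a1 : M ^+ 3 <= M ^+ 3 * H by rewrite ler_peMr ?exprn_ge0.
have a2 : H * M ^+ 2 <= M ^+ 3 * H by rewrite mulrC ler_wpM2r.
have a3 : H * M <= M ^+ 3 * H by rewrite mulrC ler_wpM2r.
have a4 : H <= M ^+ 3 * H by rewrite ler_peMl // exprn_ege1.
have -> : 10 * M ^+ 3 * H = 10 * (M ^+ 3 * H) by ring.
move: (M ^+ 3) (M ^+ 3 * H) (H * M ^+ 2) (H * M) a1 a2 a3 a4 => *; lra.
Qed.

End HeightBound.

Theorem mainTheorem2 (R : realType) (xi : R)
  (hxi : ~ (algebraic_number xi /\ (degreeQ xi <= 3)%N)) :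
  exists2 c : R, 0 < c &
    infinite_set [set alpha : R[i] |
      [/\ algebraic_integer alpha,
          (degreeQ alpha <= 4)%N &
          `|xi%:C - alpha|
            <= (c * ((height alpha)%:R `^ (- ((lambda3 R)^-1 + 1))))%:C]].
Proof.
have xi_deg (b : vec R) : intv b -> b <> @vec0 R -> ceval xi b <> 0.
  by move=> bi bn b0; apply: hxi; apply: ceval0_algebraic bi bn b0.
set l := lambda3 R.
have l0 : 0 < l by apply: lt_le_trans (lambda3_ge R); rewrite divr_gt0.
have [c c0 hc] := uniform_exponent xi_deg (lambda3_ge R) (lambda3_lt R) (lambda3_eq R).
rewrite -/l in hc.
have [K K0 tr] := transference xi.
pose A := 4 * K + 42 * M xi ^+ 4; pose D := A * (K / c); pose s := l^-1 + 1.
have Mp : 0 < M xi := lt_le_trans ltr01 (M_ge1 xi).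
have A0 : 0 < A by rewrite addr_gt0 // mulr_gt0 // exprn_gt0.
have D0 : 0 < D by rewrite mulr_gt0 // divr_gt0.
have s0 : 0 <= s by rewrite addr_ge0 // invr_ge0 ltW.
exists (16 * c * D `^ s); first by rewrite !mulr_gt0 // powR_gt0.
set S := [set alpha | _].
(* A finite set of numbers has bounded heights. *)
suff unbounded (N : nat) : exists2 alpha, S alpha & (N < height alpha)%N.
  move=> /finite_seqP[r rE].
  have [alpha Sa] := unbounded (\max_(z <- r) height z)%N.
  have ar : alpha \in r by move: Sa; rewrite rE.
  by rewrite ltnNge (leq_bigmax_seq (F := fun z => height z)).
pose q := c / K * (1 + 10 * M xi ^+ 3 * N.+1%:R).
have q0 : 0 <= q.
  by rewrite mulr_ge0 ?divr_ge0 ?(ltW c0) ?(ltW K0) // addr_ge0 // !mulr_ge0 ?exprn_ge0 // ltW.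
(* The lower bound on T makes T^lambda at least q, so that the derivative at xi is
   too large for a root of height at most N. *)
have [T BT noz] := hc (1 + q `^ l^-1).
have T1 : 1 <= T by apply: le_trans BT; rewrite lerDl powR_ge0.
have T0 : 0 < T := lt_le_trans ltr01 T1.
have Tl0 : 0 < T `^ l by rewrite powR_gt0.
pose delta := c * T `^ (- l).
have d0 : 0 < delta by rewrite mulr_gt0 // powR_gt0.
have kE : K / delta = K / c * T `^ l.
  by rewrite /delta powRN invfM invrK mulrA.
have qT : q <= T `^ l.
  have -> : q = (q `^ l^-1) `^ l by rewrite -powRrM mulVf ?gt_eqF // powRr1.
  apply: ge0_ler_powR; rewrite ?nnegrE ?powR_ge0 ?(ltW l0) ?(ltW T0) //.
  by apply: le_trans BT; rewrite lerDr.
have k_ge : 1 + 10 * M xi ^+ 3 * N.+1%:R <= K / delta.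
  have : K / c * q <= K / c * T `^ l by rewrite ler_pM2l // divr_gt0.
  rewrite -kE /q mulrA; apply: le_trans; rewrite le_eqVlt; apply/orP; left; apply/eqP.
  by field; rewrite !gt_eqF.
have MN0 : 0 <= 10 * M xi ^+ 3 * N.+1%:R by rewrite !mulr_ge0 ?exprn_ge0 // ltW.
have k1 : 1 <= K / delta by apply: le_trans k_ge; rewrite lerDl.
have [m0 [m1 [m2 [m3 [Pxi dPxi [b0 b1 b2 b3]]]]]] :=
  quartic_approximation K0 T1 d0 k1 (tr T delta T0 d0 noz).
set P := quartic m0 m1 m2 m3 in Pxi dPxi.
have k0 : 0 < K / delta := lt_le_trans ltr01 k1.
have dn : (map_poly intr P)^`().[xi] != 0.
  by rewrite -normr_gt0; apply: lt_le_trans dPxi.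
have B0 : 0 <= 16 * delta / T by rewrite divr_ge0 ?(ltW T0) // mulr_ge0 // ltW.
have P5 : size P = 5%N by rewrite quartic_seq.
have hB : 4 * `|(map_poly intr P).[xi]| <= `|(map_poly intr P)^`().[xi]| * (16 * delta / T).
  have : K / delta * (16 * delta / T) <= `|(map_poly intr P)^`().[xi]| * (16 * delta / T).
    by rewrite ler_wpM2r.
  apply: le_trans; have -> : K / delta * (16 * delta / T) = 4 * (4 * K / T).
    by field; rewrite !gt_eqF.
  by rewrite ler_pM2l.
have [alpha Pa near] := complex_root_near (quartic_monic m0 m1 m2 m3) P5 B0 dn hB.
have hN : (N < height alpha)%N.
  rewrite -(ltr_nat R).
  have := le_trans k_ge (le_trans dPxi (deriv_le_height xi Pa)).
  have M3 : 0 < 10 * M xi ^+ 3 by rewrite mulr_gt0 // exprn_gt0.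
  move=> h; have : 10 * M xi ^+ 3 * N.+1%:R <= 10 * M xi ^+ 3 * (height alpha)%:R by lra.
  by rewrite ler_pM2l // ler_nat ltr_nat.
exists alpha => //; split; [exact: quartic_integer Pa|exact: quartic_degree Pa|].
apply: (le_trans near); rewrite lecR.
have H0 : 0 < (height alpha)%:R :> R by rewrite ltr0n (leq_ltn_trans _ hN).
have Hle : (height alpha)%:R <= D * T `^ l.
  have -> : D * T `^ l = A * (K / delta) by rewrite kE /D -mulrA.
  apply: (quartic_height_le Pa) => //.
  apply: (le_trans k1); apply: ler_peMl; first exact: ltW.
  have : 1 <= M xi ^+ 4 by apply: exprn_ege1; apply: M_ge1.
  rewrite /A; lra.
have Hs : (height alpha)%:R `^ s <= D `^ s * (T `^ l * T).
  have -> : T `^ l * T = (T `^ l) `^ s.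
    by rewrite -powRrM /s mulrDr mulfV ?gt_eqF // mulr1 addrC powRD ?powRr1 ?(ltW T0) //
      ?(gt_eqF T0) ?implybT.
  rewrite -powRM ?(ltW D0) ?powR_ge0 //.
  by apply: ge0_ler_powR; rewrite ?nnegrE // mulr_ge0 ?(ltW D0) ?powR_ge0.
rewrite -/s powRN ler_pdivlMr ?powR_gt0 // /delta powRN.
have e : 16 * (c / T `^ l) / T * (D `^ s * (T `^ l * T)) = 16 * c * D `^ s.
  by field; rewrite !gt_eqF.
rewrite -e; apply: ler_wpM2l => //.
by rewrite divr_ge0 ?(ltW T0) // mulr_ge0 // divr_ge0 ?(ltW c0) ?(ltW Tl0).
Qed.
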